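(* For $\alpha\in\mathbb Z$ (and arbitrary $\beta$), the characters of $\mathrm{Ker}F_{(\alpha;\beta)}$ and $\mathrm{Coker}F_{(\alpha;\beta)}$ are given by $$ch_{\mathrm{Ker}F_{(\alpha;\beta)}}=ch_{\mathrm{Ker}F^{(0)}_{(\alpha;\beta)}}=\sum_{l=1}^\infty(-1)^{l+1}ch_{F^{(-l)}_{(\alpha;\beta)}}=\frac{q^{-\alpha(\alpha+1)}}{\prod_{n=1}^\infty(1-q^{2n})^3}\sum_{i,j\in\mathbb Z}\sum_{l=1}^\infty(-1)^{l+1}q^{l(l-1)+2l(\alpha-j)+(2i^2-2ij+j^2+j)}x^{2i-j}y^{\alpha-i},$$ $$ch_{\mathrm{Coker}F_{(\alpha;\beta)}}=ch_{\mathrm{Coker}F^{(0)}_{(\alpha;\beta)}}=\sum_{l=1}^\infty(-1)^{l+1}ch_{F^{(l)}_{(\alpha;\beta)}}=\frac{q^{-\alpha(\alpha+1)}}{\prod_{n=1}^\infty(1-q^{2n})^3}\sum_{i,j\in\mathbb Z}\sum_{l=1}^\infty(-1)^{l+1}q^{l(l+1)-2l(\alpha-j)+(2i^2-2ij+j^2+j)}x^{2i-j}y^{\alpha-i}.$$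
   Context: Let $[m]=\frac{q^m-q^{-m}}{q-q^{-1}}$. The bosonic $q$-oscillators $a^1_n,a^2_n,b_n,c_n$ ($n\in\mathbb Z$), $Q_{a^1},Q_{a^2},Q_b,Q_c$ have as only nonvanishing commutators (for $m\neq0$) $[a^i_m,a^j_n]=\delta_{ij}\delta_{m+n,0}\frac{[m]^2}{m}$, $[b_m,b_n]=-\delta_{m+n,0}\frac{[m]^2}{m}$, $[c_m,c_n]=\delta_{m+n,0}\frac{[m]^2}{m}$, and $[a^i_0,Q_{a^j}]=\delta_{ij}$, $[b_0,Q_b]=-1$, $[c_0,Q_c]=1$. Put $h^1_m=a^1_mq^{-|m|/2}-a^2_mq^{|m|/2}$ and $h^2_m=a^2_mq^{-|m|/2}+b_mq^{-|m|/2}$ for all $m\in\mathbb Z$. The vacuum $|0\rangle$ is annihilated by all $a^i_m,b_m,c_m$ with $m>0$ and by the zero modes. Put $|\lambda_{a^1},\lambda_{a^2},\lambda_b,\lambda_c\rangle=e^{\lambda_{a^1}Q_{a^1}+\lambda_{a^2}Q_{a^2}+\lambda_bQ_b+\lambda_cQ_c}|0\rangle$, and let $F_{\lambda_{a^1},\lambda_{a^2},\lambda_b,\lambda_c}$ be the bosonic Fock space generated over this vector by $a^1_{-m},a^2_{-m},b_{-m},c_{-m}$ ($m>0$). For $l\in\mathbb Z$, $$F^{(l)}_{(\alpha;\beta)}=\bigoplus_{i,j\in\mathbb Z}F_{\beta+i,\ \beta-i+j,\ \beta-\alpha+j,\ -\alpha+j+l},\qquad F_{(\alpha;\beta)}=F^{(0)}_{(\alpha;\beta)}.$$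 Let $c(z;0)=-\sum_{n\ne0}\frac{c_n}{[n]}z^{-n}+Q_c+c_0\ln z$, $\eta(z)=\sum_n\eta_nz^{-n-1}=:e^{c(z;0)}:$ and $\xi(z)=\sum_n\xi_nz^{-n}=:e^{-c(z;0)}:$, where $:\ :$ is bosonic normal ordering. Then $\eta_0:F^{(l)}_{(\alpha;\beta)}\to F^{(l+1)}_{(\alpha;\beta)}$, $\xi_0:F^{(l)}_{(\alpha;\beta)}\to F^{(l-1)}_{(\alpha;\beta)}$, $\eta_0\xi_0+\xi_0\eta_0=1$, $\eta_0^2=\xi_0^2=0$. Put $\mathrm{Ker}F_{(\alpha;\beta)}=\eta_0\xi_0F_{(\alpha;\beta)}$ and $\mathrm{Coker}F_{(\alpha;\beta)}=\xi_0\eta_0F_{(\alpha;\beta)}=F_{(\alpha;\beta)}/\eta_0\xi_0F_{(\alpha;\beta)}$ (and likewise with $F^{(0)}_{(\alpha;\beta)}=F_{(\alpha;\beta)}$). The level-one bosonization of $U_q(\widehat{sl}(2|1))$ acts on $F_{(\alpha;\beta)}$, and Ker and Coker are submodule and quotient module. The derivation operator is $$d=\sum_{m\ge1}\frac{m^2}{[m]^2}\{h^1_{-m}h^2_m+h^2_{-m}h^1_m+(q^m+q^{-m})h^2_{-m}h^2_m\}-\sum_{m\ge1}\frac{m^2}{[m]^2}c_{-m}c_m+h^1_0h^2_0+h^2_0h^2_0-\tfrac12c_0(c_0+1),$$ which commutes with $\eta_0,\xi_0$. The character of $V$ is $ch_V(q,x,y)=\mathrm{tr}_V(q^{-2d}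x^{h^1_0}y^{h^2_0})$.
   Formalization: The Fock spaces are generated by h^1_{-m}, h^2_{-m}, c_{-m} (m>0) instead of a^1_{-m}, a^2_{-m}, b_{-m}, c_{-m}: the boson q^m a^1_{-m}+a^2_{-m}+b_{-m} commutes with d, h^1_0, h^2_0, so on the larger space the traces do not exist. *)

(* Defs.v *)
From HB Require Import structures.
From mathcomp Require Import all_boot all_order all_algebra.
From mathcomp Require Import finmap.
From mathcomp Require Import monalg.
From mathcomp Require Import boolp classical_sets functions cardinality fsbigop.

Set Implicit Arguments.
Unset Strict Implicit.
Unset Printing Implicit Defensive.

Import Order.TTheory GRing.Theory Num.Theory.
Local Open Scope classical_set_scope.
Local Open Scope ring_scope.

(* 'I_4 labels the oscillators a^1, a^2, b, c in this order. *)
Definition sa1 : 'I_4 := 0.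
Definition sa2 : 'I_4 := 1.
Definition sb : 'I_4 := 2%:R.
Definition sc : 'I_4 := 3%:R.

Section Oscillators.
Variable C : numClosedFieldType.

(* A basis vector of the oscillator module is a charge
   (lambda_{a^1}, lambda_{a^2}, lambda_b, lambda_c) together with occupation
   numbers; the entry at (s, n) counts the factors s_{-(n+1)}. *)
Definition occupation := {fsfun 'I_4 * nat -> nat with 0%N}.
Definition fockbasis := ('rV[C]_4 * occupation)%type.
Definition fockmod := {malg C[fockbasis]}.

Definition linext (f : fockbasis -> fockmod) (v : fockmod) : fockmod :=
  \sum_(k <- msupp v) v@_k *: f k.

(* Sign of the commutators of a species: [b_m, b_n] and [b_0, Q_b] carry -1. *)
Definition signature (s : 'I_4) : C := if s == sb then -1 else 1.

(* The square root q^(1/2) is the parameter: only it makes q^(|m|/2) definite. *)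
Variable q12 : C.
Let q : C := q12 ^+ 2.

Definition qint (m : int) : C := (q ^ m - q ^ (- m)) / (q - q^-1).

(* s_{-(n+1)} multiplies by a variable, s_{n+1} is the matching multiple of the
   partial derivative, and s_0 acts on e^{lambda Q}|0> through
   [s_0, Q_s] = signature s. *)
Definition osc (s : 'I_4) (m : int) : fockmod -> fockmod :=
  linext (fun k => match m with
  | Posz 0 => (signature s * k.1 ord0 s) *: << k >>
  | Posz n.+1 =>
      (signature s * qint n.+1 ^+ 2 / n.+1%:R * (k.2 (s, n))%:R) *:
        << (k.1, [fsfun k.2 with (s, n) |-> (k.2 (s, n)).-1]) >>
  | Negz n => << (k.1, [fsfun k.2 with (s, n) |-> (k.2 (s, n)).+1]) >>
  end).

(* exp (lam_{a^1} Q_{a^1} + lam_{a^2} Q_{a^2} + lam_b Q_b + lam_c Q_c) *)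
Definition expQ (lam : 'rV[C]_4) : fockmod -> fockmod :=
  linext (fun k => << (k.1 + lam, k.2) >>).

Definition vacuum : fockmod := << (0, [fsfun]) >>.

Definition charged_vacuum (lam : 'rV[C]_4) : fockmod := expQ lam vacuum.

Definition h1 (m : int) (v : fockmod) : fockmod :=
  q12 ^ (- `|m|) *: osc sa1 m v - q12 ^ `|m| *: osc sa2 m v.

Definition h2 (m : int) (v : fockmod) : fockmod :=
  q12 ^ (- `|m|) *: osc sa2 m v + q12 ^ (- `|m|) *: osc sb m v.

Definition derivation (v : fockmod) : fockmod :=
  \sum_(m \in [set m : nat | (0 < m)%N])
     (m%:R ^+ 2 / qint m ^+ 2) *:
       (h1 (- m%:Z) (h2 m v) + h2 (- m%:Z) (h1 m v)
        + (q ^+ m + q ^- m) *: h2 (- m%:Z) (h2 m v))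
  - \sum_(m \in [set m : nat | (0 < m)%N])
     (m%:R ^+ 2 / qint m ^+ 2) *: osc sc (- m%:Z) (osc sc m v)
  + h1 0 (h2 0 v) + h2 0 (h2 0 v)
  - 2%:R^-1 *: osc sc 0 (osc sc 0 v + v).

(* For an operator-valued series u(t) = \sum_n u_n t^n with u_0 = 0, the
   coefficients of u(t)^k and of exp (u(t)); the latter sum stops at k = p
   because u(t)^k starts in degree k. *)
Fixpoint series_pow (u : nat -> fockmod -> fockmod) (k p : nat) (v : fockmod)
    : fockmod :=
  if k is k'.+1 then \sum_(i < p.+1) u i (series_pow u k' (p - i) v)
  else if p == 0%N then v else 0.

Definition series_exp (u : nat -> fockmod -> fockmod) (p : nat) (v : fockmod)
    : fockmod :=
  \sum_(k < p.+1) (k`!%:R)^-1 *: series_pow u k p v.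

(* Coefficients of z^n, resp. z^(-n), in the part of eps * c(z;0) containing
   the c_{-n}, resp. the c_n, with n > 0. *)
Definition c_creation (eps : C) (n : nat) (v : fockmod) : fockmod :=
  if n == 0%N then 0
  else (- eps / qint (- n%:Z)) *: osc sc (- n%:Z) v.
Definition c_annihilation (eps : C) (n : nat) (v : fockmod) : fockmod :=
  if n == 0%N then 0 else (- eps / qint n) *: osc sc n v.

(* The coefficient of z^n in z^{c_0}, namely the projection on the eigenspace
   c_0 = n; the components of non-integral c_0 are irrelevant here and dropped. *)
Definition zpow_c0 (n : int) : fockmod -> fockmod :=
  linext (fun k => if k.1 ord0 sc == n%:~R then << k >> else 0).

(* The coefficient of z^k in
     :exp (eps c(z;0)): = exp (eps c_-(z)) e^{eps Q_c} z^{eps c_0} exp (eps c_+(z))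
   for eps = 1, -1.  On a given vector only finitely many terms are nonzero. *)
Definition vertex_coef (eps k : int) (v : fockmod) : fockmod :=
  \sum_(t \in [set t : nat * int * nat |
                 t.1.1%:Z + eps * t.1.2 - t.2%:Z = k])
    series_exp (c_creation eps%:~R) t.1.1
      (expQ (eps%:~R *: delta_mx ord0 sc)
        (zpow_c0 t.1.2
          (series_exp (c_annihilation eps%:~R) t.2 v))).

Definition eta (n : int) : fockmod -> fockmod := vertex_coef 1 (- n - 1).
Definition xi (n : int) : fockmod -> fockmod := vertex_coef (-1) (- n).

(* The Fock space over |lam>, generated by the oscillators h^1_{-m}, h^2_{-m},
   c_{-m} (m > 0) through which the algebra acts.  The combination
   q^m a^1_{-m} + a^2_{-m} + b_{-m} commutes with every h^1_n, h^2_n, c_n, hence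
   with the derivation; were it included, all joint eigenspaces below would be
   infinite-dimensional and no trace would exist. *)
Inductive fock (lam : 'rV[C]_4) : fockmod -> Prop :=
| fock_vacuum : fock lam (charged_vacuum lam)
| fock_linear (a : C) u v : fock lam u -> fock lam v -> fock lam (a *: u + v)
| fock_h1 (m : nat) v : (0 < m)%N -> fock lam v -> fock lam (h1 (- m%:Z) v)
| fock_h2 (m : nat) v : (0 < m)%N -> fock lam v -> fock lam (h2 (- m%:Z) v)
| fock_c (m : nat) v : (0 < m)%N -> fock lam v -> fock lam (osc sc (- m%:Z) v).

Definition charge (alpha : int) (beta : C) (l i j : int) : 'rV[C]_4 :=
  \row_(s < 4) [:: beta + i%:~R;
                   beta - i%:~R + j%:~R;
                   beta - alpha%:~R + j%:~R;
                   - alpha%:~R + j%:~R + l%:~R]`_s.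

(* F^{(l)}_{(alpha;beta)}; the sum over (i, j) is direct because the charges
   are pairwise distinct. *)
Definition Fl (alpha : int) (beta : C) (l : int) : set fockmod :=
  [set v | exists (I : seq (int * int)) (w : int * int -> fockmod),
     (forall ij, fock (charge alpha beta l ij.1 ij.2) (w ij)) /\
     v = \sum_(ij <- I) w ij].

Definition F0 (alpha : int) (beta : C) : set fockmod := Fl alpha beta 0.

Definition Ker (W : set fockmod) : set fockmod := (eta 0 \o xi 0) @` W.
(* eta_0 xi_0 and xi_0 eta_0 are complementary projections, so this also
   represents the quotient W / eta_0 xi_0 W. *)
Definition Coker (W : set fockmod) : set fockmod := (xi 0 \o eta 0) @` W.

(* The vectors of W on which q^{-2d} x^{h^1_0} y^{h^2_0} acts as q^e x^a y^b. *)
Definition weight_space (W : set fockmod) (e a b : int) : set fockmod :=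
  [set v | [/\ W v, (- 2%:R) *: derivation v = e%:~R *: v,
               h1 0 v = a%:~R *: v & h2 0 v = b%:~R *: v]].

Definition has_dim (U : set fockmod) (n : nat) : Prop :=
  exists w : 'I_n -> fockmod,
    (forall c : 'I_n -> C, \sum_i c i *: w i = 0 -> forall i, c i = 0) /\
    (forall v, U v <-> exists c : 'I_n -> C, v = \sum_i c i *: w i).

(* d, h^1_0, h^2_0 are simultaneously diagonalizable on W, with finite
   multiplicities: the condition for the trace over W to exist. *)
Definition has_character (W : set fockmod) : Prop :=
  (forall v, W v -> exists (n : nat) (w : 'I_n -> fockmod),
     (forall i, exists e a b, weight_space W e a b (w i)) /\ v = \sum_i w i) /\
  (forall e a b, exists n, has_dim (weight_space W e a b) n).

End Oscillators.

(* Formal series in q, x, y and their inverses, with integer coefficients: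
   f e a b is the coefficient of q^e x^a y^b. *)
Definition fseries := int -> int -> int -> int.

(* tr_W (q^{-2d} x^{h^1_0} y^{h^2_0}); meaningful under [has_character W]. *)
Definition character (C : numClosedFieldType) (q12 : C)
    (W : set (fockmod C)) : fseries :=
  fun e a b => (xget 0%N [set n | has_dim (weight_space q12 W e a b) n])%:Z.

Definition monomial (e a b : int) : fseries :=
  fun e' a' b' => ((e' == e) && (a' == a) && (b' == b))%:R.

Definition fscale (c : int) (f : fseries) : fseries := fun e a b => c * f e a b.

(* Infinite sums and products of formal series are meaningful when each
   coefficient involves finitely many nonzero terms. *)
Definition fsummable (I : choiceType) (A : set I) (f : I -> fseries) : Prop :=
  forall e a b, finite_set [set i | A i /\ f i e a b <> 0].

Definition fsum (I : choiceType) (A : set I) (f : I -> fseries) : fseries :=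
  fun e a b => \sum_(i \in A) f i e a b.

Definition fmul_term (f g : fseries) (t : int * int * int) : fseries :=
  fun e a b =>
    f t.1.1 t.1.2 t.2 * g (e - t.1.1) (a - t.1.2) (b - t.2).

Definition fmulable (f g : fseries) : Prop := fsummable setT (fmul_term f g).

Definition fmul (f g : fseries) : fseries := fsum setT (fmul_term f g).

(* 1 / \prod_{n >= 1} (1 - q^{2n})^3: each factor is expanded as a geometric
   series, and factors and terms of degree > e do not affect the coefficient
   of q^e. *)
Definition inv_euler3_coef (e : nat) : int :=
  (\prod_(1 <= n < e.+1) (\sum_(k < e.+1) 'X^(2 * n * k)) ^+ 3 : {poly int})`_e.

Definition inv_euler3 : fseries := fun e a b =>
  if (0 <= e) && (a == 0) && (b == 0) then inv_euler3_coef `|e|%N else 0.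

Definition prefactor (alpha : int) : fseries :=
  fmul (monomial (- (alpha * (alpha + 1))) 0 0) inv_euler3.

Definition pos_nat : set nat := [set l | (0 < l)%N].

(* Index set i, j \in Z, l >= 1. *)
Definition theta_index : set (int * int * nat) := [set t | pos_nat t.2].

Definition ker_term (alpha : int) (t : int * int * nat) : fseries :=
  let: (i, j, l) := t in
  fscale ((-1) ^+ l.+1)
    (monomial (l%:Z * (l%:Z - 1) + 2 * l%:Z * (alpha - j)
               + (2 * i ^+ 2 - 2 * i * j + j ^+ 2 + j))
              (2 * i - j) (alpha - i)).

Definition coker_term (alpha : int) (t : int * int * nat) : fseries :=
  let: (i, j, l) := t in
  fscale ((-1) ^+ l.+1)
    (monomial (l%:Z * (l%:Z + 1) - 2 * l%:Z * (alpha - j)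
               + (2 * i ^+ 2 - 2 * i * j + j ^+ 2 + j))
              (2 * i - j) (alpha - i)).

(* Main.v *)
Require Import Defs.
From HB Require Import structures.
From mathcomp Require Import all_boot all_order all_algebra.
From mathcomp Require Import finmap monalg.
From mathcomp Require Import boolp classical_sets functions cardinality fsbigop.
From mathcomp Require Import zify ring.
Import Order.TTheory GRing.Theory Num.Theory.
Local Open Scope classical_set_scope.
Local Open Scope ring_scope.
Set Implicit Arguments.
Unset Strict Implicit.
Unset Printing Implicit Defensive.

(* The Fock space over |lam> consists of the polynomials in q^m h^1_{-m},
   q^m h^2_{-m}, c_{-m}; setting every a^2_{-m} to zero identifies it with the
   polynomials in a^1_{-m}, b_{-m}, c_{-m}, and since [d, X_{-m}] = - m X_{-m} for
   each generator, d is its zero-mode part minus the level.  In the sector where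
   c_0 = m, eta_0 and xi_0 are coefficients of products of a creation and an
   annihilation exponential, whose exchange relations give eta_0^2 = 0 and
   eta_0 xi_0 + xi_0 eta_0 = 1.  Hence, for a fixed weight, eta_0 makes the weight
   spaces of the F^(l) into a contractible complex: if s_l is the rank of eta_0 on
   the l-th one, of dimension n_l, then s_l + s_{l-1} = n_l, while Ker and Coker
   have dimensions s_{-1} and s_0.  As n_l vanishes for |l| large, both are
   alternating sums of the n_l.  Finally n_l counts occupation numbers of three
   species, which is what the Euler product generates. *)

(** Two difficulties shape the proof. The operators are infinite sums that become finite only on a
    given vector, with a length depending on it: each is replaced by a sum cut at an arbitrary large
    $N$, and the cutoff stays a free parameter so that one value can serve all vectors of an
    identity. Moreover monomials in the oscillators need not be eigenvectors of $d$. As [eta] and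
    [xi] involve the species $c$ alone, they commute with the removal of $a^2$; the complex is
    therefore studied on monomials free of $a^2$, where a weight is read off charge and level, and
    its dimensions are carried back. The exchange relations rest on $\exp(\sum_{i>0}\kappa (xy)^i/i)
    = (1-xy)^{-\kappa}$, with $\kappa=-1$ for equal and $\kappa=1$ for opposite signs of $c(z;0)$.
    They are proved on coefficients, by recursion from $t\frac{d}{dt}e^u = (t\frac{du}{dt})e^u$.
    Integrality of $\alpha$ makes $c_0$, hence the powers of $z$, integral. *)

HB.instance Definition _ (C : numClosedFieldType) :=
  GRing.Lmodule.copy (fockmod C) {malg C[fockbasis C]}.

(** * Oscillators acting on monomials *)

Section FreeModuleGeneric.
Variables (K : choiceType) (R : comNzRingType).

Lemma scaler_eq (V : lmodType R) (a b : R) (v : V) : a = b -> a *: v = b *: v.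
Proof. by move->. Qed.

(* Unlike [linearZ], this pins the function down, which keeps unification from
   unfolding the carrier of [fockmod]. *)
Lemma linearZE (V W : lmodType R) (f : {linear V -> W}) a v : f (a *: v) = a *: f v.
Proof. exact: linearZ. Qed.

Lemma linear_combD (V W : lmodType R) (f : {linear V -> W}) a b v w :
  f (a *: v + b *: w) = a *: f v + b *: f w.
Proof. by rewrite linearD !linearZ. Qed.

Lemma linear_combB (V W : lmodType R) (f : {linear V -> W}) a b v w :
  f (a *: v - b *: w) = a *: f v - b *: f w.
Proof. by rewrite linearB !linearZ. Qed.

Lemma mcoeffU1E k k' : (<< k >> : {malg R[K]})@_k' = (k == k')%:R.
Proof. by rewrite mcoeffU. Qed.

Lemma monalgEZ (v : {malg R[K]}) : v = \sum_(k <- msupp v) v@_k *: << k >>.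
Proof.
rewrite {1}[v]monalgE; apply: eq_bigr => k _.
by apply/malgP => k'; rewrite mcoeffZ !mcoeffU mulrnAr mulr1.
Qed.

Lemma diag_coef (f : K -> R) (v : {malg R[K]}) k :
  (\sum_(k' <- msupp v) v@_k' *: (f k' *: << k' >>) : {malg R[K]})@_k
    = f k * v@_k.
Proof.
rewrite raddf_sum /=; have [kv|kv] := msuppP v k; last first.
  rewrite mulr0 big1_seq // => k' /andP[_ k'v]; rewrite !mcoeffZ mcoeffU.
  by case: eqP k'v kv => [->->|] //; rewrite !mulr0.
rewrite (big_fsetD1 k) //= big1_seq ?addr0.
  by rewrite !mcoeffZ mcoeffUU mulr1 mulrC.
move=> k' /andP[_]; rewrite !inE !mcoeffZ mcoeffU => /andP[/negPf-> _].
by rewrite !mulr0.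
Qed.

End FreeModuleGeneric.

(* Sealed, so that vectors of the free module are compared syntactically. *)
HB.lock Definition ket (C : numClosedFieldType) (lam : 'rV[C]_4)
    (o : occupation) : fockmod C := << (lam, o) >>.

HB.lock Definition inc (o : occupation) x : occupation :=
  [fsfun o with x |-> (o x).+1].
HB.lock Definition dec (o : occupation) x : occupation :=
  [fsfun o with x |-> (o x).-1].

Section FreeModule.
Variable C : numClosedFieldType.
Implicit Types (k : fockbasis C) (v : fockmod C) (lam : 'rV[C]_4)
  (o : occupation).

Lemma linextEw (f : fockbasis C -> fockmod C) (A : {fset fockbasis C}) v :
  (msupp v `<=` A)%fset -> linext f v = \sum_(k <- A) v@_k *: f k.
Proof.
move=> sA; rewrite /linext (big_fset_incl _ sA) //= => k _ kv.
by rewrite mcoeff_outdom // scale0r.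
Qed.

Lemma linext_linear (f : fockbasis C -> fockmod C) : linear (linext f).
Proof.
move=> a u v; pose A := (msupp (a *: u + v) `|` (msupp u `|` msupp v))%fset.
rewrite !(@linextEw f A) ?fsubsetUl //; last first.
- by rewrite /A fsetUA -fsetUA fsubsetU // fsubsetUl orbT.
- by rewrite /A fsetUA fsubsetUr.
rewrite scaler_sumr -big_split /=; apply: eq_bigr => k _.
by rewrite mcoeffD mcoeffZ scalerDl scalerA.
Qed.
HB.instance Definition _ (f : fockbasis C -> fockmod C) :=
  GRing.isLinear.Build C (fockmod C) (fockmod C) *:%R (linext f)
    (linext_linear f).

Lemma linextU (f : fockbasis C -> fockmod C) lam o : linext f (ket lam o) = f (lam, o).
Proof.
rewrite ket.unlock (@linextEw _ [fset (lam, o)]%fset) ?msuppU_le //.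
by rewrite big_seq_fset1 mcoeffUU scale1r.
Qed.

Lemma linear_eq (W : lmodType C) (f g : {linear fockmod C -> W}) :
  (forall lam o, f (ket lam o) = g (ket lam o)) -> f =1 g.
Proof.
move=> fg v; rewrite [v]monalgEZ !linear_sum; apply: eq_bigr => -[lam o] _.
by rewrite !linearZ; have := fg lam o; rewrite ket.unlock => ->.
Qed.

Lemma linext_coef (f : fockbasis C -> C) v k :
  (linext (fun k' => f k' *: << k' >>) v)@_k = f k * v@_k.
Proof. exact: diag_coef. Qed.

End FreeModule.

Section Occupation.
Implicit Types (o : occupation).

Lemma incE o x y : inc o x y = (o y + (y == x))%N.
Proof.
by rewrite inc.unlock fsfun_withE; case: eqP => [->|_]; rewrite (addn1, addn0).
Qed.
Lemma decE o x y : dec o x y = (o y - (y == x))%N.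
Proof.
by rewrite dec.unlock fsfun_withE; case: eqP => [->|_]; rewrite (subn1, subn0).
Qed.

Lemma incC o x y : inc (inc o x) y = inc (inc o y) x.
Proof. by apply/fsfunP => z; rewrite !incE addnAC. Qed.
Lemma decC o x y : dec (dec o x) y = dec (dec o y) x.
Proof. by apply/fsfunP => z; rewrite !decE subnAC. Qed.
Lemma incK o x : dec (inc o x) x = o.
Proof. by apply/fsfunP => z; rewrite decE incE addnK. Qed.
Lemma decK o x : (0 < o x)%N -> inc (dec o x) x = o.
Proof.
by move=> ox; apply/fsfunP => z; rewrite incE decE; case: eqP => [->|]; lia.
Qed.
Lemma dec_inc o x y : x != y -> dec (inc o x) y = inc (dec o y) x.
Proof.
move=> xy; apply/fsfunP => z; rewrite !incE !decE incE.
by case: (z =P x) => [->|]; rewrite ?(negPf xy) //=; lia.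
Qed.

End Occupation.

Section OscillatorAlgebra.
Variables (C : numClosedFieldType) (q12 : C).
Notation V := (fockmod C).
Implicit Types (v : V) (lam : 'rV[C]_4) (o : occupation).

HB.instance Definition _ s m := GRing.isLinear.Build C V V *:%R (osc q12 s m)
  (linext_linear _).
HB.instance Definition _ lam := GRing.isLinear.Build C V V *:%R (@expQ C lam)
  (linext_linear _).
HB.instance Definition _ n := GRing.isLinear.Build C V V *:%R (@zpow_c0 C n)
  (linext_linear _).

Lemma oscZ s m a v : osc q12 s m (a *: v) = a *: osc q12 s m v.
Proof. exact: linearZ. Qed.

Lemma oscU0 s lam o :
  osc q12 s 0 (ket lam o) = (signature C s * lam ord0 s) *: ket lam o.
Proof. by rewrite /osc linextU ket.unlock. Qed.
Lemma oscUN s n lam o :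
  osc q12 s (- n.+1%:Z) (ket lam o) = ket lam (inc o (s, n)).
Proof. by rewrite -NegzE /osc linextU ket.unlock inc.unlock. Qed.
(** Up to [signature], the scalar $[s_n, s_{-n}]$. *)
Definition gram (n : nat) : C := qint q12 n ^+ 2 / n%:R.
Lemma oscUP s n lam o : osc q12 s n.+1%:Z (ket lam o) =
  (signature C s * gram n.+1 * (o (s, n))%:R) *: ket lam (dec o (s, n)).
Proof. by rewrite /osc linextU ket.unlock dec.unlock /gram mulrA. Qed.

Lemma expQU lam mu o : expQ lam (ket mu o) = ket (mu + lam) o.
Proof. by rewrite /expQ linextU ket.unlock. Qed.

Lemma zpowU n lam o : zpow_c0 n (ket lam o) =
  (lam ord0 sc == n%:~R)%:R *: ket lam o.
Proof.
by rewrite /zpow_c0 linextU ket.unlock; case: eqP; rewrite ?scale1r ?scale0r.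
Qed.

Lemma osc_creationC s t m n v :
  osc q12 s (- m%:Z) (osc q12 t (- n%:Z) v) =
  osc q12 t (- n%:Z) (osc q12 s (- m%:Z) v).
Proof.
move: v; apply: (linear_eq (f := osc q12 s _ \o osc q12 t _)
                           (g := osc q12 t _ \o osc q12 s _)) => lam o /=.
case: m => [|m]; case: n => [|n]; rewrite ?oppr0.
- by rewrite !oscU0 !oscZ !oscU0 !scalerA mulrC.
- by rewrite oscU0 oscUN oscZ oscUN oscU0.
- by rewrite oscU0 oscUN oscZ oscUN oscU0.
- by rewrite !oscUN incC.
Qed.

Lemma osc_annihilationC s t (m n : nat) v :
  osc q12 s m (osc q12 t n v) = osc q12 t n (osc q12 s m v).
Proof.
move: v; apply: (linear_eq (f := osc q12 s m \o osc q12 t n)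
                           (g := osc q12 t n \o osc q12 s m)) => lam o /=.
case: m => [|m]; case: n => [|n].
- by rewrite !oscU0 !oscZ !oscU0 !scalerA mulrC.
- by rewrite oscU0 oscUP !oscZ oscUP oscU0 !scalerA mulrC.
- by rewrite oscU0 oscUP !oscZ oscUP oscU0 !scalerA mulrC.
rewrite !oscUP !oscZ !oscUP !scalerA !decE decC.
case: (eqVneq (s, m) (t, n)) => [[-> ->] //|neq].
by rewrite !subn0 mulrC.
Qed.

Lemma osc_zeroC s t m v :
  osc q12 s 0 (osc q12 t m v) = osc q12 t m (osc q12 s 0 v).
Proof.
move: v; apply: (linear_eq (f := osc q12 s 0 \o osc q12 t m)
                           (g := osc q12 t m \o osc q12 s 0)) => lam o /=.
case: m => [[|m]|m]; rewrite ?NegzE.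
- by rewrite !oscU0 !oscZ !oscU0 !scalerA mulrC.
- by rewrite oscU0 oscUP !oscZ oscUP oscU0 !scalerA mulrC.
- by rewrite oscU0 oscUN oscZ oscUN oscU0.
Qed.

Lemma osc_comm s t (m n : nat) v : (0 < m)%N -> (0 < n)%N ->
  osc q12 s m (osc q12 t (- n%:Z) v) = osc q12 t (- n%:Z) (osc q12 s m v)
    + (((s == t) && (m == n))%:R * signature C s * gram m) *: v.
Proof.
case: m n => [//|m] [//|n] _ _; move: v.
pose c := (((s == t) && (m == n))%:R * signature C s * gram m.+1).
pose g := osc q12 t (- n.+1%:Z) \o osc q12 s m.+1 \+ c *: (@idfun V).
apply: (linear_eq (f := osc q12 s m.+1 \o osc q12 t (- n.+1%:Z)) (g := g)) => lam o.
rewrite /g /= -/c oscUN !oscUP oscZ oscUN incE /c -xpair_eqE.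
case: (eqVneq (s, m) (t, n)) => [[-> ->]|neq]; last first.
  by rewrite addn0 dec_inc 1?eq_sym // !mul0r scale0r addr0.
rewrite mul1r incK.
case: (posnP (o (t, n))) => [o0|o_gt0].
  by rewrite o0 mulr1 mulr0 scale0r add0r.
by rewrite decK // -scalerDl addn1 -natr1 mulrDr mulr1.
Qed.

Hypothesis q12_neq0 : q12 != 0.
Hypothesis q_generic : forall n : nat, (0 < n)%N -> (q12 ^+ 2) ^+ n != 1.

Lemma qnat_neq0 n : (0 < n)%N -> (q12 ^+ 2) ^+ n - (q12 ^+ 2) ^- n != 0.
Proof.
move=> n0; rewrite subr_eq0; apply/eqP => qn.
have qn0 : q12 ^+ 2 ^+ n != 0 by rewrite !expf_neq0.
have /negP[] := q_generic (n := (n + n)%N) ltac:(lia).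
by rewrite exprD {2}qn mulfV.
Qed.

Lemma qint_neq0 n : (0 < n)%N -> qint q12 n != 0.
Proof.
move=> n0; rewrite /qint mulf_neq0 //.
  by rewrite -invr_expz qnat_neq0.
by rewrite invr_neq0 // (qnat_neq0 (n := 1)).
Qed.

Lemma qintN n : qint q12 (- n) = - qint q12 n.
Proof. by rewrite /qint opprK -mulNr opprB. Qed.

End OscillatorAlgebra.

(* Otherwise unification computes in the free module when two sums differ. *)
#[global] Opaque fgscale fgadd fgopp fgzero mkmalg mkmalgU mcoeff msupp linext
  osc expQ zpow_c0 qint.

(** * Exponentials of series of operators *)

Section SeriesExp.
Variables (C : numFieldType) (V : lmodType C).
Implicit Types (v : V).

Lemma exchange_triangle (W : nmodType) p (F : nat -> nat -> W) :
  \sum_(i < p.+1) \sum_(j < (p - i).+1) F i j =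
  \sum_(j < p.+1) \sum_(i < (p - j).+1) F i j.
Proof.
have tri (G : nat -> nat -> W) : \sum_(i < p.+1) \sum_(j < (p - i).+1) G i j =
    \sum_(i < p.+1) \sum_(j < p.+1 | (i + j <= p)%N) G i j.
  apply: eq_bigr => i _; have ip : ((p - i).+1 <= p.+1)%N by rewrite ltnS leq_subr.
  rewrite (big_ord_widen _ (G i) ip); apply: eq_bigl => j.
  by rewrite ltnS; have := ltn_ord i; lia.
rewrite tri (tri (fun j i => F i j)) (exchange_big_dep xpredT) //=.
by apply: eq_bigr => j _; apply: eq_bigl => i; rewrite addnC.
Qed.

(** [series_pow] and [series_exp] over an arbitrary module; at the Fock module they are convertible
    to the originals. *)
Fixpoint spow (u : nat -> V -> V) (k p : nat) (v : V) : V :=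
  if k is k'.+1 then \sum_(i < p.+1) u i (spow u k' (p - i) v)
  else if p == 0%N then v else 0.

Definition sexp (u : nat -> V -> V) (p : nat) (v : V) : V :=
  \sum_(k < p.+1) (k`!%:R)^-1 *: spow u k p v.

Lemma sexp0 (u : nat -> V -> V) v : sexp u 0 v = v.
Proof. by rewrite /sexp big_ord1 /= invr1 scale1r. Qed.

Variable u : nat -> {linear V -> V}.

Lemma spow_linear k p : linear (spow u k p).
Proof.
elim: k p => [|k IH] p a v w /=; first by case: eqP; rewrite ?scaler0 ?addr0.
rewrite scaler_sumr -big_split /=; apply: eq_bigr => i _.
by rewrite IH linearP.
Qed.
HB.instance Definition _ k p := GRing.isLinear.Build C V V *:%R
  (spow u k p) (spow_linear k p).

Lemma sexp_linear p : linear (sexp u p).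
Proof.
move=> a v w; rewrite /sexp scaler_sumr -big_split /=.
by apply: eq_bigr => i _; rewrite linearP scalerDr !scalerA mulrC.
Qed.
HB.instance Definition _ p := GRing.isLinear.Build C V V *:%R
  (sexp u p) (sexp_linear p).

Lemma spow_graded (A : {linear V -> V}) (c : C) :
  (forall i v, A (u i v) = u i (A v) + (c * i%:R) *: u i v) ->
  forall k p v, A (spow u k p v) =
    spow u k p (A v) + (c * p%:R) *: spow u k p v.
Proof.
move=> Au; elim=> [|k IH] p v /=.
  by case: eqP => [->|_]; rewrite ?linear0 ?mulr0 ?scale0r ?scaler0 addr0.
rewrite linear_sum scaler_sumr -big_split /=; apply: eq_bigr => i _.
rewrite Au IH linearD linearZ -addrA -scalerDl; congr (_ + _ *: _).
by rewrite -mulrDr -natrD subnK // -ltnS.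
Qed.

(** [u i] stands at $t^i$, so commutators proportional to $i$ add up to $cp$ in degree $p$, whatever
    the power of $u$. This serves the level with $c=\pm1$ and plain commutation with $c=0$. *)
Lemma sexp_graded (A : {linear V -> V}) (c : C) :
  (forall i v, A (u i v) = u i (A v) + (c * i%:R) *: u i v) ->
  forall p v, A (sexp u p v) =
    sexp u p (A v) + (c * p%:R) *: sexp u p v.
Proof.
move=> Au p v; rewrite /sexp linear_sum scaler_sumr -big_split /=.
apply: eq_bigr => k _; rewrite linearZ /= (spow_graded Au) scalerDr.
by rewrite !scalerA [_^-1 * _]mulrC.
Qed.

Lemma sexp_comm (A : {linear V -> V}) :
  (forall i v, A (u i v) = u i (A v)) ->
  forall p v, A (sexp u p v) = sexp u p (A v).
Proof.
move=> Au p v; rewrite (@sexp_graded A 0) ?mul0r ?scale0r ?addr0 // => i w.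
by rewrite mul0r scale0r addr0.
Qed.

Hypothesis u0 : forall v, u 0 v = 0.
Hypothesis uC : forall i j v, u i (u j v) = u j (u i v).

Lemma spow_eq0 k p v : (p < k)%N -> spow u k p v = 0.
Proof.
elim: k p v => [//|k IH] p v pk /=; apply: big1 => -[[|i] /= ip] _.
  by rewrite u0.
by rewrite IH ?linear0 //; lia.
Qed.

(* The coefficients of [t * d/dt u(t)^(k+1) = (k+1) * (t * d/dt u(t)) * u(t)^k]. *)
Lemma spow_deriv k p v : p%:R *: spow u k.+1 p v =
  k.+1%:R *: \sum_(i < p.+1) i%:R *: u i (spow u k (p - i) v).
Proof.
elim: k p v => [|k IH] p v.
  rewrite scale1r /= scaler_sumr; apply: eq_bigr => i _.
  have [ip|ip] := eqVneq (p - i)%N 0%N; last by rewrite !linear0.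
  by have -> : val i = p by have := ltn_ord i; rewrite /=; lia.
have -> : spow u k.+2 p v = \sum_(i < p.+1) u i (spow u k.+1 (p - i)%N v) by [].
have -> : p%:R *: (\sum_(i < p.+1) u i (spow u k.+1 (p - i)%N v)) =
    \sum_(i < p.+1) i%:R *: u i (spow u k.+1 (p - i)%N v) +
    \sum_(i < p.+1) u i ((p - i)%:R *: spow u k.+1 (p - i)%N v).
  rewrite scaler_sumr -big_split /=; apply: eq_bigr => i _.
  by rewrite linearZ -scalerDl -natrD subnKC // -ltnS.
rewrite -[in RHS]addn1 natrD scalerDl scale1r addrC; congr (_ + _).
under eq_bigr do rewrite IH linearZ /=.
rewrite -scaler_sumr; congr (_ *: _).
under eq_bigr do rewrite linear_sum.
pose F i j := u i (j%:R *: u j (spow u k (p - i - j)%N v)).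
rewrite (exchange_triangle p F) /F; apply: eq_bigr => j _.
rewrite /= linear_sum scaler_sumr; apply: eq_bigr => i _.
by rewrite linearZ /= uC subnAC.
Qed.

(** The degree $p$ part of $t\frac{d}{dt}e^u = (t\frac{du}{dt})e^u$. For $p\neq0$ it determines a
    coefficient from lower ones, which is how the later identities avoid expanding into powers. *)
Lemma sexp_deriv p v : p%:R *: sexp u p v =
  \sum_(i < p.+1) i%:R *: u i (sexp u (p - i) v).
Proof.
rewrite /sexp scaler_sumr big_ord_recl /=.
have -> : p%:R *: (0`!%:R^-1 *: (if p == 0 then v else 0)) = 0 :> V.
  by case: eqP => [->|]; rewrite ?scale0r ?scaler0.
rewrite add0r.
transitivity (\sum_(k < p) \sum_(i < p.+1)
    i%:R *: u i (k`!%:R^-1 *: spow u k (p - i) v)).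
  apply: eq_bigr => k _; rewrite scalerA mulrC -scalerA spow_deriv.
  rewrite scalerA factS natrM invfM mulrAC mulVf ?pnatr_eq0 // mul1r scaler_sumr.
  by apply: eq_bigr => i _; rewrite [u _ (_ *: _)]linearZ /= !scalerA mulrC.
rewrite exchange_big /=; apply: eq_bigr => -[[|i] /= ip] _.
  by rewrite scale0r big1 // => k _; rewrite scale0r.
rewrite -scaler_sumr -linear_sum /=; congr (_ *: u _ _).
(* The two sums over $k$ have different lengths; the surplus powers vanish because $u$ starts in
   degree 1. *)
have le : ((p - i.+1).+1 <= p)%N by lia.
rewrite (big_ord_widen _ (fun k => k`!%:R^-1 *: spow u k (p - i.+1) v) le).
rewrite [RHS]big_mkcond; apply: eq_bigr => k _; case: ltnP => // lek.
by rewrite spow_eq0 ?scaler0.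
Qed.

End SeriesExp.

Lemma telescope_ord (V : zmodType) (F : nat -> V) N :
  \sum_(i < N) (F i - F i.+1) = F 0%N - F N.
Proof.
rewrite -(big_mkord xpredT (fun i => F i - F i.+1)).
rewrite -[RHS]opprB -telescope_sumr // -sumrN.
by apply: eq_bigr => i _; rewrite opprB.
Qed.

Section IntExp.
Variables (C : numFieldType) (V : lmodType C).
Implicit Types (v : V) (u t w : nat -> {linear V -> V}).

(** Zero in negative degrees, so that shifted degrees are integers and not truncated differences. *)
Definition sexpz (u : nat -> V -> V) (n : int) (v : V) : V :=
  if n is Posz p then sexp u p v else 0.

Lemma sexpz_linear u n : linear (sexpz u n).
Proof.
move=> a v w; case: n => [p|p] /=; first by rewrite linearP.
by rewrite scaler0 addr0.
Qed.
HB.instance Definition _ u n := GRing.isLinear.Build C V V *:%R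
  (sexpz u n) (sexpz_linear u n).

Lemma sexpz_lt0 (u : nat -> V -> V) n v : n < 0 -> sexpz u n v = 0.
Proof. by case: n. Qed.

Arguments sexpz_lt0 u [n] v _.

Lemma sexpz0 (u : nat -> V -> V) v : sexpz u 0 v = v.
Proof. exact: sexp0. Qed.

Lemma sexpz_comm u (A : {linear V -> V}) :
  (forall i v, A (u i v) = u i (A v)) ->
  forall n v, A (sexpz u n v) = sexpz u n (A v).
Proof.
by move=> Au [p|p] v /=; rewrite ?linear0 //; exact: sexp_comm.
Qed.

Lemma sexpz_graded u (A : {linear V -> V}) (c : C) :
  (forall i v, A (u i v) = u i (A v) + (c * i%:R) *: u i v) ->
  forall n v, A (sexpz u n v) =
    sexpz u n (A v) + (c * n%:~R) *: sexpz u n v.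
Proof.
move=> Au [p|p] v /=; first exact: sexp_graded.
by rewrite linear0 scaler0 addr0.
Qed.

Lemma sexpzC u t : (forall i j v, u i (t j v) = t j (u i v)) ->
  forall m n v, sexpz u m (sexpz t n v) = sexpz t n (sexpz u m v).
Proof.
move=> ut m n v; apply: (sexpz_comm (A := sexpz u m)) => i w.
by apply/esym/(sexpz_comm (A := t i)) => j x; rewrite ut.
Qed.

(** The upper end $N$ is arbitrary above $n$: sums belonging to different degrees can share one
    range and be compared termwise. *)
Lemma sexpz_deriv u : (forall v, u 0%N v = 0) ->
  (forall i j v, u i (u j v) = u j (u i v)) ->
  forall (n : int) (N : nat) v, n <= N%:Z -> n%:~R *: sexpz u n v =
    \sum_(i < N) i.+1%:R *: u i.+1 (sexpz u (n - i.+1%:Z) v).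
Proof.
move=> u0 uC [p|p] N v nN; last first.
  by rewrite scaler0 big1 // => i _; rewrite sexpz_lt0 ?linear0 ?scaler0 //; lia.
rewrite [LHS](sexp_deriv u0 uC) big_ord_recl scale0r add0r /=.
have pN : (p <= N)%N by lia.
rewrite (big_ord_widen _ (fun i => i.+1%:R *: u i.+1 (sexp u (p - i.+1) v)) pN).
rewrite big_mkcond; apply: eq_bigr => i _; case: ltnP => ip.
  by have -> : p%:Z - i.+1%:Z = (p - i.+1)%N%:Z by lia.
by rewrite sexpz_lt0 ?linear0 ?scaler0 //; lia.
Qed.

Section Commutation.
Variables (u t : nat -> {linear V -> V}) (kappa : C).
Hypothesis u0 : forall v, u 0%N v = 0.
Hypothesis t0 : forall v, t 0%N v = 0.
Hypothesis uC : forall i j v, u i (u j v) = u j (u i v).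
Hypothesis tC : forall i j v, t i (t j v) = t j (t i v).
Hypothesis tu : forall i j v, t i.+1 (u j.+1 v) =
  u j.+1 (t i.+1 v) + ((i == j)%:R * (kappa / i.+1%:R)) *: v.
Notation S := (sexpz u).
Notation T := (sexpz t).

(** Since the commutator is a scalar, $[t_i, e^u] = [t_i, u]\,e^u$; the factor $[t_i,u]$ sits in
    degree $i$, whence the shift. *)
Lemma mode_sexpz i n v : t i.+1 (S n v) =
  S n (t i.+1 v) + (kappa / i.+1%:R) *: S (n - i.+1%:Z) v.
Proof.
pose c := kappa / i.+1%:R; rewrite -/c.
have [N] : exists N : nat, n <= N%:Z by exists `|n|%N; lia.
elim: N n => [|N IH] n nN.
  have [->|n0] : n = 0 \/ n < 0 by lia.
    by rewrite !sexpz0 sexpz_lt0 // scaler0 addr0.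
  by rewrite !sexpz_lt0 ?linear0 ?scaler0 ?addr0 //; lia.
have [n0|n0] := eqVneq n 0; first by apply: IH; lia.
apply: (@scalerI _ _ n%:~R); first by rewrite intr_eq0.
rewrite -linearZ (sexpz_deriv u0 uC _ nN) linear_sum.
pose G (j : nat) := (i == j)%:R * (j.+1%:R * c) *: S (n - j.+1%:Z) v.
pose H (j : nat) := c *: (j.+1%:R *: u j.+1 (S (n - i.+1%:Z - j.+1%:Z) v)).
transitivity (\sum_(j < N.+1)
    (j.+1%:R *: u j.+1 (S (n - j.+1%:Z) (t i.+1 v)) + H j + G j)).
  apply: eq_bigr => j _; rewrite [t _ (_ *: _)]linearZ /= tu IH; last by lia.
  rewrite -/c [u _ (_ + _)]linearD /= [u _ (c *: _)]linearZ /= !scalerDr /H /G.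
  rewrite !scalerA; congr (_ + _ + _ *: _); last by rewrite mulrCA.
  by rewrite [c * _]mulrC; congr (_ *: u _ (S _ _)); lia.
rewrite !big_split /= -(sexpz_deriv u0 uC _ nN) -scaler_sumr.
rewrite -(sexpz_deriv u0 uC); last by lia.
rewrite scalerDr -addrA; congr (_ + _).
(* The terms [H] from the induction hypothesis resum to $n-(i+1)$ copies, the direct commutator [G]
   gives $i+1$ copies: $n$ in all. *)
transitivity (c *: ((n - i.+1%:Z)%:~R *: S (n - i.+1%:Z) v)
    + (i.+1%:R * c) *: S (n - i.+1%:Z) v); last first.
  rewrite scalerA -scalerDl scalerA; congr (_ *: _).
  by rewrite intrD mulrNz -pmulrn mulrDr mulrN [i.+1%:R * c]mulrC subrK mulrC.
congr (_ + _); have [iN|iN] := ltnP i N.+1.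
  rewrite (bigD1 (Ordinal iN)) //= big1 ?addr0 /G ?eqxx ?mul1r //.
  move=> j /negPf ji; suff -> : (i == j) = false by rewrite mul0r scale0r.
  by apply: contraFF ji => /eqP ij; apply/eqP/val_inj.
rewrite sexpz_lt0 ?scaler0 ?big1 //; last by lia.
move=> j _; rewrite /G; suff -> : (i == j) = false by rewrite mul0r scale0r.
by apply/eqP => ij; have := ltn_ord j; lia.
Qed.

(** The coefficient of $x^r y^p$ in $e^{t(x)}e^{u(y)} = (1-xy)\,e^{u(y)}e^{t(x)}$, by induction on
    $r$ through the recursion for $e^t$. *)
Lemma sexpz_commN : kappa = -1 -> forall r p v,
  T r (S p v) = S p (T r v) - S (p - 1) (T (r - 1) v).
Proof.
move=> k1 r p v.
have [N] : exists N : nat, r <= N%:Z by exists `|r|%N; lia.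
elim: N r => [|N IH] r rN.
  have [->|r0] : r = 0 \/ r < 0 by lia.
    by rewrite !sexpz0 [T _ _]sexpz_lt0 // linear0 subr0.
  by rewrite !(sexpz_lt0 t) ?linear0 ?addr0 //; lia.
have [r0|r0] := eqVneq r 0; first by apply: IH; lia.
apply: (@scalerI _ _ r%:~R); first by rewrite intr_eq0.
rewrite (sexpz_deriv t0 tC _ rN).
(* [F] collects what arises when $t_{i+1}$ crosses $e^u$. The two terms of the induction hypothesis
   give [F i] and [F i.+1] with opposite signs, so only [F 0] survives; it raises the factor $r-1$
   of the second term to $r$. *)
pose F (i : nat) := S (p - i.+1%:Z) (T (r - i.+1%:Z) v).
transitivity (\sum_(i < N.+1)
    (S p (i.+1%:R *: t i.+1 (T (r - i.+1%:Z) v))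
     - S (p - 1) (i.+1%:R *: t i.+1 (T (r - 1 - i.+1%:Z) v))
     - (F i - F i.+1))).
  apply: eq_bigr => i _; rewrite IH; last by lia.
  have -> : r - i.+1%:Z - 1 = r - 1 - i.+1%:Z by lia.
  rewrite linearB /= !mode_sexpz k1 !linearZ /=.
  have -> : p - 1 - i.+1%:Z = p - i.+2%:Z by lia.
  have -> : r - 1 - i.+1%:Z = r - i.+2%:Z by lia.
  rewrite scalerBr !scalerDr !scalerA mulrC mulfVK ?pnatr_eq0 // !scaleN1r.
  by rewrite /F ?scalerN !opprD !opprK !addrA; congr (_ + _); rewrite addrAC.
rewrite !big_split /= !sumrN telescope_ord -!linear_sum /=.
rewrite -(sexpz_deriv t0 tC _ rN) -(sexpz_deriv t0 tC); last by lia.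
have -> : F N.+1 = 0 by rewrite /F (sexpz_lt0 t) ?linear0 //; lia.
have -> : F 0%N = S (p - 1) (T (r - 1) v) by [].
rewrite subr0 [S p (_ *: _)]linearZ [S (p - 1) (_ *: _)]linearZ /=.
rewrite scalerBr -addrA -opprD; congr (_ - _).
by rewrite intrD scalerDl mulrNz scaleNr scale1r subrK.
Qed.

(** Now the exchange factor is $(1-xy)^{-1}$; multiplying it out keeps the identity finite. *)
Lemma sexpz_comm1 : kappa = 1 -> forall r p v,
  T r (S p v) - T (r - 1) (S (p - 1) v) = S p (T r v).
Proof.
move=> k1 r p v.
have [N] : exists N : nat, r <= N%:Z by exists `|r|%N; lia.
elim: N r p => [|N IH] r p rN.
  have [->|r0] : r = 0 \/ r < 0 by lia.
    by rewrite !sexpz0 [T _ _]sexpz_lt0 // subr0.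
  by rewrite !(sexpz_lt0 t) ?linear0 ?addr0 //; lia.
have [r0|r0] := eqVneq r 0; first by apply: IH; lia.
apply: (@scalerI _ _ r%:~R); first by rewrite intr_eq0.
pose F (i : nat) := T (r - i.+1%:Z) (S (p - i.+1%:Z) v).
have F0 : F 0%N = T (r - 1) (S (p - 1) v) by [].
have FN : F N.+1 = 0 by rewrite /F (sexpz_lt0 t) //; lia.
have rE : r%:~R = (r - 1)%:~R + 1 :> C by rewrite intrD mulrNz subrK.
(* The recursion in degree $r-1$ absorbs only $r-1$ of the $r$ copies; the remaining one is written
   as a telescoping sum of [F] to be matched termwise. *)
rewrite scalerBr {2}rE scalerDl scale1r opprD addrA.
rewrite (sexpz_deriv t0 tC _ rN) (@sexpz_deriv t t0 tC (r - 1) N.+1); last by lia.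
have <- : \sum_(i < N.+1) (F i - F i.+1) = T (r - 1) (S (p - 1) v).
  by rewrite telescope_ord FN subr0.
rewrite -!sumrB.
rewrite -[RHS]linearZ (sexpz_deriv t0 tC _ rN) linear_sum.
apply: eq_bigr => i _.
rewrite -scalerBr -linearB /=.
have -> : r - 1 - i.+1%:Z = r - i.+1%:Z - 1 by lia.
rewrite IH; last by lia.
rewrite mode_sexpz k1 scalerDr scalerA mul1r mulfV ?pnatr_eq0 // scale1r.
rewrite [S p (_ *: _)]linearZ /=.
rewrite /F.
have -> : r - i.+2%:Z = r - i.+1%:Z - 1 by lia.
have -> : p - i.+2%:Z = p - i.+1%:Z - 1 by lia.
by rewrite IH ?addrK //; lia.
Qed.

(** The geometric series of $(1-xy)^{-1}$, which stops because [T] vanishes in negative degrees. *)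
Lemma sexpz_comm1_sum : kappa = 1 -> forall (N : nat) r p v, r < N%:Z ->
  T r (S p v) = \sum_(k < N) S (p - k%:Z) (T (r - k%:Z) v).
Proof.
move=> k1 N r p v rN.
pose F (k : nat) := T (r - k%:Z) (S (p - k%:Z) v).
have -> : T r (S p v) = F 0%N - F N.
  by rewrite /F [X in _ - X]sexpz_lt0 ?subr0 //; lia.
rewrite -telescope_ord; apply: eq_bigr => k _; rewrite -sexpz_comm1 //.
by rewrite /F; congr (_ - T _ (S _ _)); lia.
Qed.

End Commutation.

(** The derivative of $e^u e^{-u}$ is zero: splitting $n = a + (n-a)$ in each term and applying the
    recursion to either factor gives two sums that cancel. *)
Lemma sexp_inv u w : (forall v, u 0%N v = 0) ->
  (forall i j v, u i (u j v) = u j (u i v)) ->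
  (forall i v, w i v = - u i v) ->
  forall n v, \sum_(a < n.+1) sexp u a (sexp w (n - a) v) = (n == 0%N)%:R *: v.
Proof.
move=> u0 uC wu n v.
have w0 x : w 0%N x = 0 by rewrite wu u0 oppr0.
have wC i j x : w i (w j x) = w j (w i x) by rewrite !wu !linearN uC.
case: n => [|n]; first by rewrite big_ord1 !sexp0 scale1r.
apply: (@scalerI _ _ n.+1%:R); first by rewrite pnatr_eq0.
rewrite scale0r scaler0 scaler_sumr.
pose F i a := i%:R *: u i (sexp u (n.+1 - a - i) (sexp w a v)).
transitivity (\sum_(a < n.+2) a%:R *: sexp u a (sexp w (n.+1 - a) v)
   + \sum_(a < n.+2) sexp u a ((n.+1 - a)%:R *: sexp w (n.+1 - a) v)).
  rewrite -big_split; apply: eq_bigr => a _.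
  by rewrite [sexp u _ (_ *: _)]linearZ /= -scalerDl -natrD subnKC // -ltnS.
have -> : \sum_(a < n.+2) a%:R *: sexp u a (sexp w (n.+1 - a) v) =
    \sum_(a < n.+2) \sum_(i < (n.+1 - a).+1) F i a.
  rewrite (reindex_inj rev_ord_inj); apply: eq_bigr => a _ /=.
  rewrite subSS sexp_deriv //; apply: eq_bigr => i _.
  by rewrite /F subKn // -ltnS.
rewrite (exchange_triangle _ (fun a i => F i a)) -[RHS](subrr (\sum_(i < n.+2)
   \sum_(a < (n.+1 - i).+1) F i a)); congr (_ + _).
under eq_bigr do rewrite sexp_deriv // linear_sum /=.
rewrite (exchange_triangle _ (fun a i =>
  sexp u a (i%:R *: w i (sexp w (n.+1 - a - i) v)))) -sumrN.
apply: eq_bigr => i _; rewrite (reindex_inj rev_ord_inj) -sumrN.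
apply: eq_bigr => a _; rewrite /= subSS [sexp u _ (_ *: _)]linearZ /= wu.
rewrite [sexp u _ (- _)]linearN /= scalerN.
rewrite -[in LHS](sexp_comm (A := u i)) /F; last by move=> j x; exact: uC.
have le : (a <= n.+1 - i)%N by rewrite -ltnS.
congr (- (_ *: u _ (sexp u _ (sexp w _ v)))); have := ltn_ord i; lia.
Qed.

Lemma sum_ord_cut (F : nat -> V) (D N : nat) : (D <= N)%N ->
  (forall r, (D <= r)%N -> F r = 0) -> \sum_(r < N) F r = \sum_(r < D) F r.
Proof.
move=> DN F0; rewrite (big_ord_widen _ F DN) [RHS]big_mkcond.
by apply: eq_bigr => r _; case: ltnP => // /F0.
Qed.

(** Both ranges contain the whole support $[0, D)$ of [F]. *)
Lemma sum_shift (F : int -> V) (D N k : nat) : (D + k <= N)%N ->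
  (forall x, x < 0 -> F x = 0) -> (forall x, D%:Z <= x -> F x = 0) ->
  \sum_(r < N) F (r%:Z - k%:Z) = \sum_(r < D) F r%:Z.
Proof.
move=> le Fneg Fpos; have -> : N = (k + (N - k))%N by lia.
rewrite big_split_ord /= big1 ?add0r; last first.
  by move=> r _; apply: Fneg; have := ltn_ord r; lia.
under eq_bigr => r _ do have -> : (k + r)%N%:Z - k%:Z = r%:Z by lia.
by apply: (sum_ord_cut (F := fun r => F r%:Z)) => [|r ?]; [|apply: Fpos]; lia.
Qed.

End IntExp.

Arguments sexpz : simpl never.

(** * Fermionic relations between vertex modes *)

Section FermionModes.
Variables (C : numFieldType) (V : lmodType C).
Variables (u t : bool -> nat -> {linear V -> V}).
Implicit Types (v : V) (b : bool).
Hypothesis u0 : forall b v, u b 0%N v = 0.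
Hypothesis t0 : forall b v, t b 0%N v = 0.
Hypothesis uC : forall b c i j v, u b i (u c j v) = u c j (u b i v).
Hypothesis tC : forall b c i j v, t b i (t c j v) = t c j (t b i v).
Hypothesis tu : forall b c i j v, t b i.+1 (u c j.+1 v) = u c j.+1 (t b i.+1 v)
  + ((i == j)%:R * ((if b == c then -1 else 1) / i.+1%:R)) *: v.
Hypothesis uN : forall i v, u false i v = - u true i v.
Notation S b := (sexpz (u b)).
Notation T b := (sexpz (t b)).

Let SC b c m n v : S b m (S c n v) = S c n (S b m v).
Proof. by apply: sexpzC => *; rewrite uC. Qed.
Let TC b c m n v : T b m (T c n v) = T c n (T b m v).
Proof. by apply: sexpzC => *; rewrite tC. Qed.
Let TS_same b r p v : T b r (S b p v) = S b p (T b r v) - S b (p - 1) (T b (r - 1) v).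
Proof.
apply: (sexpz_commN (kappa := -1)) => // i j w; rewrite ?uC ?tC //.
by rewrite tu eqxx.
Qed.
Let TS_opp b (N : nat) r p v : r < N%:Z ->
  T b r (S (~~ b) p v) = \sum_(k < N) S (~~ b) (p - k%:Z) (T b (r - k%:Z) v).
Proof.
apply: (sexpz_comm1_sum (kappa := 1)) => // i j w; rewrite ?uC ?tC //.
by rewrite tu; case: (b).
Qed.

Let ST_sum b c m n N (F : 'I_N -> V) :
  S b m (T c n (\sum_(j < N) F j)) = \sum_(j < N) S b m (T c n (F j)).
Proof. by rewrite (linear_sum (T c n)) (linear_sum (S b m)). Qed.

(* The coefficient of [z^n] in [E_-(z) E_+(z)], where [N] bounds the degree
   in [z^-1] of the annihilation part on [v]. *)
Definition vmode b (N : nat) (n : int) v : V :=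
  \sum_(r < N) S b (n + r%:Z) (T b r%:Z v).

(** Exchanging equal signs produces a factor antisymmetric in the two variables once the charge
    shift, here the step from [n] to [n - 1], is included, while the normally ordered product is
    symmetric. The coefficient becomes a double sum of [G i j - G j i]. *)
Lemma vmode_sq b (D N N' : nat) n v :
  (forall r : nat, (D <= r)%N -> T b r%:Z v = 0) -> (D <= N)%N -> (D < N')%N ->
  vmode b N' (n - 1) (vmode b N n v) = 0.
Proof.
move=> Dv DN DN'; rewrite /vmode.
rewrite (sum_ord_cut (F := fun r : nat => S b (n + r%:Z) (T b r%:Z v)) DN); last first.
  by move=> r Dr; rewrite Dv ?linear0.
pose G (i j : nat) := S b (n - 1 + i%:Z) (S b (n + j%:Z) (T b i%:Z (T b j%:Z v))).
transitivity (\sum_(j < D) \sum_(i < D) (G i j - G j i)); last first.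
  under eq_bigr do rewrite sumrB.
  by rewrite sumrB [X in _ - X]exchange_big subrr.
under eq_bigr do rewrite ST_sum.
rewrite exchange_big; apply: eq_bigr => j _.
(* The correction term of the exchange is [H] at $i-1$, and [H i] is [G j i] after commuting.
   Undoing this shift takes one more index, hence $D < N'$. *)
pose H (i : int) := S b (n + i) (S b (n - 1 + j%:Z) (T b i (T b j%:Z v))).
transitivity (\sum_(i < N') G i j - \sum_(i < N') H (i%:Z - 1%N%:Z)).
  rewrite -sumrB; apply: eq_bigr => i _ /=; rewrite TS_same linearB /G /H /=.
  by congr (_ - S b _ (S b _ _)); lia.
rewrite (sum_shift (D := D)); first 1 last.
- by lia.
- by move=> i i0; rewrite /H (sexpz_lt0 (t b)) ?linear0.
- case=> // i Di; rewrite /H TC Dv ?linear0 //.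
rewrite (sum_ord_cut (D := D) (F := fun i => G i j)); last 2 first.
- by lia.
- by move=> i Di; rewrite /G TC Dv ?linear0.
rewrite -sumrB; apply: eq_bigr => i _; rewrite /G /H; congr (_ - _).
by rewrite SC TC.
Qed.

(** Normal ordering: exchanging opposite signs introduces the geometric series in [k]. Beyond
    $2D+|n|$ the cutoff [N] loses nothing. *)
Lemma vmode_opp b (D N N1 : nat) n v :
  (forall c (r : nat), (D <= r)%N -> T c r%:Z v = 0) -> (D <= N1)%N ->
  (D + D + `|n| < N)%N ->
  vmode b N (- n) (vmode (~~ b) N1 n v) = \sum_(r < D) \sum_(s < D) \sum_(k < N)
    S b (s%:Z + k%:Z - n)
      (S (~~ b) (r%:Z + n - k%:Z) (T b s%:Z (T (~~ b) r%:Z v))).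
Proof.
move=> Dv DN1 DN; rewrite /vmode.
rewrite (sum_ord_cut (F := fun r : nat => S (~~ b) (n + r%:Z) (T (~~ b) r%:Z v)) DN1);
  last by move=> r Dr; rewrite Dv ?linear0.
under eq_bigr do rewrite ST_sum.
rewrite exchange_big; apply: eq_bigr => r _; rewrite exchange_big /=.
pose H (k : nat) (i : int) := S b (i + k%:Z - n)
  (S (~~ b) (r%:Z + n - k%:Z) (T b i (T (~~ b) r%:Z v))).
transitivity (\sum_(s < N) \sum_(k < N) H k (s%:Z - k%:Z)).
  apply: eq_bigr => s _; rewrite (TS_opp _ (N := N)); last by have := ltn_ord s; lia.
  rewrite (linear_sum (S b _)); apply: eq_bigr => k _; rewrite /H.
  by congr (S b _ (S (~~ b) _ _)); lia.
rewrite exchange_big /=; apply: eq_bigr => k _.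
have [kN|kN] := leqP (D + k) N.
  rewrite (sum_shift (D := D) (F := H k)) //.
  - by move=> i i0; rewrite /H (sexpz_lt0 (t b)) ?linear0.
  - by case=> // i Di; rewrite /H TC Dv ?linear0.
(* Here $k > N-D > D+|n|$ while $r < D$, so the creation degree $r+n-k$ is negative and both sides
   vanish. *)
by rewrite !big1 // => i _; rewrite /H (sexpz_lt0 (u (~~ b))) ?linear0 //;
  have := ltn_ord r; lia.
Qed.

(** The two orders expand one rational function in opposite regions, and their sum is a delta
    function: the creation degrees of [S true] run over all integers. The two creation exponentials,
    now at the same point, are inverse to each other, so [sexp_inv] leaves only $r=s=0$. *)
Lemma vmode_anticomm (D N N1 : nat) m v :
  (forall c (r : nat), (D <= r)%N -> T c r%:Z v = 0) -> (D <= N1)%N ->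
  (D + D + `|m| + 1 < N)%N ->
  vmode true N (- m) (vmode false N1 m v)
  + vmode false N (m + 1) (vmode true N1 (- 1 - m) v) = v.
Proof.
move=> Dv DN1 DN; have DN' : (D + D + absz (- 1 - m)%R < N)%N by lia.
case: D Dv DN1 DN DN' => [|D] Dv DN1 DN DN'.
  (* The surviving term $r=s=0$ needs $D>0$; if $D=0$, the vanishing bound applies to $T_0 v =
     v$. *)
  have v0 : v = 0 by rewrite -[v](sexpz0 (t true)) (Dv true 0%N).
  have vmode0 c M k : vmode c M k 0 = 0.
    by rewrite /vmode big1 // => r _; rewrite !linear0.
  by rewrite v0 !vmode0 addr0.
have -> : m + 1 = - (- 1 - m) by lia.
rewrite (@vmode_opp true D.+1) //; last by lia.
rewrite (@vmode_opp false D.+1) // [X in _ + X]exchange_big -big_split /=.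
transitivity (\sum_(r < D.+1) \sum_(s < D.+1)
    (((r == 0%N :> nat) && (s == 0%N :> nat))%:R : C) *: v); last first.
  rewrite big_ord_recl [X in _ + X]big1 => [|r _]; last first.
    by rewrite big1 // => s _; rewrite scale0r.
  by rewrite big_ord_recl big1 => [|s _]; rewrite /= ?scale1r ?addr0 // scale0r.
apply: eq_bigr => r _; rewrite -big_split /=; apply: eq_bigr => s _.
have rD := ltn_ord r; have sD := ltn_ord s.
(* With $y$ the degree of [S true], the first order covers $s-m \le y < s-m+N$ and the second $s-m-N
   \le y < s-m$: together one window of length $2N$. *)
pose w := T true s%:Z (T false r%:Z v).
pose H (y : int) := S true y (S false (s%:Z + r%:Z - y) w).
transitivity (\sum_(x < N + N) H (x%:Z - (absz (N%:Z - s%:Z + m)%R)%:Z)).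
  rewrite big_split_ord /= addrC; congr (_ + _).
    rewrite (reindex_inj rev_ord_inj); apply: eq_bigr => x _ /=.
    rewrite TC -/w SC /H; have := ltn_ord x => xN.
    by congr (S true _ (S false _ _)); lia.
  apply: eq_bigr => x _; rewrite -/w /H; have := ltn_ord x => xN.
  by congr (S true _ (S false _ _)); lia.
rewrite (sum_shift (D := (s + r).+1)); first last.
- by move=> x sx; rewrite /H [S false _ _]sexpz_lt0 ?linear0 //; lia.
- by move=> x x0; rewrite /H sexpz_lt0.
- by lia.
transitivity (\sum_(a < (s + r).+1) sexp (u true) a (sexp (u false) (s + r - a) w)).
  apply: eq_bigr => a _; rewrite /H; have := ltn_ord a => aN.
  by have -> : s%:Z + r%:Z - a%:Z = (s + r - a)%N%:Z by lia.
rewrite (sexp_inv (u0 true) (@uC true true) uN) /w.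
rewrite addn_eq0 andbC; case: eqP => [->|]; case: eqP => [->|] /=; rewrite ?scale0r //.
by rewrite !sexpz0.
Qed.

End FermionModes.

(** * The level grading *)

Section FiniteSupportSums.
Variables (C : numFieldType) (I : choiceType).
Implicit Types V W : lmodType C.

Lemma fsbig_sub V (D X : set I) (F : I -> V) : finite_set X ->
  (forall i, D i -> F i != 0 -> X i) ->
  \sum_(i \in D) F i = \sum_(i <- fset_set (D `&` X)) F i.
Proof.
move=> fX DX; have fDX : finite_set (D `&` X) by apply: finite_setIr.
rewrite (fsbigE (fset_set (D `&` X))).
- rewrite big_seq_cond [RHS]big_seq_cond; apply: eq_bigl => i.
  rewrite andbT; apply: andb_idr; rewrite in_fset_set // !inE.
  by case.
- exact: fset_uniq.
- by move=> i /=; rewrite in_fset_set // inE => -[].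
move=> i Di; apply: contraNeq => Fi; rewrite in_fset_set // inE.
by split=> //; apply: DX.
Qed.

Lemma linear_fsum V W (A : {linear V -> W}) (D : set I) (F : I -> V) :
  finite_set [set i | D i /\ F i != 0] ->
  A (\sum_(i \in D) F i) = \sum_(i \in D) A (F i).
Proof.
move=> fin; rewrite !(fsbig_sub fin) ?linear_sum //.
by move=> i Di AFi; split=> //; apply: contra_neq AFi => ->; rewrite linear0.
Qed.

Lemma fsum_linear V W (D : set I) (F : I -> {linear V -> W}) :
  (forall v, finite_set [set i | D i /\ F i v != 0]) ->
  linear (fun v => \sum_(i \in D) F i v).
Proof.
move=> fin a v w.
have finU : finite_set ([set i | D i /\ F i v != 0] `|` [set i | D i /\ F i w != 0]).
  by rewrite finite_setU; split; apply: fin.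
rewrite !(fsbig_sub finU).
- rewrite scaler_sumr -big_split; apply: eq_bigr => i _.
  by rewrite linearP.
- by move=> i Di Fi; right.
- by move=> i Di Fi; left.
move=> i Di; rewrite linearP => Fi.
have [Fv|Fv] := eqVneq (F i v) 0; last by left.
by right; split=> //; apply: contra_neq Fi => ->; rewrite Fv scaler0 addr0.
Qed.

End FiniteSupportSums.

Section Level.
Implicit Types (o : occupation).

Definition level o : nat := (\sum_(x <- finsupp o) o x * x.2.+1)%N.

Lemma levelEw o (A : {fset 'I_4 * nat}) : (finsupp o `<=` A)%fset ->
  level o = (\sum_(x <- A) o x * x.2.+1)%N.
Proof.
move=> sA; rewrite /level (big_fset_incl _ sA) //= => x _ /fsfun_dflt ->.
by rewrite mul0n.
Qed.

Lemma level_inc o x : level (inc o x) = (level o + x.2.+1)%N.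
Proof.
pose A := (x |` (finsupp o `|` finsupp (inc o x)))%fset.
have xA : x \in A by rewrite !inE eqxx.
rewrite (@levelEw o A); last first.
  by apply/fsubsetP => y yo; rewrite !inE yo orbT.
rewrite (@levelEw (inc o x) A); last first.
  by apply/fsubsetP => y yo; rewrite !inE yo !orbT.
rewrite !(big_fsetD1 x xA) /= incE eqxx mulnDl mul1n addnAC; congr (_ + _ + _)%N.
apply: eq_big_seq => y; rewrite !inE => /andP[/negPf yx _].
by rewrite incE yx addn0.
Qed.

Lemma level_dec o x : (0 < o x)%N -> (level (dec o x) + x.2.+1)%N = level o.
Proof. by move=> ox; rewrite -[in RHS](decK ox) level_inc. Qed.

Lemma level0 : level [fsfun] = 0%N.
Proof. by rewrite /level finsupp0 big_seq_fset0. Qed.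

End Level.

Section Grading.
Variables (C : numClosedFieldType) (q12 : C).
Notation V := (fockmod C).
Implicit Types (v w : V) (lam : 'rV[C]_4) (o : occupation).

Definition levop : V -> V := linext (fun k => (level k.2)%:R *: << k >>).
HB.instance Definition _ := GRing.isLinear.Build C V V *:%R levop
  (linext_linear _).

Lemma levopU lam o : levop (ket lam o) = (level o)%:R *: ket lam o.
Proof. by rewrite /levop linextU ket.unlock. Qed.

Lemma levop_osc s (n : int) v :
  levop (osc q12 s n v) = osc q12 s n (levop v) + (- n%:~R) *: osc q12 s n v.
Proof.
move: v; apply: (linear_eq (f := levop \o osc q12 s n)
  (g := (osc q12 s n \o levop) \+ (- n%:~R) *: osc q12 s n)) => lam o /=.
have levZ a v : levop (a *: v) = a *: levop v by exact: linearZ.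
rewrite /= levopU oscZ.
case: n => [[|n]|n]; rewrite ?NegzE.
- by rewrite oscU0 levZ levopU !scalerA oppr0 mul0r scale0r addr0 mulrC.
- rewrite oscUP levZ levopU !scalerA -scalerDl.
  have [o0|o0] := posnP (o (s, n)).
    by rewrite o0 !(mulr0, mul0r) addr0.
  rewrite -(level_dec o0) natrD /= -pmulrn; apply: scaler_eq.
  by rewrite mulrDl mulNr addrK mulrC.
- rewrite oscUN levopU level_inc natrD scalerDl /= mulrNz opprK.
  by rewrite -pmulrn.
Qed.

Lemma levop_eigen0 v c : levop v = c *: v -> (forall n : nat, c != n%:R) -> v = 0.
Proof.
move=> lv cn; apply/malgP => k; rewrite mcoeff0.
have := congr1 (mcoeff k) lv; rewrite /= linext_coef mcoeffZ => /eqP.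
rewrite -subr_eq0 -mulrBl mulf_eq0 subr_eq0 eq_sym (negPf (cn _)) /=.
by move/eqP.
Qed.

Definition degree_bound v : nat := (\max_(k <- msupp v) level k.2).+1.

(** Lowering a monomial of level less than $n$ by $n$ would give a negative level, which [levop]
    does not have as an eigenvalue. All cutoffs of annihilation operators come from here. *)
Lemma vanish_above (A : {linear V -> V}) (n : nat) v :
  (forall w, levop (A w) = A (levop w) + (- n%:R) *: A w) ->
  (degree_bound v <= n)%N -> A v = 0.
Proof.
move=> grA vn; rewrite [v]monalgEZ linear_sum big1_seq // => k /andP[_ kv].
rewrite linearZ /=; suff -> : A << k >> = 0 by rewrite scaler0.
have kn : (level k.2 < n)%N.
  apply: leq_trans vn; rewrite /degree_bound ltnS.
  exact: (leq_bigmax_seq (F := fun k : fockbasis C => level k.2)).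
have -> : << k >> = ket k.1 k.2 by rewrite ket.unlock; case: (k).
apply: (levop_eigen0 (c := - (n - level k.2)%N%:R)).
  have AZ a w : A (a *: w) = a *: A w by exact: linearZ.
  rewrite grA levopU AZ; apply: etrans (esym (scalerDl _ _ _)) _.
  by apply: scaler_eq; rewrite natrB 1?ltnW // opprB.
move=> m; rewrite eq_sym -subr_eq0 opprK -natrD pnatr_eq0 addn_eq0 subn_eq0.
by rewrite negb_and -ltnNge kn orbT.
Qed.

Lemma osc_vanish s (n : nat) v : (degree_bound v <= n)%N -> osc q12 s n v = 0.
Proof.
by apply: (vanish_above (A := osc q12 s n)) => w; rewrite levop_osc -pmulrn.
Qed.

End Grading.

Arguments levop {C}.
Arguments degree_bound {C} v : simpl never.

(** * The modes eta_0 and xi_0 *)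

Section ScaledOperators.
Variables (R : comPzRingType) (V : lmodType R).

Lemma scaled_commutator (A B : {linear V -> V}) (a b k l : R) v :
  A (B v) = B (A v) + k *: v -> a * b * k = l ->
  a *: A (b *: B v) = b *: B (a *: A v) + l *: v.
Proof.
by move=> AB <-; rewrite !linearZ /= AB !scalerDr !scalerA (mulrC b a).
Qed.

Lemma scaled_grading (A L : {linear V -> V}) (a k : R) v :
  L (A v) = A (L v) + k *: A v -> L (a *: A v) = a *: A (L v) + k *: (a *: A v).
Proof. by move=> LA; rewrite linearZ /= LA scalerDr !scalerA mulrC. Qed.

End ScaledOperators.

Section VertexInstances.
Variables (C : numClosedFieldType) (q12 : C).
Notation V := (fockmod C).

Lemma c_creation_linear eps n : linear (c_creation q12 eps n).
Proof.
move=> a v w; rewrite /c_creation; case: eqP => _; first by rewrite scaler0 addr0.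
by rewrite linearP scalerDr !scalerA mulrC.
Qed.
HB.instance Definition _ eps n := GRing.isLinear.Build C V V *:%R
  (c_creation q12 eps n) (c_creation_linear eps n).

Lemma c_annihilation_linear eps n : linear (c_annihilation q12 eps n).
Proof.
move=> a v w; rewrite /c_annihilation; case: eqP => _; first by rewrite scaler0 addr0.
by rewrite linearP scalerDr !scalerA mulrC.
Qed.
HB.instance Definition _ eps n := GRing.isLinear.Build C V V *:%R
  (c_annihilation q12 eps n) (c_annihilation_linear eps n).

End VertexInstances.

(** The sign of $c(z;0)$ in the exponent: [true] belongs to $\eta$, [false] to $\xi$. *)
Definition sgn (b : bool) : int := if b then 1 else -1.
HB.lock Definition crea (C : numClosedFieldType) (q12 : C) b n :
  {linear fockmod C -> fockmod C} := c_creation q12 (sgn b)%:~R n.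
HB.lock Definition anni (C : numClosedFieldType) (q12 : C) b n :
  {linear fockmod C -> fockmod C} := c_annihilation q12 (sgn b)%:~R n.

Section VertexOperators.
Variables (C : numClosedFieldType) (q12 : C).
Hypothesis q12_neq0 : q12 != 0.
Hypothesis q_generic : forall n : nat, (0 < n)%N -> (q12 ^+ 2) ^+ n != 1.
Notation V := (fockmod C).
Implicit Types (v w : V) (lam : 'rV[C]_4) (o : occupation) (b : bool).
Notation crea := (crea q12).
Notation anni := (anni q12).

Lemma creaE b n v :
  crea b n.+1 v = ((sgn b)%:~R / qint q12 n.+1) *: osc q12 sc (- n.+1%:Z) v.
Proof. by rewrite crea.unlock /= /c_creation /= qintN invrN mulrNN. Qed.
Lemma anniE b n v :
  anni b n.+1 v = (- (sgn b)%:~R / qint q12 n.+1) *: osc q12 sc n.+1%:Z v.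
Proof. by rewrite anni.unlock. Qed.
Lemma crea0 b v : crea b 0 v = 0. Proof. by rewrite crea.unlock. Qed.
Lemma anni0 b v : anni b 0 v = 0. Proof. by rewrite anni.unlock. Qed.

Lemma crea_comm (A : {linear V -> V}) :
  (forall n v, (0 < n)%N -> A (osc q12 sc (- n%:Z) v) = osc q12 sc (- n%:Z) (A v)) ->
  forall b n v, A (crea b n v) = crea b n (A v).
Proof.
move=> Ao b [|n] v; first by rewrite !crea0 linear0.
by rewrite !creaE (linearZE A) /= Ao.
Qed.

Lemma anni_comm (A : {linear V -> V}) :
  (forall (n : nat) v, (0 < n)%N -> A (osc q12 sc n v) = osc q12 sc n (A v)) ->
  forall b n v, A (anni b n v) = anni b n (A v).
Proof.
move=> Ao b [|n] v; first by rewrite !anni0 linear0.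
by rewrite !anniE (linearZE A) /= Ao.
Qed.

Lemma creaC b c i j v : crea b i (crea c j v) = crea c j (crea b i v).
Proof.
apply: crea_comm => n w _; apply/esym/(crea_comm (A := osc q12 sc (- n%:Z))).
by move=> m x _; rewrite osc_creationC.
Qed.

Lemma anniC b c i j v : anni b i (anni c j v) = anni c j (anni b i v).
Proof.
apply: anni_comm => n w _; apply/esym/(anni_comm (A := osc q12 sc n)).
by move=> m x _; rewrite osc_annihilationC.
Qed.

(** The two denominators $[n]$ of $c(z;0)$ cancel the $[n]^2$ of the commutator. What remains is
    minus the product of the signs divided by $n$, free of $q$; this is why the modes are
    fermionic. *)
Lemma anni_crea b c i j v : anni b i.+1 (crea c j.+1 v) = crea c j.+1 (anni b i.+1 v)
  + ((i == j)%:R * ((if b == c then -1 else 1) / i.+1%:R)) *: v.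
Proof.
rewrite creaE anniE creaE anniE.
have comm := osc_comm q12 sc sc v (ltn0Sn i) (ltn0Sn j).
apply: (scaled_commutator (A := osc q12 sc i.+1) (B := osc q12 sc (- j.+1%:Z)) comm).
rewrite eqxx eqSS.
have [->|] := eqVneq i j; last by rewrite !mul0r mulr0.
have qj : qint q12 j.+1 != 0 by exact: qint_neq0.
rewrite !mul1r /signature /gram /=.
have j0 : j.+1%:R != 0 :> C by rewrite pnatr_eq0.
have -> : (if b == c then -1 else 1) = - (sgn b)%:~R * (sgn c)%:~R :> C.
  by case: b; case: c; rewrite /= ?mulrNz; ring.
by move: (qint q12 j.+1) (j.+1%:R) qj j0 => x y x0 y0; field; rewrite x0 y0.
Qed.

Lemma creaN i v : crea false i v = - crea true i v.
Proof.
case: i => [|i]; first by rewrite !crea0 oppr0.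
by rewrite !creaE /= mulrNz mulNr scaleNr.
Qed.

Lemma levop_crea b n v :
  levop (crea b n v) = crea b n (levop v) + (1 * n%:R) *: crea b n v.
Proof.
case: n => [|n]; first by rewrite !crea0 linear0 scaler0 addr0.
have grd := levop_osc q12 sc (- n.+1%:Z) v.
rewrite mulrNz opprK -pmulrn -[n.+1%:R]mul1r in grd; rewrite !creaE.
exact: (scaled_grading (A := osc q12 sc (- n.+1%:Z)) _ grd).
Qed.

Lemma levop_anni b n v :
  levop (anni b n v) = anni b n (levop v) + (-1 * n%:R) *: anni b n v.
Proof.
case: n => [|n]; first by rewrite !anni0 linear0 scaler0 addr0.
have grd := levop_osc q12 sc n.+1%:Z v.
rewrite -pmulrn -mulN1r in grd; rewrite !anniE.
exact: (scaled_grading (A := osc q12 sc n.+1%:Z) _ grd).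
Qed.

Lemma anni_exp_vanish b (r : nat) v :
  (degree_bound v <= r)%N -> sexpz (anni b) r%:Z v = 0.
Proof.
apply: (vanish_above (A := sexpz (anni b) r%:Z)) => w.
rewrite (sexpz_graded (A := levop) (c := -1)); last exact: levop_anni.
by rewrite mulN1r -pmulrn.
Qed.

Lemma expQ_osc lam s n v : n != 0 ->
  expQ lam (osc q12 s n v) = osc q12 s n (expQ lam v).
Proof.
move=> n0; move: v; apply: (linear_eq (f := expQ lam \o osc q12 s n)
  (g := osc q12 s n \o expQ lam)) => mu o /=.
have EZ a v : expQ lam (a *: v) = a *: expQ lam v by exact: linearZ.
case: n n0 => [[|n]|n] n0; rewrite ?NegzE.
- by case/negP: n0.
- by rewrite oscUP EZ !expQU oscUP.
- by rewrite oscUN !expQU oscUN.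
Qed.

Lemma zpow_osc m s n v : zpow_c0 m (osc q12 s n v) = osc q12 s n (zpow_c0 m v).
Proof.
move: v; apply: (linear_eq (f := zpow_c0 m \o osc q12 s n)
  (g := osc q12 s n \o zpow_c0 m)) => mu o /=.
have EZ a v : zpow_c0 m (a *: v) = a *: zpow_c0 m v by exact: linearZ.
rewrite !zpowU oscZ.
case: n => [[|n]|n]; rewrite ?NegzE.
- by rewrite oscU0 EZ zpowU !scalerA mulrC.
- by rewrite oscUP EZ zpowU !scalerA mulrC.
- by rewrite oscUN zpowU.
Qed.

Lemma zpow_zpow n m v : zpow_c0 n (zpow_c0 m v) = (n == m)%:R *: zpow_c0 m v.
Proof.
move: v; apply: (linear_eq (f := @zpow_c0 C n \o zpow_c0 m)
  (g := ((n == m)%:R : C) *: @zpow_c0 C m)) => mu o /=.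
have EZ a v : zpow_c0 n (a *: v) = a *: zpow_c0 n v by exact: linearZ.
rewrite !zpowU EZ zpowU !scalerA; apply: scaler_eq.
have [->|_] := eqVneq (mu ord0 sc) m%:~R; last by rewrite mul0r mulr0.
by rewrite mul1r mulr1 eqr_int eq_sym.
Qed.

Lemma zpow_expQ n m lam v : lam ord0 sc = m%:~R ->
  zpow_c0 (n + m) (expQ lam v) = expQ lam (zpow_c0 n v).
Proof.
move=> lm; move: v; apply: (linear_eq (f := zpow_c0 (n + m) \o expQ lam)
  (g := expQ lam \o zpow_c0 n)) => mu o /=.
have EZ a v : expQ lam (a *: v) = a *: expQ lam v by exact: linearZ.
rewrite expQU !zpowU EZ expQU; apply: scaler_eq.
by rewrite mxE lm intrD (inj_eq (addIr _)).
Qed.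

End VertexOperators.

Definition charge_shift (C : numClosedFieldType) (b : bool) : 'rV[C]_4 :=
  (sgn b)%:~R *: delta_mx ord0 sc.

HB.lock Definition vterm (C : numClosedFieldType) (q12 : C) b
    (t : nat * int * nat) : {linear fockmod C -> fockmod C} :=
  sexpz (crea q12 b) t.1.1%:Z \o (expQ (charge_shift C b) \o
    (zpow_c0 t.1.2 \o sexpz (anni q12 b) t.2%:Z)).

Section VertexModes.
Variables (C : numClosedFieldType) (q12 : C).
Notation V := (fockmod C).
Implicit Types (v w : V) (lam : 'rV[C]_4) (b : bool).
Notation crea := (crea q12).
Notation anni := (anni q12).
Notation S b := (sexpz (crea b)).
Notation T b := (sexpz (anni b)).

Lemma charge_shiftE b : charge_shift C b ord0 sc = (sgn b)%:~R.
Proof. by rewrite !mxE !eqxx mulr1. Qed.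

Lemma vtermE b t v : vterm q12 b t v = S b t.1.1%:Z (expQ (charge_shift C b)
  (zpow_c0 t.1.2 (T b t.2%:Z v))).
Proof. by rewrite vterm.unlock. Qed.

Definition vset b (k : int) : set (nat * int * nat) :=
  [set t | t.1.1%:Z + sgn b * t.1.2 - t.2%:Z = k].

Lemma vertex_coefE b k v :
  vertex_coef q12 (sgn b) k v = \sum_(t \in vset b k) vterm q12 b t v.
Proof.
rewrite /vertex_coef; apply: eq_fsbigr => t _.
by rewrite vtermE crea.unlock anni.unlock.
Qed.

Section CommutingOperator.
Variable A : {linear V -> V}.
Hypothesis A_osc : forall n v, n != 0 -> A (osc q12 sc n v) = osc q12 sc n (A v).

Lemma comm_creation_exp b n v : A (S b n v) = S b n (A v).
Proof.
apply: (sexpz_comm (A := A)) => i w; apply: crea_comm => m x m0.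
by apply: A_osc; rewrite oppr_eq0 -lt0n.
Qed.

Lemma comm_annihilation_exp b n v : A (T b n v) = T b n (A v).
Proof.
apply: (sexpz_comm (A := A)) => i w; apply: anni_comm => m x m0.
by apply: A_osc; rewrite -lt0n.
Qed.

End CommutingOperator.

Lemma zpow_annihilation_exp b m n v : zpow_c0 m (T b n v) = T b n (zpow_c0 m v).
Proof.
by apply: (comm_annihilation_exp (A := zpow_c0 m)) => i w _; apply: zpow_osc.
Qed.
Lemma zpow_creation_exp b m n v : zpow_c0 m (S b n v) = S b n (zpow_c0 m v).
Proof.
by apply: (comm_creation_exp (A := zpow_c0 m)) => i w _; apply: zpow_osc.
Qed.
Lemma expQ_annihilation_exp b lam n v : expQ lam (T b n v) = T b n (expQ lam v).
Proof.
by apply: (comm_annihilation_exp (A := expQ lam)) => i w; apply: expQ_osc.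
Qed.
Lemma expQ_creation_exp b lam n v : expQ lam (S b n v) = S b n (expQ lam v).
Proof.
by apply: (comm_creation_exp (A := expQ lam)) => i w; apply: expQ_osc.
Qed.

Lemma zpow_supp m v : zpow_c0 m v != 0 ->
  exists2 k, k \in msupp v & k.1 ord0 sc = m%:~R.
Proof.
apply: contra_neqP => nk; rewrite [v]monalgEZ linear_sum big1_seq // => k /andP[_ kv].
rewrite linearZE /=; have -> : << k >> = ket k.1 k.2 by rewrite ket.unlock; case: (k).
rewrite zpowU; case: eqP => [km|_]; last by rewrite scale0r scaler0.
by case: nk; exists k.
Qed.

(** A contributing triple is fixed by a $c_0$-charge of $v$ and an annihilation degree below
    [degree_bound v]; the equation of [vset] then gives the creation degree. *)
Lemma vterm_support b k v : finite_set [set t | vset b k t /\ vterm q12 b t v != 0].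
Proof.
(* Non-integral charges receive the default 0, which is harmless since the list only has to contain
   the support. *)
pose ms := [seq xget 0 [set m : int | x.1 ord0 sc = m%:~R] |
              x : fockbasis C <- msupp v].
pose R := [seq (absz (k - sgn b * m + r%:Z)%R, m, r) |
            m <- ms, r <- iota 0 (degree_bound v)].
apply: (sub_finite_set _ (finite_seq R)) => -[[p m] r] [/= tk tv].
have rv : (r < degree_bound v)%N.
  rewrite ltnNge; apply: contraNN tv => le; rewrite vtermE /=.
  by rewrite anni_exp_vanish // !linear0.
have mv : zpow_c0 m v != 0.
  apply: contraNneq tv => mv; rewrite vtermE /= zpow_annihilation_exp mv.
  by rewrite !linear0.
have [x xv xm] := zpow_supp mv.
have mms : m \in ms.
  apply/mapP; exists x => //; apply/esym/xget_unique => //= m' xm'.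
  by apply: (@intr_inj C); rewrite -xm -xm'.
apply/allpairsP; exists (m, r); split; [exact: mms|by rewrite mem_iota|].
by move: tk; rewrite /vset /=; case: (b) => /= tk; congr (_, _, _); lia.
Qed.

Lemma vertex_coef_linear b k : linear (vertex_coef q12 (sgn b) k).
Proof.
move=> a v w; rewrite !vertex_coefE.
exact: (fsum_linear (F := vterm q12 b) (D := vset b k) (vterm_support b k)).
Qed.

Lemma comm_vertex (A : {linear V -> V}) b k :
  (forall n v, n != 0 -> A (osc q12 sc n v) = osc q12 sc n (A v)) ->
  (forall lam v, A (expQ lam v) = expQ lam (A v)) ->
  (forall n v, A (zpow_c0 n v) = zpow_c0 n (A v)) ->
  forall v, A (vertex_coef q12 (sgn b) k v) = vertex_coef q12 (sgn b) k (A v).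
Proof.
move=> Ao Ae Az v; rewrite !vertex_coefE linear_fsum; last exact: vterm_support.
apply: eq_fsbigr => t _; rewrite !vtermE.
by rewrite (comm_creation_exp Ao) Ae Az (comm_annihilation_exp Ao).
Qed.

Notation vm := (vmode crea anni).

Lemma expQ_vmode b N n lam v : expQ lam (vm b N n v) = vm b N n (expQ lam v).
Proof.
rewrite /vmode linear_sum; apply: eq_bigr => r _ /=.
by rewrite expQ_creation_exp expQ_annihilation_exp.
Qed.

Lemma zpow_vmode b N n m v : zpow_c0 m (vm b N n v) = vm b N n (zpow_c0 m v).
Proof.
rewrite /vmode linear_sum; apply: eq_bigr => r _ /=.
by rewrite zpow_creation_exp zpow_annihilation_exp.
Qed.

(** A definite charge $m$ fixes the middle index, and the creation degree follows from the
    annihilation degree $r$, so one sum over $r$ remains. Negative creation degrees, missing from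
    the triples, are zero in [sexpz]. *)
Lemma vertex_coef_charge b k m N v : zpow_c0 m v = v -> (degree_bound v <= N)%N ->
  vertex_coef q12 (sgn b) k v =
  vm b N (k - sgn b * m) (expQ (charge_shift C b) v).
Proof.
move=> vm vN; rewrite vertex_coefE.
pose x (r : nat) := k - sgn b * m + r%:Z.
pose R := [seq (absz (x r), m, r) | r <- iota 0 N & 0 <= x r].
rewrite (fsbigE R); first 1 last.
- rewrite map_inj_uniq ?filter_uniq ?iota_uniq //.
  by move=> r s [_ ->].
- move=> t /= /mapP[r]; rewrite mem_filter => /andP[x0 _] ->.
  by rewrite /vset /= gez0_abs // /x; lia.
- move=> [[p m'] r] tk tR; rewrite vtermE /=.
  have [mm'|mm'] := eqVneq m' m; last first.
    rewrite zpow_annihilation_exp -vm zpow_zpow (negPf mm') scale0r.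
    by rewrite !linear0.
  have [rN|rN] := leqP N r.
    by rewrite anni_exp_vanish ?(leq_trans vN) // !linear0.
  have xr : x r = p%:Z.
    by move: tk; rewrite /x /vset /= mm'; move: (sgn b * m) => y; lia.
  case/negP: tR; apply/mapP; exists r; last by rewrite xr mm'.
  by rewrite mem_filter mem_iota rN xr.
have iotaE : iota 0 N = index_iota 0 N by rewrite /index_iota subn0.
rewrite big_map big_filter_cond iotaE big_mkord /vmode.
rewrite big_mkcond; apply: eq_bigr => r _ /=.
rewrite -/(x r); case: ifPn => [/andP[x0 _]|].
  rewrite vtermE /= (gez0_abs x0) zpow_annihilation_exp vm.
  by rewrite expQ_annihilation_exp.
rewrite negb_and -ltNge => /orP[x0|]; first by rewrite sexpz_lt0.
rewrite notin_setE /vset /= => /eqP; have [x0|x0] := ltP (x r) 0.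
  by rewrite sexpz_lt0.
by rewrite gez0_abs // /x; case/negP; apply/eqP; lia.
Qed.

(** $\eta_0$ is the coefficient of $z^{-1}$ and $z^{c_0}$ already supplies $z^m$, which leaves
    $-1-m$ to the exponentials. For $\xi_0$ the coefficient is that of $z^0$, and $z^{-c_0}$ leaves
    $m$. *)
Lemma etaE m N v : zpow_c0 m v = v -> (degree_bound v <= N)%N ->
  Defs.eta q12 0 v = vm true N (- 1 - m) (expQ (charge_shift C true) v).
Proof.
move=> vm vN; rewrite /Defs.eta (@vertex_coef_charge true _ m N v vm vN).
by have -> : - 0 - 1 - sgn true * m = - 1 - m by rewrite /=; lia.
Qed.

Lemma xiE m N v : zpow_c0 m v = v -> (degree_bound v <= N)%N ->
  Defs.xi q12 0 v = vm false N m (expQ (charge_shift C false) v).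
Proof.
move=> vm vN; rewrite /Defs.xi (@vertex_coef_charge false _ m N v vm vN).
by have -> : - 0 - sgn false * m = m by rewrite /=; lia.
Qed.

Lemma charge_eta m v : zpow_c0 m v = v ->
  zpow_c0 (m + 1) (Defs.eta q12 0 v) = Defs.eta q12 0 v.
Proof.
move=> mv; rewrite (etaE mv (leqnn _)) zpow_vmode.
have sh : charge_shift C true ord0 sc = 1%:~R by exact: charge_shiftE.
by rewrite (zpow_expQ m v sh) mv.
Qed.

Lemma charge_xi m v : zpow_c0 m v = v ->
  zpow_c0 (m - 1) (Defs.xi q12 0 v) = Defs.xi q12 0 v.
Proof.
move=> mv; rewrite (xiE mv (leqnn _)) zpow_vmode.
have sh : charge_shift C false ord0 sc = (- 1)%:~R by exact: charge_shiftE.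
by rewrite (zpow_expQ m v sh) mv.
Qed.

Lemma expQ_add lam mu v : expQ lam (expQ mu v) = expQ (mu + lam) v.
Proof.
move: v; apply: (linear_eq (f := expQ lam \o expQ mu) (g := expQ (mu + lam))).
by move=> nu o /=; rewrite !expQU addrA.
Qed.

Lemma expQ0 v : expQ 0 v = v.
Proof.
move: v; apply: (linear_eq (f := expQ 0) (g := @idfun V)) => nu o /=.
by rewrite expQU addr0.
Qed.

Hypothesis q12_neq0 : q12 != 0.
Hypothesis q_generic : forall n : nat, (0 < n)%N -> (q12 ^+ 2) ^+ n != 1.

Lemma eta_eta m v : zpow_c0 m v = v -> Defs.eta q12 0 (Defs.eta q12 0 v) = 0.
Proof.
move=> mv; have mw := charge_eta mv.
pose x := expQ (charge_shift C true + charge_shift C true) v.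
pose D := degree_bound x; pose N := (degree_bound v + D)%N.
have vN : (degree_bound v <= N)%N by exact: leq_addr.
pose w := Defs.eta q12 0 v; pose N' := (degree_bound w + N).+1.
have wN : (degree_bound w <= N')%N by rewrite /N'; lia.
rewrite (etaE mw wN) (etaE mv vN) expQ_vmode expQ_add -/x.
have -> : - 1 - (m + 1) = - 1 - m - 1 by lia.
have x_vanish (r : nat) : (D <= r)%N -> T true r%:Z x = 0.
  exact: anni_exp_vanish.
have DN : (D <= N)%N by exact: leq_addl.
have DN' : (D < N')%N by rewrite /N' /N; lia.
exact: (vmode_sq (@crea0 _ _) (@anni0 _ _) (@creaC _ _) (@anniC _ _)
  (@anni_crea _ _ q12_neq0 q_generic) _ x_vanish DN DN').
Qed.

Lemma eta_xi_anticomm m v : zpow_c0 m v = v ->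
  Defs.eta q12 0 (Defs.xi q12 0 v) + Defs.xi q12 0 (Defs.eta q12 0 v) = v.
Proof.
move=> mv; have mw := charge_xi mv; have mw' := charge_eta mv.
pose D := degree_bound v.
pose w := Defs.xi q12 0 v; pose w' := Defs.eta q12 0 v.
pose N := (degree_bound w + degree_bound w' + (D + D + `|m| + 2))%N.
have wN : (degree_bound w <= N)%N by rewrite /N; lia.
have wN' : (degree_bound w' <= N)%N by rewrite /N; lia.
rewrite (etaE mw wN) (xiE mw' wN') (etaE mv (leqnn D)) (xiE mv (leqnn D)).
rewrite !expQ_vmode !expQ_add.
have sh : charge_shift C false + charge_shift C true = 0.
  by rewrite /charge_shift -scalerDl /= mulrNz addNr scale0r.
rewrite sh (addrC (charge_shift C true)) sh expQ0.
have -> : - 1 - (m - 1) = - m by lia.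
have v_vanish c (r : nat) : (D <= r)%N -> T c r%:Z v = 0.
  exact: anni_exp_vanish.
have DN : (D + D + `|m| + 1 < N)%N by rewrite /N; lia.
exact: (vmode_anticomm (@crea0 _ _) (@anni0 _ _) (@creaC _ _) (@anniC _ _)
  (@anni_crea _ _ q12_neq0 q_generic) (@creaN _ _) v_vanish (leqnn D) DN).
Qed.

End VertexModes.

(** * Dimensions in a contractible complex *)

Section Dimension.
Variable F : fieldType.
Implicit Types V W : lmodType F.

(* [has_dim] in an arbitrary left module. *)
Definition gdim V (U : set V) (n : nat) : Prop :=
  exists w : 'I_n -> V,
    (forall c : 'I_n -> F, \sum_i c i *: w i = 0 -> forall i, c i = 0) /\
    (forall v, U v <-> exists c : 'I_n -> F, v = \sum_i c i *: w i).

Lemma sum_row V m n (x : 'rV[F]_m) (A : 'M[F]_(m, n)) (w : 'I_n -> V) :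
  \sum_i x 0 i *: (\sum_j A i j *: w j) = \sum_j (x *m A) 0 j *: w j.
Proof.
under eq_bigr do rewrite scaler_sumr.
rewrite exchange_big; apply: eq_bigr => j _.
by rewrite mxE scaler_suml; apply: eq_bigr => i _; rewrite scalerA.
Qed.

Lemma row_eq0 n (x : 'rV[F]_n) : (forall i, x 0 i = 0) -> x = 0.
Proof. by move=> x0; apply/rowP => i; rewrite x0 mxE. Qed.

Lemma gdim_le V (U : set V) m n : gdim U m -> gdim U n -> (m <= n)%N.
Proof.
move=> [w [wfree wU]] [w' [_ w'U]].
have /choice[A HA] i : exists c : 'I_n -> F, w i = \sum_j c j *: w' j.
  apply/w'U/wU; exists (fun j => (j == i)%:R).
  rewrite (bigD1 i) //= eqxx scale1r big1 ?addr0 // => j /negPf->.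
  by rewrite scale0r.
pose M : 'M[F]_(m, n) := \matrix_(i, j) A i j.
suff /eqP <- : row_free M by exact: rank_leq_col.
rewrite -kermx_eq0; apply/rowV0P => x /sub_kermxP xM; apply: row_eq0.
apply: wfree; transitivity (\sum_i x 0 i *: \sum_j M i j *: w' j).
  by apply: eq_bigr => i _; rewrite HA; under [in RHS]eq_bigr do rewrite mxE.
by rewrite sum_row xM big1 // => j _; rewrite mxE scale0r.
Qed.

Lemma gdim_uniq V (U : set V) m n : gdim U m -> gdim U n -> m = n.
Proof. by move=> Um Un; apply/eqP; rewrite eqn_leq !(@gdim_le _ U). Qed.

Lemma gdim_row_space V m n (w : 'I_n -> V) (M : 'M[F]_(m, n)) :
  (forall c : 'I_n -> F, \sum_i c i *: w i = 0 -> forall i, c i = 0) ->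
  gdim [set v | exists2 x : 'rV[F]_n, (x <= M)%MS & v = \sum_j x 0 j *: w j]
    (\rank M).
Proof.
move=> wfree; exists (fun i => \sum_j row_base M i j *: w j); split.
  move=> c c0 i; pose x : 'rV[F]_(\rank M) := \row_i c i.
  have := c0; rewrite (eq_bigr (fun i => x 0 i *: \sum_j row_base M i j *: w j));
    last by move=> k _; rewrite mxE.
  rewrite sum_row => /wfree/row_eq0 xB.
  suff x0 : x = 0 by have := congr1 (fun y : 'rV[F]__ => y 0 i) x0; rewrite !mxE.
  by apply: (row_free_inj (row_base_free M)); rewrite xB mul0mx.
move=> v; split=> [[x xM ->]|[c ->]].
  have /submxP[y xy] : (x <= row_base M)%MS by rewrite eq_row_base.
  by exists (y 0); rewrite sum_row -xy.
exists ((\row_i c i) *m row_base M).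
  by rewrite -(eq_row_base M) submxMl.
by rewrite -sum_row; apply: eq_bigr => i _; rewrite mxE.
Qed.

(** Rank-nullity for the matrix of [f] between the two families; $r \le n$ is recorded because $n-r$
    is a truncated difference. *)
Lemma gdim_image_kernel V W (U : set V) (U' : set W) (f : {linear V -> W}) n n' :
  gdim U n -> gdim U' n' -> (forall v, U v -> U' (f v)) ->
  exists r, [/\ (r <= n)%N, gdim (f @` U) r & gdim [set v | U v /\ f v = 0] (n - r)].
Proof.
move=> [w [wfree wU]] [w' [w'free w'U]] fU.
have /choice[A HA] i : exists c : 'I_n' -> F, f (w i) = \sum_j c j *: w' j.
  apply/w'U/fU/wU; exists (fun j => (j == i)%:R).
  rewrite (bigD1 i) //= eqxx scale1r big1 ?addr0 // => j /negPf->.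
  by rewrite scale0r.
pose M : 'M[F]_(n, n') := \matrix_(i, j) A i j.
have fE (x : 'rV[F]_n) : f (\sum_i x 0 i *: w i) = \sum_j (x *m M) 0 j *: w' j.
  rewrite linear_sum -sum_row; apply: eq_bigr => i _; rewrite linearZ /= HA.
  by under [in RHS]eq_bigr do rewrite mxE.
have rowE (c : 'I_n -> F) : \sum_i c i *: w i = \sum_i (\row_i c i) 0 i *: w i.
  by apply: eq_bigr => i _; rewrite mxE.
exists (\rank M); split; first exact: rank_leq_row.
- suff -> : f @` U = [set v | exists2 x : 'rV[F]_n', (x <= M)%MS
      & v = \sum_j x 0 j *: w' j] by exact: gdim_row_space.
  apply/seteqP; split=> [_ [v /wU[c ->] <-]|v [x /submxP[y ->] ->]].
    by rewrite rowE fE; exists (\row_i c i *m M); rewrite ?submxMl.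
  by rewrite -fE; exists (\sum_i y 0 i *: w i) => //; apply/wU; exists (y 0).
rewrite -mxrank_ker.
suff -> : [set v | U v /\ f v = 0] = [set v | exists2 x : 'rV[F]_n,
    (x <= kermx M)%MS & v = \sum_j x 0 j *: w j] by exact: gdim_row_space.
apply/seteqP; split=> [v [/wU[c ->]]|v [x /sub_kermxP xM ->]].
  rewrite rowE fE => /w'free/row_eq0 cM; exists (\row_i c i) => //.
  exact/sub_kermxP.
split; first by apply/wU; exists (x 0).
by rewrite fE xM big1 // => j _; rewrite mxE scale0r.
Qed.

Lemma gdim_injective V W (U : set V) (f : {linear V -> W}) n :
  (forall v, U v -> f v = 0 -> v = 0) -> gdim U n -> gdim (f @` U) n.
Proof.
move=> finj [w [wfree wU]]; exists (f \o w).
have fE (c : 'I_n -> F) : \sum_i c i *: (f \o w) i = f (\sum_i c i *: w i).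
  by rewrite linear_sum; apply: eq_bigr => i _; rewrite linearZ.
split=> [c|v]; first by rewrite fE => /finj fc; apply/wfree/fc/wU; exists c.
split=> [[u /wU[c ->] <-]|[c ->]]; first by exists c; rewrite fE.
by rewrite fE; exists (\sum_i c i *: w i) => //; apply/wU; exists c.
Qed.

Section ContractibleComplex.
Variables (V : lmodType F) (eta xi : {linear V -> V}).
Variables (U : int -> set V) (n : int -> nat).
Hypothesis Un : forall l, gdim (U l) (n l).
Hypothesis eta_stable : forall l v, U l v -> U (l + 1) (eta v).
Hypothesis xi_stable : forall l v, U l v -> U (l - 1) (xi v).
Hypothesis eta_sq : forall l v, U l v -> eta (eta v) = 0.
Hypothesis homotopy : forall l v, U l v -> eta (xi v) + xi (eta v) = v.

(* [xi] is a contracting homotopy for the differential [eta]. *)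
Lemma image_eta_dims : exists r : int -> nat,
  (forall l, gdim (eta @` U l) (r l)) /\ (forall l, (r l + r (l - 1)%R)%N = n l).
Proof.
have /choice[r Hr] l := gdim_image_kernel (Un l) (Un (l + 1)) (@eta_stable l).
exists r; split=> l; first by case: (Hr l).
have [rn _ Ker] := Hr l; suff <- : (n l - r l)%N = r (l - 1) by rewrite subnKC.
have [_ Im _] := Hr (l - 1); apply: gdim_uniq Ker _.
(* Exactness: by the homotopy, a vector killed by [eta] is [eta (xi v)]. *)
suff -> : [set v | U l v /\ eta v = 0] = eta @` U (l - 1) by [].
apply/seteqP; split=> [v [Uv ev]|_ [v Uv <-]].
  exists (xi v); first exact: xi_stable.
  by rewrite -[RHS](homotopy Uv) ev linear0 addr0.
split; last exact: eta_sq Uv.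
by have := eta_stable Uv; rewrite subrK.
Qed.

End ContractibleComplex.

End Dimension.

(** Substituting $n_{l+1} = s_l + s_{l+1}$ turns the summands into differences of $(-1)^l s_l$, and
    the sum telescopes. *)
Lemma alternating_fsum (s n : nat -> int) (L : nat) :
  (forall l, n l.+1 = s l + s l.+1) -> (forall l, (L <= l)%N -> s l = 0) ->
  \sum_(l \in pos_nat) (-1) ^+ l.+1 * n l = s 0%N.
Proof.
move=> ns sL; rewrite (fsbigE (iota 1 L)); first 1 last.
- exact: iota_uniq.
- by move=> l /=; rewrite mem_iota => /andP[].
- case=> // l _; rewrite mem_iota ltnS => lL.
  by rewrite ns !sL ?mulr0 //; lia.
rewrite -[1%N]addn0 iotaDl big_map -{1}[L]subn0 -/(index_iota 0 L) big_mkord.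
transitivity (\sum_(l < L) ((-1) ^+ l * s l - (-1) ^+ l.+1 * s l.+1)).
  apply: eq_big => [l|l _]; first exact: mem_set.
  by rewrite add1n ns !exprS; ring.
rewrite (telescope_ord (fun l => (-1) ^+ l * s l)).
by rewrite [s L]sL // mulr0 subr0 mul1r.
Qed.

(** * The derivation *)

Section OscillatorRepresentation.
Variables (C : numClosedFieldType) (q12 : C) (V : lmodType C).
Hypothesis q12_neq0 : q12 != 0.
Hypothesis q_generic : forall n : nat, (0 < n)%N -> (q12 ^+ 2) ^+ n != 1.
Variable a : 'I_4 -> int -> {linear V -> V}.
Implicit Types (v : V) (m n : nat).
Hypothesis a_creationC : forall s t m n v,
  a s (- m%:Z) (a t (- n%:Z) v) = a t (- n%:Z) (a s (- m%:Z) v).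
Hypothesis a_zeroC : forall s t (m : int) v, a s 0 (a t m v) = a t m (a s 0 v).
Hypothesis a_comm : forall s t m n v, (0 < m)%N -> (0 < n)%N ->
  a s m%:Z (a t (- n%:Z) v) = a t (- n%:Z) (a s m%:Z v)
    + (((s == t) && (m == n))%:R * signature C s * gram q12 m) *: v.

(** [h1] for an abstract family of oscillators, so that the commutator of $d$ is computed from the
    relations alone, away from the free module. *)
Definition ah1 (m : int) v : V :=
  q12 ^ (- `|m|) *: a sa1 m v - q12 ^ `|m| *: a sa2 m v.
Definition ah2 (m : int) v : V :=
  q12 ^ (- `|m|) *: a sa2 m v + q12 ^ (- `|m|) *: a sb m v.

HB.instance Definition _ (m : int) := GRing.Linear.copy (ah1 m)
  (q12 ^ (- `|m|) \*: a sa1 m \- q12 ^ `|m| \*: a sa2 m).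
HB.instance Definition _ (m : int) := GRing.Linear.copy (ah2 m)
  (q12 ^ (- `|m|) \*: a sa2 m \+ q12 ^ (- `|m|) \*: a sb m).

Section ModeCommutator.
Variables (X : {linear V -> V}) (m : int) (k : 'I_4 -> C).
Hypothesis aX : forall s v, a s m (X v) = X (a s m v) + k s *: v.

Lemma ah1_comm v : ah1 m (X v) =
  X (ah1 m v) + (q12 ^ (- `|m|) * k sa1 - q12 ^ `|m| * k sa2) *: v.
Proof.
rewrite /ah1 !aX (linearB X) !(linearZE X) !scalerDr !scalerA scalerBl opprD.
by rewrite addrACA.
Qed.

Lemma ah2_comm v : ah2 m (X v) =
  X (ah2 m v) + (q12 ^ (- `|m|) * (k sa2 + k sb)) *: v.
Proof.
rewrite /ah2 !aX (linearD X) !(linearZE X) !scalerDr !scalerA mulrDr scalerDl.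
by rewrite addrACA.
Qed.

End ModeCommutator.

Definition sqr_level m : C := m%:R ^+ 2 / qint q12 m ^+ 2.
Definition qsum m : C := (q12 ^+ 2) ^+ m + (q12 ^+ 2) ^- m.

Definition dterm m v : V := sqr_level m *:
  (ah1 (- m%:Z) (ah2 m v) + ah2 (- m%:Z) (ah1 m v)
   + qsum m *: ah2 (- m%:Z) (ah2 m v)).
Definition cterm m v : V := sqr_level m *: a sc (- m%:Z) (a sc m v).
Definition zero_part v : V :=
  ah1 0 (ah2 0 v) + ah2 0 (ah2 0 v) - 2%:R^-1 *: a sc 0 (a sc 0 v + v).
(** The derivation with both sums cut at [N]; unlike the original, its linearity does not depend on
    any finiteness of support. *)
Definition dN N v : V := \sum_(i < N) dterm i.+1 v - \sum_(i < N) cterm i.+1 v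
  + zero_part v.

HB.instance Definition _ m := GRing.Linear.copy (dterm m)
  (sqr_level m \*: ((ah1 (- m%:Z) \o ah2 m) \+ (ah2 (- m%:Z) \o ah1 m)
    \+ qsum m \*: (ah2 (- m%:Z) \o ah2 m))).
HB.instance Definition _ m := GRing.Linear.copy (cterm m)
  (sqr_level m \*: (a sc (- m%:Z) \o a sc m)).
HB.instance Definition _ := GRing.Linear.copy zero_part
  ((ah1 0 \o ah2 0) \+ (ah2 0 \o ah2 0)
    \- 2%:R^-1 \*: (a sc 0 \o (a sc 0 \+ idfun))).

Lemma dN_linear N : linear (dN N).
Proof.
move=> c v w.
have E x : dN N x = \sum_(i < N) (dterm i.+1 x - cterm i.+1 x) + zero_part x.
  by rewrite /dN sumrB.
rewrite !E scalerDr addrACA scaler_sumr -big_split /=; congr (_ + _).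
  apply: eq_bigr => i _; rewrite scalerBr addrACA -opprD.
  by congr (_ - _); [exact: (linearP (dterm _))|exact: (linearP (cterm _))].
exact: (linearP zero_part).
Qed.
HB.instance Definition _ N := GRing.isLinear.Build C V V *:%R (dN N) (dN_linear N).

(** The coefficient $m^2/[m]^2$ of $d$ is chosen for this: it turns the commutator $[m]^2/m$ into
    the eigenvalue $m$. *)
Lemma sqr_level_gram m : (0 < m)%N -> sqr_level m * gram q12 m = m%:R.
Proof.
move=> m0; have qm : qint q12 m != 0 by exact: qint_neq0.
have mC : m%:R != 0 :> C by rewrite pnatr_eq0 -lt0n.
by rewrite /sqr_level /gram; field; rewrite qm mC.
Qed.

Lemma q12_pow m : q12 ^ (- m%:Z) * q12 ^ m%:Z = 1.
Proof. by rewrite -expfzDr // addNr. Qed.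
Lemma qsumE m : qsum m = q12 ^ (- m%:Z) * q12 ^ (- m%:Z) + q12 ^ m%:Z * q12 ^ m%:Z.
Proof.
by rewrite /qsum -exprnP -exprnN -invfM -!expr2 -!exprM mulnC addrC.
Qed.

Lemma zero_ah1 s (m : int) v : a s 0 (ah1 m v) = ah1 m (a s 0 v).
Proof. by rewrite /ah1 (linearB (a s 0)) !(linearZE (a s 0)) /= !(a_zeroC s). Qed.

Lemma zero_ah2 s (m : int) v : a s 0 (ah2 m v) = ah2 m (a s 0 v).
Proof. by rewrite /ah2 (linearD (a s 0)) !(linearZE (a s 0)) /= !(a_zeroC s). Qed.

Lemma comm_ah1 (A : {linear V -> V}) (m : int) v :
  (forall s w, A (a s m w) = a s m (A w)) -> A (ah1 m v) = ah1 m (A v).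
Proof. by move=> Aa; rewrite /ah1 (linearB A) !(linearZE A) !Aa. Qed.

Lemma comm_ah2 (A : {linear V -> V}) (m : int) v :
  (forall s w, A (a s m w) = a s m (A w)) -> A (ah2 m v) = ah2 m (A v).
Proof. by move=> Aa; rewrite /ah2 (linearD A) !(linearZE A) !Aa. Qed.

Section Grading.
Variables (L : {linear V -> V}) (m : int) (k : C).
Hypothesis La : forall s v, L (a s m v) = a s m (L v) + k *: a s m v.

Lemma grading_ah1 v : L (ah1 m v) = ah1 m (L v) + k *: ah1 m v.
Proof.
rewrite /ah1 (linearB L) !(linearZE L) /= !La !scalerDr !scalerN !scalerA.
by rewrite opprD addrACA ![k * _]mulrC.
Qed.

Lemma grading_ah2 v : L (ah2 m v) = ah2 m (L v) + k *: ah2 m v.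
Proof.
rewrite /ah2 (linearD L) !(linearZE L) /= !La !scalerDr !scalerA.
by rewrite addrACA ![k * _]mulrC.
Qed.

End Grading.

Section ZeroModes.
Variable X : {linear V -> V}.
Hypothesis a0X : forall s v, a s 0 (X v) = X (a s 0 v).

Lemma ah1_zero_comm v : ah1 0 (X v) = X (ah1 0 v).
Proof. by rewrite /ah1 !a0X (linearB X) !(linearZE X). Qed.

Lemma ah2_zero_comm v : ah2 0 (X v) = X (ah2 0 v).
Proof. by rewrite /ah2 !a0X (linearD X) !(linearZE X). Qed.

Lemma zero_part_comm v : zero_part (X v) = X (zero_part v).
Proof.
have lin3 c x y z : X (x + y - c *: z) = X x + X y - c *: X z.
  by rewrite (linearB X) (linearD X) (linearZE X).
by rewrite /zero_part lin3 !ah2_zero_comm ah1_zero_comm a0X -(linearD X) /= a0X.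
Qed.

End ZeroModes.

Section Commutator.
Variables (X : {linear V -> V}) (n : nat) (k1 k2 kc : nat -> C).
Hypothesis h1X : forall m v, (0 < m)%N -> ah1 m (X v) = X (ah1 m v) + k1 m *: v.
Hypothesis h2X : forall m v, (0 < m)%N -> ah2 m (X v) = X (ah2 m v) + k2 m *: v.
Hypothesis cX : forall m v, (0 < m)%N -> a sc m (X v) = X (a sc m v) + kc m *: v.
Hypothesis aX : forall s m v, a s (- m%:Z) (X v) = X (a s (- m%:Z) v).
Hypothesis extra : forall m v, (0 < m)%N -> sqr_level m *:
     (k2 m *: ah1 (- m%:Z) v + k1 m *: ah2 (- m%:Z) v
      + qsum m *: (k2 m *: ah2 (- m%:Z) v)) - sqr_level m *: (kc m *: a sc (- m%:Z) v)
    = ((m == n)%:R * - n%:R) *: X v.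

Lemma ah1_creation_comm m w : ah1 (- m%:Z) (X w) = X (ah1 (- m%:Z) w).
Proof. by rewrite /ah1 !aX (linearB X) !(linearZE X). Qed.

Lemma ah2_creation_comm m w : ah2 (- m%:Z) (X w) = X (ah2 (- m%:Z) w).
Proof. by rewrite /ah2 !aX (linearD X) !(linearZE X). Qed.

Let ah1_affine m w c v :
  ah1 (- m%:Z) (X w + c *: v) = X (ah1 (- m%:Z) w) + c *: ah1 (- m%:Z) v.
Proof. by rewrite (linearD (ah1 _)) (linearZE (ah1 _)) -ah1_creation_comm. Qed.

Let ah2_affine m w c v :
  ah2 (- m%:Z) (X w + c *: v) = X (ah2 (- m%:Z) w) + c *: ah2 (- m%:Z) v.
Proof. by rewrite (linearD (ah2 _)) (linearZE (ah2 _)) -ah2_creation_comm. Qed.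

Let affine_sum (r s : C) (x y z x' y' z' : V) :
  r *: (X x + x' + (X y + y') + s *: (X z + z')) =
  X (r *: (x + y + s *: z)) + r *: (x' + y' + s *: z').
Proof.
rewrite (linearZE X) -scalerDr !(linearD X) (linearZE X).
rewrite [s *: (_ + _)]scalerDr; congr (_ *: _).
by rewrite [X in X + _ = _]addrACA [LHS]addrACA.
Qed.

Lemma dterm_comm m v : (0 < m)%N -> dterm m (X v) = X (dterm m v) + sqr_level m *:
  (k2 m *: ah1 (- m%:Z) v + k1 m *: ah2 (- m%:Z) v
   + qsum m *: (k2 m *: ah2 (- m%:Z) v)).
Proof.
by move=> m0; rewrite /dterm h1X // h2X // ah1_affine !ah2_affine affine_sum.
Qed.

Lemma cterm_comm m v : (0 < m)%N -> cterm m (X v) = X (cterm m v)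
  + sqr_level m *: (kc m *: a sc (- m%:Z) v).
Proof.
move=> m0; rewrite /cterm cX // (linearD (a sc _)) /= (linearZE (a sc _)) aX.
by rewrite (linearZE X) scalerDr.
Qed.

(** Only the annihilation factors of $d$ fail to commute with [X]. Their scalar commutators leave
    creation modes, which by [extra] combine to $-nX$ for $m=n$ and to zero otherwise. *)
Lemma dN_commutator N v : (0 < n <= N)%N ->
  dN N (X v) = X (dN N v) - n%:R *: X v.
Proof.
move=> nN; have a0X s w : a s 0 (X w) = X (a s 0 w).
  by have := aX s 0%N w; rewrite oppr0.
rewrite /dN (zero_part_comm a0X) -!sumrB [in RHS](linearD X) addrAC.
congr (_ + _); rewrite (linear_sum X) /=.
transitivity (\sum_(i < N) (X (dterm i.+1 v - cterm i.+1 v)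
    + ((i.+1 == n)%:R * - n%:R) *: X v)).
  apply: eq_bigr => i _; rewrite dterm_comm // cterm_comm // (linearB X) /=.
  by rewrite -extra // opprD addrACA.
rewrite big_split /=; congr (_ + _); case: n nN => // n' /andP[_ nN].
rewrite (bigD1 (Ordinal nN)) //= eqxx mul1r big1 ?addr0 ?scaleNr //.
move=> i /negPf; rewrite -val_eqE /= eqSS => ->.
by rewrite mul0r scale0r.
Qed.

End Commutator.

Lemma mode_ah1 s m n v : (0 < m)%N -> (0 < n)%N ->
  a s m%:Z (ah1 (- n%:Z) v) = ah1 (- n%:Z) (a s m%:Z v)
  + ((m == n)%:R * gram q12 m *
     (q12 ^ (- n%:Z) * (s == sa1)%:R - q12 ^ n%:Z * (s == sa2)%:R)) *: v.
Proof.
move=> m0 n0; rewrite /ah1 normrN (linearB (a s m%:Z)) !(linearZE (a s m%:Z)) !a_comm //.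
rewrite !scalerDr !scalerA opprD addrACA -scalerBl; congr (_ + _ *: _).
have [-> | s1] := eqVneq s sa1; first by rewrite /signature /=; case: eqP => _; ring.
have [-> | s2] := eqVneq s sa2; first by rewrite /signature /=; case: eqP => _; ring.
by rewrite /=; ring.
Qed.

Lemma mode_ah2 s m n v : (0 < m)%N -> (0 < n)%N ->
  a s m%:Z (ah2 (- n%:Z) v) = ah2 (- n%:Z) (a s m%:Z v)
  + ((m == n)%:R * gram q12 m *
     (q12 ^ (- n%:Z) * ((s == sa2)%:R - (s == sb)%:R))) *: v.
Proof.
move=> m0 n0; rewrite /ah2 normrN (linearD (a s m%:Z)) !(linearZE (a s m%:Z)) !a_comm //.
rewrite !scalerDr !scalerA addrACA -scalerDl; congr (_ + _ *: _).
have [-> | s1] := eqVneq s sa2; first by rewrite /signature /=; case: eqP => _; ring.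
have [-> | s2] := eqVneq s sb; first by rewrite /signature /=; case: eqP => _; ring.
by rewrite /=; ring.
Qed.

Section CreationModes.
Variables (n : nat).
Hypothesis n0 : (0 < n)%N.
Implicit Type N : nat.

Let creation_linear (X : {linear V -> V}) (c d : C) s t v w :
  X (c *: a s (- n%:Z) v - d *: a t (- n%:Z) w) =
  c *: X (a s (- n%:Z) v) - d *: X (a t (- n%:Z) w).
Proof. by rewrite (linearB X) !(linearZE X). Qed.

Lemma creation_ah1C s m v :
  a s (- m%:Z) (ah1 (- n%:Z) v) = ah1 (- n%:Z) (a s (- m%:Z) v).
Proof. by rewrite /ah1 creation_linear !(a_creationC s). Qed.

Lemma creation_ah2C s m v :
  a s (- m%:Z) (ah2 (- n%:Z) v) = ah2 (- n%:Z) (a s (- m%:Z) v).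
Proof.
rewrite /ah2 (linearD (a s _)) !(linearZE (a s _)).
by rewrite !(a_creationC s).
Qed.

(** The commutators of $h^1_n, h^2_n$ with $h^1_{-n}, h^2_{-n}$ form [gram] times the matrix with
    rows $(q^n+q^{-n}, -1)$ and $(-1, 0)$. The quadratic form in $d$ has minus the inverse of that
    matrix, so each $h^i_{-n}$ is shifted by $-n$. *)
Lemma dN_ah1 N v : (n <= N)%N ->
  dN N (ah1 (- n%:Z) v) = ah1 (- n%:Z) (dN N v) - n%:R *: ah1 (- n%:Z) v.
Proof.
move=> nN; apply: (dN_commutator (X := ah1 (- n%:Z))
  (k1 := fun m => (m == n)%:R * gram q12 m * qsum m)
  (k2 := fun m => - ((m == n)%:R * gram q12 m)) (kc := fun=> 0)) => //; last by rewrite n0.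
- move=> m w m0; rewrite (ah1_comm (fun s v => mode_ah1 s v m0 n0)).
  congr (_ + _ *: _); rewrite (_ : `|m%:Z| = m%:Z) // !eqxx qsumE.
  by case: eqP => [->|_]; rewrite /=; ring.
- move=> m w m0; rewrite (ah2_comm (fun s v => mode_ah1 s v m0 n0)).
  congr (_ + _ *: _); rewrite (_ : `|m%:Z| = m%:Z) // /=.
  case: eqP => [->|_]; last by rewrite /=; ring.
  transitivity (- gram q12 n * (q12 ^ (- n%:Z) * q12 ^ n%:Z)); first by rewrite /=; ring.
  by rewrite q12_pow mulr1 mul1r.
- move=> m w m0; rewrite (mode_ah1 _ _ m0 n0) /=; congr (_ + _ *: _).
  by ring.
- by move=> s m w; rewrite creation_ah1C.
move=> m w m0; rewrite scale0r scaler0 subr0.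
have [->|mn] := eqVneq m n; last first.
  by rewrite !mul0r oppr0 !scale0r !(addr0, scaler0).
rewrite !mul1r !scaleNr scalerN scalerA [qsum n * _]mulrC.
by rewrite -addrA subrr addr0 scalerN scalerA sqr_level_gram.
Qed.

Lemma dN_ah2 N v : (n <= N)%N ->
  dN N (ah2 (- n%:Z) v) = ah2 (- n%:Z) (dN N v) - n%:R *: ah2 (- n%:Z) v.
Proof.
move=> nN; apply: (dN_commutator (X := ah2 (- n%:Z))
  (k1 := fun m => - ((m == n)%:R * gram q12 m))
  (k2 := fun m => 0) (kc := fun=> 0)) => //; last by rewrite n0.
- move=> m w m0; rewrite (ah1_comm (fun s v => mode_ah2 s v m0 n0)).
  congr (_ + _ *: _); rewrite (_ : `|m%:Z| = m%:Z) // /=.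
  case: eqP => [->|_]; last by rewrite /=; ring.
  transitivity (- gram q12 n * (q12 ^ (- n%:Z) * q12 ^ n%:Z)); first by rewrite /=; ring.
  by rewrite q12_pow mulr1 mul1r.
- move=> m w m0; rewrite (ah2_comm (fun s v => mode_ah2 s v m0 n0)).
  congr (_ + _ *: _); rewrite /=; ring.
- move=> m w m0; rewrite (mode_ah2 _ _ m0 n0) /=; congr (_ + _ *: _).
  by ring.
- by move=> s m w; rewrite creation_ah2C.
move=> m w m0; rewrite !scale0r !scaler0 subr0 add0r addr0.
have [->|mn] := eqVneq m n; last by rewrite !mul0r oppr0 !scale0r scaler0.
by rewrite !mul1r !scaleNr scalerN scalerA sqr_level_gram.
Qed.

Lemma dN_c N v : (n <= N)%N ->
  dN N (a sc (- n%:Z) v) = a sc (- n%:Z) (dN N v) - n%:R *: a sc (- n%:Z) v.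
Proof.
move=> nN; apply: (dN_commutator (X := a sc (- n%:Z))
  (k1 := fun m => 0) (k2 := fun m => 0)
  (kc := fun m => (m == n)%:R * gram q12 m)) => //;
  last by rewrite n0.
- move=> m w m0; rewrite (ah1_comm (fun s v => a_comm s sc v m0 n0)).
  by congr (_ + _ *: _); rewrite /=; ring.
- move=> m w m0; rewrite (ah2_comm (fun s v => a_comm s sc v m0 n0)).
  by congr (_ + _ *: _); rewrite /=; ring.
- move=> m w m0; rewrite a_comm // eqxx /signature /=; congr (_ + _ *: _).
  by ring.
move=> m w m0; rewrite !scale0r !scaler0 !addr0 scaler0 sub0r.
have [->|mn] := eqVneq m n; last by rewrite !mul0r !scale0r scaler0 oppr0.
by rewrite !mul1r scalerA sqr_level_gram // scaleNr.
Qed.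

End CreationModes.

End OscillatorRepresentation.

Lemma fsum_positive (W : zmodType) (F : nat -> W) (N : nat) :
  (forall m, (N <= m)%N -> F m = 0) ->
  \sum_(m \in [set m : nat | (0 < m)%N]) F m = \sum_(i < N) F i.+1.
Proof.
move=> F0; rewrite (fsbigE (iota 1 N)); first 1 last.
- exact: iota_uniq.
- by move=> m /=; rewrite mem_iota => /andP[].
- by case=> // m _; rewrite mem_iota ltnS => mN; apply: F0; lia.
rewrite -[1%N]addn0 iotaDl big_map -{1}[N]subn0 -/(index_iota 0 N) big_mkord.
by apply: eq_bigl => i; apply: mem_set.
Qed.

Definition oscl (C : numClosedFieldType) (q12 : C) (s : 'I_4) (m : int) :
  {linear fockmod C -> fockmod C} := osc q12 s m.

Section DerivationOnFock.
Variables (C : numClosedFieldType) (q12 : C).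
Hypothesis q12_neq0 : q12 != 0.
Hypothesis q_generic : forall n : nat, (0 < n)%N -> (q12 ^+ 2) ^+ n != 1.
Notation V := (fockmod C).
Notation a := (oscl q12).
Implicit Types (v w : V) (lam : 'rV[C]_4).

Lemma h1E m v : h1 q12 m v = ah1 q12 a m v. Proof. by []. Qed.
Lemma h2E m v : h2 q12 m v = ah2 q12 a m v. Proof. by []. Qed.
HB.instance Definition _ m := GRing.Linear.copy (h1 q12 m) (ah1 q12 a m).
HB.instance Definition _ m := GRing.Linear.copy (h2 q12 m) (ah2 q12 a m).

Lemma h1_vanish (m : nat) v : (degree_bound v <= m)%N -> h1 q12 m v = 0.
Proof.
by move=> vm; rewrite /h1 !(osc_vanish q12 _ vm) !scaler0 subr0.
Qed.
Lemma h2_vanish (m : nat) v : (degree_bound v <= m)%N -> h2 q12 m v = 0.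
Proof.
by move=> vm; rewrite /h2 !(osc_vanish q12 _ vm) !scaler0 addr0.
Qed.

Let assoc5 (W : zmodType) (x y z t u : W) : x - y + z + t - u = x - y + (z + t - u).
Proof. by rewrite !addrA. Qed.

Lemma derivation_split v : derivation q12 v =
  \sum_(m \in [set m : nat | (0 < m)%N]) dterm q12 a m v
  - \sum_(m \in [set m : nat | (0 < m)%N]) cterm q12 a m v + zero_part q12 a v.
Proof. exact: (@assoc5 V). Qed.

Lemma derivationE v N : (degree_bound v <= N)%N ->
  derivation q12 v = dN q12 a N v.
Proof.
move=> vN; rewrite derivation_split.
have dterm0 (m : nat) : (N <= m)%N -> dterm q12 a m v = 0.
  move=> Nm; have vm := leq_trans vN Nm.
  rewrite /dterm -!h1E -!h2E (h2_vanish vm) (h1_vanish vm).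
  by rewrite (linear0 (h1 q12 _)) (linear0 (h2 q12 _)) (scaler0 V) !addr0 (scaler0 V).
have cterm0 (m : nat) : (N <= m)%N -> cterm q12 a m v = 0.
  move=> Nm; have vm := leq_trans vN Nm.
  rewrite /cterm /oscl /= (osc_vanish q12 _ vm) (linear0 (osc q12 sc _)).
  exact: (scaler0 V).
exact: (congr2 (fun x y : V => x - y + zero_part q12 a v)
  (fsum_positive dterm0) (fsum_positive cterm0)).
Qed.

Lemma derivation_linear : linear (derivation q12).
Proof.
move=> c v w.
pose N := (degree_bound v + degree_bound w + degree_bound (c *: v + w)%R)%N.
rewrite !(derivationE (N := N)) /N; try lia.
exact: (linearP (dN q12 a _)).
Qed.
HB.instance Definition _ := GRing.isLinear.Build C V V *:%R (derivation q12)
  derivation_linear.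

Lemma derivation_h1 (n : nat) v : (0 < n)%N ->
  derivation q12 (h1 q12 (- n%:Z) v) =
  h1 q12 (- n%:Z) (derivation q12 v) - n%:R *: h1 q12 (- n%:Z) v.
Proof.
move=> n0; pose N := (degree_bound v + degree_bound (h1 q12 (- n%:Z)%R v) + n)%N.
rewrite !(derivationE (N := N)) /N; try lia.
exact: (dN_ah1 (a := a) q12_neq0 q_generic (osc_creationC q12)
  (osc_comm q12) n0 _ (leq_addl _ _)).
Qed.

Lemma derivation_h2 (n : nat) v : (0 < n)%N ->
  derivation q12 (h2 q12 (- n%:Z) v) =
  h2 q12 (- n%:Z) (derivation q12 v) - n%:R *: h2 q12 (- n%:Z) v.
Proof.
move=> n0; pose N := (degree_bound v + degree_bound (h2 q12 (- n%:Z)%R v) + n)%N.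
rewrite !(derivationE (N := N)) /N; try lia.
exact: (dN_ah2 (a := a) q12_neq0 q_generic (osc_creationC q12)
  (osc_comm q12) n0 _ (leq_addl _ _)).
Qed.

Lemma derivation_c (n : nat) v : (0 < n)%N ->
  derivation q12 (osc q12 sc (- n%:Z) v) =
  osc q12 sc (- n%:Z) (derivation q12 v) - n%:R *: osc q12 sc (- n%:Z) v.
Proof.
move=> n0; pose N := (degree_bound v + degree_bound (osc q12 sc (- n%:Z)%R v) + n)%N.
rewrite !(derivationE (N := N)) /N; try lia.
exact: (dN_c (a := a) q12_neq0 q_generic (osc_creationC q12)
  (osc_comm q12) n0 _ (leq_addl _ _)).
Qed.

End DerivationOnFock.

(** * Operators diagonal on monomials *)

HB.lock Definition diagop (C : numClosedFieldType) (f : fockbasis C -> C) :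
  fockmod C -> fockmod C := linext (fun k => f k *: << k >>).

Section DiagonalOperators.
Variables (C : numClosedFieldType) (q12 : C).
Notation V := (fockmod C).
Implicit Types (v w : V) (lam mu : 'rV[C]_4) (o : occupation) (f g : fockbasis C -> C).

Lemma diagop_linear f : linear (diagop f).
Proof. rewrite diagop.unlock; exact: linext_linear. Qed.
HB.instance Definition _ f := GRing.isLinear.Build C V V *:%R (diagop f)
  (diagop_linear f).

Lemma diagopU f lam o : diagop f (ket lam o) = f (lam, o) *: ket lam o.
Proof. by rewrite diagop.unlock linextU ket.unlock. Qed.

Lemma fock_coefP v w : (forall k, v@_k = w@_k) -> v = w.
Proof. by move=> vw; apply/malgP. Qed.

Lemma diagop_coef f v k : (diagop f v)@_k = f k * v@_k.
Proof. rewrite diagop.unlock; exact: linext_coef. Qed.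

Lemma diagopC f g v : diagop f (diagop g v) = diagop g (diagop f v).
Proof.
move: v; apply: (linear_eq (f := diagop f \o diagop g) (g := diagop g \o diagop f)).
move=> lam o /=; have DZ h c v : diagop h (c *: v) = c *: diagop h v.
  exact: linearZ.
by rewrite !diagopU !DZ !diagopU !scalerA mulrC.
Qed.

Lemma levop_diag v : levop v = diagop (fun k => (level k.2)%:R) v.
Proof. by rewrite diagop.unlock. Qed.

Lemma zpow_diag n v :
  zpow_c0 n v = diagop (fun k => (k.1 ord0 sc == n%:~R)%:R) v.
Proof.
move: v; apply: (linear_eq (f := zpow_c0 n) (g := diagop _)) => lam o.
by rewrite /= zpowU diagopU.
Qed.

Lemma osc0_diag s v :
  osc q12 s 0 v = diagop (fun k => signature C s * k.1 ord0 s) v.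
Proof.
move: v; apply: (linear_eq (f := osc q12 s 0) (g := diagop _)) => lam o.
by rewrite /= oscU0 diagopU.
Qed.

Lemma diagop_osc f s n v :
  (forall lam o x, x.1 = s -> f (lam, inc o x) = f (lam, o)) ->
  diagop f (osc q12 s n v) = osc q12 s n (diagop f v).
Proof.
move=> fs; move: v; apply: (linear_eq (f := diagop f \o osc q12 s n)
  (g := osc q12 s n \o diagop f)) => lam o /=.
have DZ c v : diagop f (c *: v) = c *: diagop f v by exact: linearZ.
rewrite diagopU oscZ.
case: n => [[|n]|n]; rewrite ?NegzE.
- by rewrite oscU0 DZ diagopU !scalerA mulrC.
- rewrite oscUP DZ diagopU !scalerA; apply: scaler_eq.
  have [o0|o0] := posnP (o (s, n)); first by rewrite o0 !(mulr0, mul0r).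
  by rewrite -(fs lam _ (s, n)) // decK // mulrC.
- by rewrite oscUN diagopU fs.
Qed.

Lemma diagop_expQ f mu v :
  diagop f (expQ mu v) = expQ mu (diagop (fun k => f (k.1 + mu, k.2)) v).
Proof.
move: v; apply: (linear_eq (f := diagop f \o expQ mu)
  (g := expQ mu \o diagop (fun k => f (k.1 + mu, k.2)))) => lam o /=.
have DZ c v : expQ mu (c *: v) = c *: expQ mu v by exact: linearZ.
by rewrite expQU !diagopU DZ expQU.
Qed.

Lemma diagop_eigen f c v :
  diagop f v = c *: v <-> forall k, k \in msupp v -> f k = c.
Proof.
split=> [fv k|fc].
  rewrite -mcoeff_neq0 => vk.
  have := congr1 (mcoeff k) fv; rewrite diagop_coef mcoeffZ => /eqP.
  by rewrite -subr_eq0 -mulrBl mulf_eq0 subr_eq0 (negPf vk) orbF => /eqP.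
apply: fock_coefP => k; rewrite diagop_coef mcoeffZ.
by have [kv|_] := msuppP v k; rewrite ?mulr0 // fc.
Qed.

End DiagonalOperators.

Section FockStructure.
Variables (C : numClosedFieldType) (q12 : C).
Hypothesis q12_neq0 : q12 != 0.
Hypothesis q_generic : forall n : nat, (0 < n)%N -> (q12 ^+ 2) ^+ n != 1.
Notation V := (fockmod C).
Notation a := (oscl q12).
Implicit Types (v w : V) (lam mu : 'rV[C]_4) (o : occupation).

Notation zpart := (zero_part q12 a).
Notation empty := ([fsfun] : occupation).

Lemma charged_vacuumE lam : charged_vacuum lam = ket lam empty.
Proof.
rewrite /charged_vacuum /vacuum; have -> : << (0, [fsfun]) >> = ket 0 empty :> V.
  by rewrite ket.unlock.
by rewrite expQU add0r.
Qed.

Lemma osc_vacuum s m lam : (0 < m)%N -> osc q12 s m%:Z (ket lam empty) = 0.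
Proof.
case: m => // m _; rewrite oscUP; apply: etrans (scale0r _).
by apply: scaler_eq; rewrite fsfun0E mulr0.
Qed.

Lemma levop_vacuum lam : levop (ket lam empty) = 0.
Proof. by rewrite levopU level0 scale0r. Qed.

Let fock_step_linear (W : lmodType C) (D Z L : {linear W -> W}) c (u v : W) :
  D u = Z u - L u -> D v = Z v - L v -> D (c *: u + v) = Z (c *: u + v) - L (c *: u + v).
Proof.
move=> Du Dv; rewrite (linearP D) (linearP Z) (linearP L) Du Dv.
by rewrite scalerBr opprD addrACA.
Qed.

Let fock_step (W : lmodType C) (D Z L X : {linear W -> W}) c (v : W) :
  D v = Z v - L v -> D (X v) = X (D v) - c *: X v -> Z (X v) = X (Z v) ->
  L (X v) = X (L v) + c *: X v -> D (X v) = Z (X v) - L (X v).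
Proof.
by move=> Dv -> -> ->; rewrite Dv (linearB X) opprD addrA.
Qed.

Lemma levop_h1 (n : nat) v :
  levop (h1 q12 (- n%:Z) v) = h1 q12 (- n%:Z) (levop v) + n%:R *: h1 q12 (- n%:Z) v.
Proof.
have grd s w : levop (a s (- n%:Z) w) =
    a s (- n%:Z) (levop w) + n%:R *: a s (- n%:Z) w.
  by have := levop_osc q12 s (- n%:Z) w; rewrite mulrNz opprK.
exact: (@grading_ah1 C q12 V a levop _ _ grd v).
Qed.

Lemma levop_h2 (n : nat) v :
  levop (h2 q12 (- n%:Z) v) = h2 q12 (- n%:Z) (levop v) + n%:R *: h2 q12 (- n%:Z) v.
Proof.
have grd s w : levop (a s (- n%:Z) w) =
    a s (- n%:Z) (levop w) + n%:R *: a s (- n%:Z) w.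
  by have := levop_osc q12 s (- n%:Z) w; rewrite mulrNz opprK.
exact: (@grading_ah2 C q12 V a levop _ _ grd v).
Qed.

Lemma levop_c (n : nat) v : levop (osc q12 sc (- n%:Z) v) =
  osc q12 sc (- n%:Z) (levop v) + n%:R *: osc q12 sc (- n%:Z) v.
Proof. by have := levop_osc q12 sc (- n%:Z) v; rewrite mulrNz opprK. Qed.

Lemma derivation_vacuum lam :
  derivation q12 (ket lam empty) = zpart (ket lam empty) - levop (ket lam empty).
Proof.
rewrite levop_vacuum subr0 derivation_split.
have h10 (m : nat) : (0 < m)%N -> h1 q12 m (ket lam empty) = 0.
  by move=> m0; rewrite /h1 !osc_vacuum // !scaler0 subr0.
have h20 (m : nat) : (0 < m)%N -> h2 q12 m (ket lam empty) = 0.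
  by move=> m0; rewrite /h2 !osc_vacuum // !scaler0 addr0.
have dterm0 (m : nat) : (0 < m)%N -> dterm q12 a m (ket lam empty) = 0.
  move=> m0; rewrite /dterm -!h1E -!h2E h10 // h20 //.
  by rewrite (linear0 (h1 q12 _)) (linear0 (h2 q12 _)) (scaler0 V) !addr0 (scaler0 V).
have cterm0 (m : nat) : (0 < m)%N -> cterm q12 a m (ket lam empty) = 0.
  move=> m0; rewrite /cterm /oscl /= osc_vacuum // (linear0 (osc q12 sc _)).
  exact: (scaler0 V).
have E1 := @fsbig1 _ _ (+%R : V -> V -> V) _ [set m : nat | (0 < m)%N] _ dterm0.
have E2 := @fsbig1 _ _ (+%R : V -> V -> V) _ [set m : nat | (0 < m)%N] _ cterm0.
apply: etrans (congr2 (fun x y : V => x - y + zpart _) E1 E2) _.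
by rewrite subr0 add0r.
Qed.

Lemma fock_ket lam : fock q12 lam (ket lam empty).
Proof. by rewrite -charged_vacuumE; exact: fock_vacuum. Qed.

Lemma fock_lin lam (c : C) u v :
  fock q12 lam u -> fock q12 lam v -> fock q12 lam (c *: u + v).
Proof. exact: fock_linear. Qed.

Lemma fock_elim lam (P : V -> Prop) :
  P (ket lam empty) ->
  (forall c u v, fock q12 lam u -> P u -> fock q12 lam v -> P v -> P (c *: u + v)) ->
  (forall (m : nat) v, (0 < m)%N -> fock q12 lam v -> P v -> P (h1 q12 (- m%:Z) v)) ->
  (forall (m : nat) v, (0 < m)%N -> fock q12 lam v -> P v -> P (h2 q12 (- m%:Z) v)) ->
  (forall (m : nat) v, (0 < m)%N -> fock q12 lam v -> P v ->
    P (osc q12 sc (- m%:Z) v)) ->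
  forall v, fock q12 lam v -> P v.
Proof.
move=> Pvac Plin Ph1 Ph2 Pc; apply: fock_ind => //.
by rewrite charged_vacuumE.
Qed.

(** Both sides agree on the vacuum, and each generator of degree $-m$ changes both by $-m$. On the
    whole module this fails: $q^m a^1_{-m}+a^2_{-m}+b_{-m}$ raises the level but commutes with
    $d$. *)
Lemma derivation_fock lam v : fock q12 lam v -> derivation q12 v = zpart v - levop v.
Proof.
apply: (fock_elim (P := fun w => derivation q12 w = zpart w - levop w)) => {v}
  [|c u v _ IHu _ IHv|m v m0 _ IH|m v m0 _ IH|m v m0 _ IH].
- exact: derivation_vacuum.
- exact: (@fock_step_linear V (derivation q12) zpart levop c u v IHu IHv).
- have aX s w : a s 0 (h1 q12 (- m%:Z) w) = h1 q12 (- m%:Z) (a s 0 w).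
    exact: (@zero_ah1 C q12 V a (osc_zeroC q12)).
  exact: (@fock_step V (derivation q12) zpart levop (h1 q12 (- m%:Z)) m%:R v IH
    (derivation_h1 q12_neq0 q_generic v m0)
    (@zero_part_comm C q12 V a (h1 q12 (- m%:Z)) aX v) (levop_h1 m v)).
- have aX s w : a s 0 (h2 q12 (- m%:Z) w) = h2 q12 (- m%:Z) (a s 0 w).
    exact: (@zero_ah2 C q12 V a (osc_zeroC q12)).
  exact: (@fock_step V (derivation q12) zpart levop (h2 q12 (- m%:Z)) m%:R v IH
    (derivation_h2 q12_neq0 q_generic v m0)
    (@zero_part_comm C q12 V a (h2 q12 (- m%:Z)) aX v) (levop_h2 m v)).
have aX s w : a s 0 (osc q12 sc (- m%:Z) w) = osc q12 sc (- m%:Z) (a s 0 w).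
  exact: osc_zeroC.
exact: (@fock_step V (derivation q12) zpart levop (osc q12 sc (- m%:Z)) m%:R v IH
  (derivation_c q12_neq0 q_generic v m0)
  (@zero_part_comm C q12 V a (osc q12 sc (- m%:Z)) aX v) (levop_c m v)).
Qed.

End FockStructure.

(** * The Fock space as a polynomial space *)

(* Modulo the [a^2_{-n}], [q^n h^1_{-n}] and [q^n h^2_{-n}] become [a^1_{-n}] and
   [b_{-n}], so the monomials without [a^2_{-n}] give coordinates on [fock lam]. *)
Definition good (o : occupation) : bool := all (fun x => x.1 != sa2) (finsupp o).

Lemma goodP (o : occupation) : reflect (forall n, o (sa2, n) = 0%N) (good o).
Proof.
apply: (iffP allP) => [go n|o0 [s n]].
  by apply: fsfun_dflt; apply: contraL isT => /go; rewrite eqxx.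
by rewrite mem_finsupp /=; apply: contraNneq => ->; rewrite o0.
Qed.

Lemma good_inc (o : occupation) x : good (inc o x) = (x.1 != sa2) && good o.
Proof.
apply/goodP/andP => [go|[xs /goodP go] n].
  split; last by apply/goodP => n; have := go n; rewrite incE; lia.
  case: x go => s n go /=; apply/eqP => ss; have := go n.
  by rewrite incE ss eqxx addn1.
rewrite incE go; case: x xs => s m /= ss.
by rewrite xpair_eqE eq_sym (negPf ss).
Qed.

(** The list form, undone by [word_occ], gives induction on occupations one letter at a time. *)
Definition word (o : occupation) : seq ('I_4 * nat) :=
  flatten [seq nseq (o x) x | x <- finsupp o].

Lemma count_word (o : occupation) x : count_mem x (word o) = o x.
Proof.
rewrite /word count_flatten -map_comp sumnE big_map.
have E y : (count_mem x \o (fun y => nseq (o y) y)) y = ((y == x) * o y)%N.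
  by rewrite /= count_nseq /=.
under eq_bigr do rewrite E.
have [xo|xo] := boolP (x \in finsupp o).
  rewrite (big_fsetD1 x) //= eqxx mul1n big1_seq ?addn0 // => y /andP[_].
  by rewrite !inE => /andP[/negPf-> _].
rewrite big1_seq ?(fsfun_dflt xo) // => y /andP[_ yo].
by case: eqP yo xo => [->->|_ _ _]; rewrite ?mul0n.
Qed.

Definition word_occ (w : seq ('I_4 * nat)) : occupation :=
  foldr (fun x o => inc o x) [fsfun] w.

Lemma word_occE w x : word_occ w x = count_mem x w.
Proof.
elim: w => [|y w IH] /=; first by rewrite fsfun0E.
by rewrite incE IH addnC eq_sym.
Qed.

Lemma wordK (o : occupation) : word_occ (word o) = o.
Proof. by apply/fsfunP => x; rewrite word_occE count_word. Qed.

Lemma perm_word_inc (o : occupation) x : perm_eq (word (inc o x)) (x :: word o).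
Proof.
apply/allP => y _; apply/eqP; rewrite /= !count_word incE addnC.
by congr (nat_of_bool _ + _)%N; rewrite eq_sym.
Qed.

Section FockIsomorphism.
Variables (C : numClosedFieldType) (q12 : C).
Hypothesis q12_neq0 : q12 != 0.
Notation V := (fockmod C).
Notation a := (oscl q12).
Implicit Types (v w : V) (lam mu : 'rV[C]_4) (o : occupation) (n : nat).
Notation empty := ([fsfun] : occupation).

Definition goodpart : V -> V := diagop (fun k => (good k.2)%:R).
HB.instance Definition _ := GRing.Linear.copy goodpart
  (diagop (fun k : fockbasis C => (good k.2)%:R)).

Lemma goodpart_diag v : goodpart v = diagop (fun k => (good k.2)%:R) v.
Proof. by []. Qed.

Lemma goodpartU lam o : goodpart (ket lam o) = (good o)%:R *: ket lam o.
Proof. exact: diagopU. Qed.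

Lemma goodpart_osc s (n : int) v : s != sa2 ->
  goodpart (osc q12 s n v) = osc q12 s n (goodpart v).
Proof.
move=> s2; apply: diagop_osc => lam o x xs /=.
by rewrite good_inc xs s2.
Qed.

Lemma goodpart_zpow m v : goodpart (zpow_c0 m v) = zpow_c0 m (goodpart v).
Proof. by rewrite !zpow_diag; exact: diagopC. Qed.

Lemma goodpart_expQ mu v : goodpart (expQ mu v) = expQ mu (goodpart v).
Proof. exact: diagop_expQ. Qed.

Lemma goodpart_sa2 n v : goodpart (osc q12 sa2 (- n.+1%:Z) v) = 0.
Proof.
move: v; apply: (linear_eq (f := goodpart \o osc q12 sa2 (- n.+1%:Z))
  (g := (\0 : V -> V))) => lam o /=.
by rewrite oscUN goodpartU good_inc /= scale0r.
Qed.

Lemma h1_neg n v : h1 q12 (- n.+1%:Z) v =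
  q12 ^ (- n.+1%:Z) *: osc q12 sa1 (- n.+1%:Z) v
  - q12 ^ n.+1%:Z *: osc q12 sa2 (- n.+1%:Z) v.
Proof. by rewrite h1E /ah1 normrN. Qed.

Lemma h2_neg n v : h2 q12 (- n.+1%:Z) v =
  q12 ^ (- n.+1%:Z) *: osc q12 sa2 (- n.+1%:Z) v
  + q12 ^ (- n.+1%:Z) *: osc q12 sb (- n.+1%:Z) v.
Proof. by rewrite h2E /ah2 normrN. Qed.

Let comb_killB (W : lmodType C) (G : {linear W -> W}) c d x y z :
  G x = z -> G y = 0 -> G (c *: x - d *: y) = c *: z.
Proof. by move=> Gx Gy; rewrite linear_combB Gx Gy scaler0 subr0. Qed.

Let comb_killD (W : lmodType C) (G : {linear W -> W}) c d x y z :
  G x = 0 -> G y = z -> G (c *: x + d *: y) = d *: z.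
Proof. by move=> Gx Gy; rewrite linear_combD Gx Gy scaler0 add0r. Qed.

Lemma goodpart_h1 n v : goodpart (h1 q12 (- n.+1%:Z) v) =
  q12 ^ (- n.+1%:Z) *: osc q12 sa1 (- n.+1%:Z) (goodpart v).
Proof.
rewrite h1_neg.
have E1 := @goodpart_osc sa1 (- n.+1%:Z) v isT; have E2 := goodpart_sa2 n v.
exact: (@comb_killB V goodpart _ _ _ _ _ E1 E2).
Qed.

Lemma goodpart_h2 n v : goodpart (h2 q12 (- n.+1%:Z) v) =
  q12 ^ (- n.+1%:Z) *: osc q12 sb (- n.+1%:Z) (goodpart v).
Proof.
rewrite h2_neg.
have E1 := goodpart_sa2 n v; have E2 := @goodpart_osc sb (- n.+1%:Z) v isT.
exact: (@comb_killD V goodpart _ _ _ _ _ E1 E2).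
Qed.

(* The generator of [fock lam] whose [a^2]-free part is [x.1_{-(x.2+1)}]. *)
Definition letter (x : 'I_4 * nat) : {linear V -> V} :=
  if x.1 == sa1 then (q12 ^ x.2.+1%:Z \*: h1 q12 (- x.2.+1%:Z) : {linear V -> V})
  else if x.1 == sb then (q12 ^ x.2.+1%:Z \*: h2 q12 (- x.2.+1%:Z) : {linear V -> V})
  else (osc q12 x.1 (- x.2.+1%:Z) : {linear V -> V}).

Lemma letter_sa1 n v :
  letter (sa1, n) v = q12 ^ n.+1%:Z *: h1 q12 (- n.+1%:Z) v.
Proof. by []. Qed.
Lemma letter_sb n v :
  letter (sb, n) v = q12 ^ n.+1%:Z *: h2 q12 (- n.+1%:Z) v.
Proof. by []. Qed.
Lemma letter_other s n v : s != sa1 -> s != sb ->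
  letter (s, n) v = osc q12 s (- n.+1%:Z) v.
Proof. by rewrite /letter /= => /negPf-> /negPf->. Qed.

Variant letter_spec : 'I_4 * nat -> Prop :=
  | LetterSa1 n : letter_spec (sa1, n)
  | LetterSb n : letter_spec (sb, n)
  | LetterOther s n of s != sa1 & s != sb : letter_spec (s, n).

Lemma letterP x : letter_spec x.
Proof.
case: x => s n; have [->|s1] := eqVneq s sa1; first exact: LetterSa1.
by have [->|sb] := eqVneq s sb; [exact: LetterSb|exact: LetterOther].
Qed.

Lemma letter_comm (A : {linear V -> V}) x v :
  (forall s w, A (osc q12 s (- x.2.+1%:Z) w) = osc q12 s (- x.2.+1%:Z) (A w)) ->
  A (letter x v) = letter x (A v).
Proof.
case: (letterP x) => [n|n|s n s1 s2] Ao.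
- rewrite !letter_sa1 (linearZE A); congr (_ *: _).
  exact: (@comm_ah1 C q12 V a A (- n.+1%:Z) v Ao).
- rewrite !letter_sb (linearZE A); congr (_ *: _).
  exact: (@comm_ah2 C q12 V a A (- n.+1%:Z) v Ao).
by rewrite !letter_other.
Qed.

Lemma letterC x y v : letter x (letter y v) = letter y (letter x v).
Proof.
apply: (letter_comm (A := letter x)) => s w; apply/esym.
apply: (letter_comm (A := osc q12 s (- y.2.+1%:Z))) => t z.
exact: osc_creationC.
Qed.

Lemma levop_letter x v :
  levop (letter x v) = letter x (levop v) + x.2.+1%:R *: letter x v.
Proof.
case: (letterP x) => [n|n|s n s1 s2] /=.
- exact: (scaled_grading (L := levop) (A := h1 q12 (- n.+1%:Z)) _ (levop_h1 _ _ _)).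
- exact: (scaled_grading (L := levop) (A := h2 q12 (- n.+1%:Z)) _ (levop_h2 _ _ _)).
rewrite (letter_other n v s1 s2) (letter_other n (levop v) s1 s2).
by have := levop_osc q12 s (- n.+1%:Z) v; rewrite mulrNz opprK.
Qed.

Let inverse_scale (W : lmodType C) (c d : C) (w : W) :
  c * d = 1 -> c *: (d *: w) = w.
Proof. by move=> cd; rewrite scalerA cd scale1r. Qed.

Lemma goodpart_letter x v : x.1 != sa2 ->
  goodpart (letter x v) = osc q12 x.1 (- x.2.+1%:Z) (goodpart v).
Proof.
have qq n : q12 ^ n.+1%:Z * q12 ^ (- n.+1%:Z) = 1 by rewrite mulrC q12_pow.
have GZ c w : goodpart (c *: w) = c *: goodpart w by exact: linearZ.
case: (letterP x) => [n|n|s n s1 s2] xs.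
- rewrite letter_sa1 GZ goodpart_h1; exact: (@inverse_scale V _ _ _ (qq n)).
- rewrite letter_sb GZ goodpart_h2; exact: (@inverse_scale V _ _ _ (qq n)).
rewrite (letter_other n v s1 s2); exact: (@goodpart_osc s (- n.+1%:Z) v xs).
Qed.

Lemma fock_letter lam x v : x.1 != sa2 -> fock q12 lam v -> fock q12 lam (letter x v).
Proof.
(* [fock] has no rule for zero or for scaling alone; zero is obtained as $-w+w$. *)
have fockZ c w : fock q12 lam w -> fock q12 lam (c *: w).
  move=> fw; have f0 := fock_lin (- 1) fw fw.
  have := fock_lin c fw f0; congr (fock _ _ _).
  by rewrite scaleN1r addNr addr0.
case: (letterP x) => [n|n|s n s1 s2] xs fv.
- rewrite letter_sa1; apply: fockZ; exact: (@fock_h1 C q12 lam n.+1 v isT fv).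
- rewrite letter_sb; apply: fockZ; exact: (@fock_h2 C q12 lam n.+1 v isT fv).
rewrite (letter_other n v s1 s2); suff -> : s = sc.
  exact: (@fock_c C q12 lam n.+1 v isT fv).
by move: s s1 s2 xs {fv} => [[|[|[|[|i]]]] //= i4] *; apply/val_inj.
Qed.

Definition word_op (w : seq ('I_4 * nat)) v : V := foldr (fun x => letter x) v w.

Lemma word_op_perm (w w' : seq ('I_4 * nat)) v : perm_eq w w' -> word_op w v = word_op w' v.
Proof.
have rem_op x (u : seq ('I_4 * nat)) : x \in u ->
    word_op u v = letter x (word_op (rem x u) v).
  elim: u => // y u IH; rewrite inE /= [x == y]eq_sym; case: eqP => [->|_] //= xu.
  by rewrite (IH xu); exact: (@letterC y x (word_op (rem x u) v)).
elim: w w' => [|x w IH] w' pw.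
  by have := perm_size pw; case: w' pw.
have xw' : x \in w' by rewrite -(perm_mem pw) mem_head.
rewrite (rem_op x w' xw') /=; congr (letter _ _); apply: IH.
by rewrite -(perm_cons x); apply: perm_trans pw (perm_to_rem xw').
Qed.

(** Substitutes [letter x] for each oscillator [x] of a monomial; the order of the word is
    immaterial because letters commute. It is the inverse of [goodpart] between $a^2$-free vectors
    and the Fock spaces. *)
Definition sigma : V -> V := linext (fun k => word_op (word k.2) (ket k.1 empty)).
HB.instance Definition _ := GRing.isLinear.Build C V V *:%R sigma (linext_linear _).

Lemma sigmaU lam o : sigma (ket lam o) = word_op (word o) (ket lam empty).
Proof. by rewrite /sigma linextU. Qed.

Lemma sigma_osc s n v :
  sigma (osc q12 s (- n.+1%:Z) v) = letter (s, n) (sigma v).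
Proof.
move: v; apply: (linear_eq (f := sigma \o osc q12 s (- n.+1%:Z))
  (g := letter (s, n) \o sigma)) => lam o.
rewrite /= oscUN !sigmaU; exact: (word_op_perm _ (perm_word_inc o (s, n))).
Qed.

Lemma sigma_levop v : sigma (levop v) = levop (sigma v).
Proof.
move: v; apply: (linear_eq (f := sigma \o levop) (g := levop \o sigma)) => lam o /=.
have SZ c v : sigma (c *: v) = c *: sigma v by exact: linearZ.
rewrite levopU SZ !sigmaU -{1}[o]wordK.
elim: (word o) => [|x w IH] /=; first by rewrite levop_vacuum level0 scale0r.
rewrite levop_letter -IH (linearZE (letter x)) level_inc natrD; exact: scalerDl.
Qed.

Lemma fock_sigma lam o : good o -> fock q12 lam (sigma (ket lam o)).
Proof.
rewrite sigmaU -{1}[o]wordK; elim: (word o) => [|x w IH] /=.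
  by move=> _; exact: fock_ket.
by rewrite good_inc => /andP[xs /IH]; apply: fock_letter.
Qed.

Lemma goodpart_sigma v : goodpart (sigma (goodpart v)) = goodpart v.
Proof.
move: v; apply: (linear_eq (f := goodpart \o (sigma \o goodpart)) (g := goodpart)).
move=> lam o /=; have SZ c v : sigma (c *: v) = c *: sigma v by exact: linearZ.
have GZ c v : goodpart (c *: v) = c *: goodpart v by exact: linearZ.
rewrite goodpartU SZ GZ; have [go|_] := boolP (good o); last by rewrite !scale0r.
rewrite !scale1r sigmaU; move: go; rewrite -{1 3}[o]wordK.
elim: (word o) => [|x w IH] /=.
  by move=> g0; rewrite goodpartU g0 scale1r.
rewrite good_inc => /andP[xs gw]; rewrite (goodpart_letter _ xs) (IH gw).
case: x {xs} => s n.
exact: oscUN.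
Qed.

Lemma sigma_goodpart lam v : fock q12 lam v -> sigma (goodpart v) = v.
Proof.
have qq n : q12 ^ (- n.+1%:Z) * q12 ^ n.+1%:Z = 1 by exact: q12_pow.
have SZ c u : sigma (c *: u) = c *: sigma u by exact: linearZ.
move: v; refine (@fock_elim C q12 lam (fun w => sigma (goodpart w) = w) _ _ _ _ _).
- rewrite goodpartU; have -> : good empty by apply/goodP => n; rewrite fsfun0E.
  rewrite scale1r sigmaU; suff -> : word empty = [::] by [].
  by rewrite /word finsupp0.
- move=> c u w _ IHu _ IHw; rewrite -{2}IHu -{2}IHw.
  exact: (linearP (sigma \o goodpart : {linear V -> V})).
- case=> [//|m] w _ _ IH; rewrite goodpart_h1 SZ sigma_osc letter_sa1 IH.
  exact: (@inverse_scale V _ _ _ (qq m)).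
- case=> [//|m] w _ _ IH; rewrite goodpart_h2 SZ sigma_osc letter_sb IH.
  exact: (@inverse_scale V _ _ _ (qq m)).
case=> [w l0|m w]; first by case: (notF l0).
move=> _ _ IH.
have s1 : sc != sa1 by [].
have s3 : sc != sb by [].
have s2 : sc != sa2 by [].
have E := @goodpart_osc sc (- m.+1%:Z) w s2.
have L := @letter_other sc m w s1 s3.
rewrite E.
rewrite (@sigma_osc sc m).
rewrite IH.
exact: L.
Qed.

End FockIsomorphism.

(** * Stability of the Fock spaces under the vertex modes *)

Section ClosedUnderModes.
Variables (C : numFieldType) (V : lmodType C) (P : V -> Prop).
Hypothesis P0 : P 0.
Hypothesis Plin : forall c v w, P v -> P w -> P (c *: v + w).

Lemma sum_closed (I : Type) (r : seq I) (F : I -> V) :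
  (forall i, P (F i)) -> P (\sum_(i <- r) F i).
Proof.
move=> PF; elim: r => [|i r IH]; first by rewrite big_nil.
by rewrite big_cons -[F i]scale1r; apply: Plin.
Qed.

Lemma spow_closed (u : nat -> V -> V) : (forall i v, P v -> P (u i v)) ->
  forall k p v, P v -> P (spow u k p v).
Proof.
move=> Pu; elim=> [|k IH] p v Pv /=; first by case: eqP.
by apply: sum_closed => i; apply/Pu/IH.
Qed.

Lemma sexpz_closed (u : nat -> V -> V) : (forall i v, P v -> P (u i v)) ->
  forall n v, P v -> P (sexpz u n v).
Proof.
move=> Pu [p|p] v Pv //; apply: sum_closed => k.
by rewrite -[X in P X]addr0; apply: Plin => //; apply: spow_closed.
Qed.

Lemma linear_comm_combB (A X Y : {linear V -> V}) c d v :
  A (X v) = X (A v) -> A (Y v) = Y (A v) ->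
  A (c *: X v - d *: Y v) = c *: X (A v) - d *: Y (A v).
Proof. by move=> AX AY; rewrite linear_combB AX AY. Qed.

Lemma linear_comm_combD (A X Y : {linear V -> V}) c d v :
  A (X v) = X (A v) -> A (Y v) = Y (A v) ->
  A (c *: X v + d *: Y v) = c *: X (A v) + d *: Y (A v).
Proof. by move=> AX AY; rewrite linear_combD AX AY. Qed.

Lemma add_scale0 (x y z : V) c : x = y + c *: z -> c = 0 -> x = y.
Proof. by move=> -> ->; rewrite scale0r addr0. Qed.

Lemma closed_add_scale (x y z : V) c : x = y + c *: z -> P y -> P z -> P x.
Proof. by move=> -> Py Pz; rewrite addrC; apply: Plin. Qed.

Lemma subv_self (x : V) : -1 *: x + x = 0.
Proof. by rewrite scaleN1r addNr. Qed.

End ClosedUnderModes.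

Section VertexOnFock.
Variables (C : numClosedFieldType) (q12 : C).
Hypothesis q12_neq0 : q12 != 0.
Hypothesis q_generic : forall n : nat, (0 < n)%N -> (q12 ^+ 2) ^+ n != 1.
Notation V := (fockmod C).
Notation a := (oscl q12).
Notation empty := ([fsfun] : occupation).
Implicit Types (v w : V) (lam mu : 'rV[C]_4) (o : occupation) (n : nat).

Lemma fock0 lam : fock q12 lam 0.
Proof.
have f1 := fock_ket q12 lam; have := fock_lin (-1) f1 f1.
by rewrite (@subv_self C V).
Qed.

Lemma osc_c_h1 n m v : (0 < m)%N -> (0 < n)%N ->
  osc q12 sc n (h1 q12 (- m%:Z) v) = h1 q12 (- m%:Z) (osc q12 sc n v).
Proof.
move=> m0 n0.
have E s : sc != s -> osc q12 sc n (osc q12 s (- m%:Z) v) =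
    osc q12 s (- m%:Z) (osc q12 sc n v).
  move=> /negPf cs; have := osc_comm q12 sc s v n0 m0; rewrite cs /= !mul0r.
  by move/(@add_scale0 C V)=> -> .
exact: (@linear_comm_combB C V (osc q12 sc n) (osc q12 sa1 (- m%:Z))
  (osc q12 sa2 (- m%:Z)) _ _ v (E sa1 isT) (E sa2 isT)).
Qed.

Lemma osc_c_h2 n m v : (0 < m)%N -> (0 < n)%N ->
  osc q12 sc n (h2 q12 (- m%:Z) v) = h2 q12 (- m%:Z) (osc q12 sc n v).
Proof.
move=> m0 n0.
have E s : sc != s -> osc q12 sc n (osc q12 s (- m%:Z) v) =
    osc q12 s (- m%:Z) (osc q12 sc n v).
  move=> /negPf cs; have := osc_comm q12 sc s v n0 m0; rewrite cs /= !mul0r.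
  by move/(@add_scale0 C V)=> -> .
exact: (@linear_comm_combD C V (osc q12 sc n) (osc q12 sa2 (- m%:Z))
  (osc q12 sb (- m%:Z)) _ _ v (E sa2 isT) (E sb isT)).
Qed.

Lemma fock_osc_pos lam n v : (0 < n)%N -> fock q12 lam v ->
  fock q12 lam (osc q12 sc n v).
Proof.
move=> n0; move: v.
refine (@fock_elim C q12 lam (fun w => fock q12 lam (osc q12 sc n w)) _ _ _ _ _).
- by rewrite osc_vacuum //; exact: fock0.
- move=> c u v _ fu _ fv; rewrite (linearP (osc q12 sc n)).
  exact: (fock_lin c fu fv).
- move=> m v m0 _ fv; rewrite (osc_c_h1 v m0 n0); exact: (@fock_h1 C q12 lam m _ m0 fv).
- move=> m v m0 _ fv; rewrite (osc_c_h2 v m0 n0); exact: (@fock_h2 C q12 lam m _ m0 fv).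
move=> m v m0 fv fw; have E := osc_comm q12 sc sc v n0 m0.
exact: (@closed_add_scale C V (fock q12 lam) (@fock_lin C q12 lam) _ _ _ _ E
  (@fock_c C q12 lam m _ m0 fw) fv).
Qed.

Lemma fock_crea lam b i v : fock q12 lam v -> fock q12 lam (crea q12 b i v).
Proof.
move=> fv; have f0 := fock0 lam.
case: i => [|i]; first by rewrite crea0.
rewrite creaE -[X in fock _ _ X]addr0; apply: fock_lin => //.
exact: (@fock_c C q12 lam i.+1 v isT fv).
Qed.

Lemma fock_anni lam b i v : fock q12 lam v -> fock q12 lam (anni q12 b i v).
Proof.
move=> fv; have f0 := fock0 lam.
case: i => [|i]; first by rewrite anni0.
rewrite anniE -[X in fock _ _ X]addr0; apply: fock_lin => //.
exact: (@fock_osc_pos lam i.+1 v isT fv).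
Qed.

Lemma fock_expQ lam mu v : fock q12 lam v -> fock q12 (lam + mu) (expQ mu v).
Proof.
move: v.
refine (@fock_elim C q12 lam (fun w => fock q12 (lam + mu) (expQ mu w)) _ _ _ _ _).
- by rewrite expQU; exact: fock_ket.
- move=> c u v _ fu _ fv; rewrite (linearP (expQ mu)); exact: (fock_lin c fu fv).
- move=> [|m] v m0 _ fv; first by case: (notF m0).
  suff -> : expQ mu (h1 q12 (- m.+1%:Z) v) = h1 q12 (- m.+1%:Z) (expQ mu v).
    exact: (@fock_h1 C q12 _ m.+1 _ m0 fv).
  by apply: (@comm_ah1 C q12 V a (expQ mu) (- m.+1%:Z)) => s w; exact: expQ_osc.
- move=> [|m] v m0 _ fv; first by case: (notF m0).
  suff -> : expQ mu (h2 q12 (- m.+1%:Z) v) = h2 q12 (- m.+1%:Z) (expQ mu v).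
    exact: (@fock_h2 C q12 _ m.+1 _ m0 fv).
  by apply: (@comm_ah2 C q12 V a (expQ mu) (- m.+1%:Z)) => s w; exact: expQ_osc.
move=> [|m] v m0 _ fv; first by case: (notF m0).
rewrite (@expQ_osc C q12 mu sc (- m.+1%:Z) v isT).
exact: (@fock_c C q12 _ m.+1 _ m0 fv).
Qed.

(** The projection to charge [lam] commutes with all oscillators and fixes the vacuum, hence
    everything generated from it. *)
Lemma fock_charge lam v : fock q12 lam v -> forall k, k \in msupp v -> k.1 = lam.
Proof.
move=> fv; pose f (k : fockbasis C) : C := (k.1 == lam)%:R.
have fosc s m w : diagop f (osc q12 s m w) = osc q12 s m (diagop f w).
  exact: diagop_osc.
suff E : diagop f v = 1 *: v.
  move=> k kv; have := (iffLR (diagop_eigen f 1 v) E) k kv; rewrite /f.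
  by case: eqP => // _ /eqP; rewrite eq_sym oner_eq0.
rewrite scale1r; move: v fv.
refine (@fock_elim C q12 lam (fun w => diagop f w = w) _ _ _ _ _).
- by rewrite diagopU /f eqxx scale1r.
- move=> c u v _ fu _ fv; rewrite -{2}fu -{2}fv; exact: (linearP (diagop f)).
- move=> m v _ _ IH; rewrite -{2}IH.
  by apply: (@comm_ah1 C q12 V a (diagop f) (- m%:Z)) => s w; exact: fosc.
- move=> m v _ _ IH; rewrite -{2}IH.
  by apply: (@comm_ah2 C q12 V a (diagop f) (- m%:Z)) => s w; exact: fosc.
by move=> m v _ _ IH; rewrite fosc IH.
Qed.

Lemma zpow_charge lam (m : int) v : lam ord0 sc = m%:~R ->
  (forall k, k \in msupp v -> k.1 = lam) -> zpow_c0 m v = v.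
Proof.
move=> lm cv; rewrite zpow_diag -[RHS]scale1r; apply/diagop_eigen => k kv.
by rewrite (cv k kv) lm eqxx.
Qed.

HB.instance Definition _ (n : int) := GRing.isLinear.Build C V V *:%R
  (Defs.eta q12 n) (vertex_coef_linear q12 true (- n - 1)).
HB.instance Definition _ (n : int) := GRing.isLinear.Build C V V *:%R
  (Defs.xi q12 n) (vertex_coef_linear q12 false (- n)).

Lemma fock_vmode lam b N (n : int) v : fock q12 lam v ->
  fock q12 lam (vmode (crea q12) (anni q12) b N n v).
Proof.
move=> fv; have f0 := fock0 lam; have fl := @fock_lin C q12 lam.
apply: (@sum_closed C V (fock q12 lam) f0 fl) => r.
apply: (@sexpz_closed C V (fock q12 lam) f0 fl); first by move=> i w; exact: fock_crea.
apply: (@sexpz_closed C V (fock q12 lam) f0 fl) => //.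
by move=> i w; exact: fock_anni.
Qed.

Lemma fock_eta lam (m : int) v : lam ord0 sc = m%:~R -> fock q12 lam v ->
  fock q12 (lam + charge_shift C true) (Defs.eta q12 0 v).
Proof.
move=> lm fv; have mv := zpow_charge lm (fock_charge fv).
rewrite (etaE q12 mv (leqnn _)); apply: fock_vmode; exact: fock_expQ.
Qed.

Lemma fock_xi lam (m : int) v : lam ord0 sc = m%:~R -> fock q12 lam v ->
  fock q12 (lam + charge_shift C false) (Defs.xi q12 0 v).
Proof.
move=> lm fv; have mv := zpow_charge lm (fock_charge fv).
rewrite (xiE q12 mv (leqnn _)); apply: fock_vmode; exact: fock_expQ.
Qed.

End VertexOnFock.

(** * Weight spaces *)

Section JointEigenspaces.
Variables (K : fieldType) (V : lmodType K).
Variables (eta xi : {linear V -> V}) (P S : {linear V -> V}).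
Variables (F : int -> set V) (X : set V) (U : int -> set V) (n : int -> nat).
Hypothesis eta_F : forall l v, F l v -> F (l + 1) (eta v).
Hypothesis xi_F : forall l v, F l v -> F (l - 1) (xi v).
Hypothesis eta_sq : forall l v, F l v -> eta (eta v) = 0.
Hypothesis homotopy : forall l v, F l v -> eta (xi v) + xi (eta v) = v.
Hypothesis SP : forall l v, F l v -> S (P v) = v.
Hypothesis P_eta : forall v, P (eta v) = eta (P v).
Hypothesis P_xi : forall v, P (xi v) = xi (P v).
Hypothesis F_U : forall l v, F l v -> X v -> U l (P v).
Hypothesis U_F : forall l u, U l u -> F l (S u).
Hypothesis U_X : forall l u, U l u -> X (S u).
Hypothesis PS : forall l u, U l u -> P (S u) = u.
Hypothesis U_eta : forall l u, U l u -> U (l + 1) (eta u).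
Hypothesis U_xi : forall l u, U l u -> U (l - 1) (xi u).
Hypothesis U_dim : forall l, gdim (U l) (n l).

Lemma S_inj l u : U l u -> S u = 0 -> u = 0.
Proof. by move=> Uu Su0; rewrite -(PS Uu) Su0 linear0. Qed.

Lemma weight_gdim l : gdim [set v | F l v /\ X v] (n l).
Proof.
suff -> : [set v | F l v /\ X v] = S @` U l by apply: gdim_injective; first exact: S_inj.
apply/seteqP; split=> [v [Fv Xv]|_ [u Uu <-]].
  by exists (P v); [exact: F_U|exact: SP Fv].
by split; [exact: U_F|exact: U_X Uu].
Qed.

Lemma U_eta_sq l u : U l u -> eta (eta u) = 0.
Proof. by move=> Uu; rewrite -(PS Uu) -!P_eta (eta_sq (U_F Uu)) linear0. Qed.

Lemma U_homotopy l u : U l u -> eta (xi u) + xi (eta u) = u.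
Proof.
move=> Uu; rewrite -{3}(PS Uu) -(homotopy (U_F Uu)) linearD !P_eta !P_xi P_eta.
by rewrite !(PS Uu).
Qed.

Lemma U_eta_xi l u : U l u -> U l (eta (xi u)).
Proof. by move=> Uu; have := U_eta (U_xi Uu); rewrite subrK. Qed.
Lemma U_xi_eta l u : U l u -> U l (xi (eta u)).
Proof. by move=> Uu; have := U_xi (U_eta Uu); rewrite addrK. Qed.
Lemma F_eta_xi l v : F l v -> F l (eta (xi v)).
Proof. by move=> Fv; have := eta_F (xi_F Fv); rewrite subrK. Qed.
Lemma F_xi_eta l v : F l v -> F l (xi (eta v)).
Proof. by move=> Fv; have := xi_F (eta_F Fv); rewrite addrK. Qed.

(** Commutation of [eta] and [xi] with $d$ is not assumed: the vector is carried by [P] to [U],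
    where stability is known, and back by [S]. *)
Lemma X_eta_xi l v : F l v -> X v -> X (eta (xi v)).
Proof.
move=> Fv Xv; rewrite -(SP (F_eta_xi Fv)) P_eta P_xi.
exact: (U_X (U_eta_xi (F_U Fv Xv))).
Qed.
Lemma X_xi_eta l v : F l v -> X v -> X (xi (eta v)).
Proof.
move=> Fv Xv; rewrite -(SP (F_xi_eta Fv)) P_xi P_eta.
exact: (U_X (U_xi_eta (F_U Fv Xv))).
Qed.

Lemma ker_image l v : F l v ->
  ((eta \o xi) @` F l) v <-> eta v = 0.
Proof.
move=> Fv; split=> [[w Fw <-]|ev]; first exact: (eta_sq (xi_F Fw)).
by exists v => //=; rewrite -[RHS](homotopy Fv) ev linear0 addr0.
Qed.

Lemma coker_image l v : F l v ->
  ((xi \o eta) @` F l) v <-> xi (eta v) = v.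
Proof.
move=> Fv; split=> [[w Fw <-]|xv]; last by exists v.
have := homotopy (eta_F Fw); rewrite (eta_sq Fw) linear0 addr0 /=.
by move=> ->.
Qed.

(** The complex is the one on [U], with ranks $r_l$. Under [S] the kernel part corresponds to
    [eta @] U (l - 1)[, the cokernel part to]xi[of]eta @[U l]. *)
Lemma weight_ker_coker_gdim : exists r : int -> nat,
  [/\ forall l, (r l + r (l - 1)%R)%N = n l,
      forall l, gdim [set v | ((eta \o xi) @` F l) v /\ X v] (r (l - 1)) &
      forall l, gdim [set v | ((xi \o eta) @` F l) v /\ X v] (r l)].
Proof.
have [r [r_dim r_n]] := image_eta_dims U_dim U_eta U_xi U_eta_sq U_homotopy.
exists r; split=> // l.
  suff -> : [set v | ((eta \o xi) @` F l) v /\ X v] = S @` (eta @` U (l - 1)).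
    apply: gdim_injective (r_dim _) => _ [u Uu <-].
    exact: (S_inj (U_eta Uu)).
  apply/seteqP; split=> [v [kv Xv]|_ [_ [u Uu <-] <-]].
    have Fv : F l v by case: kv => w Fw <-; exact: F_eta_xi.
    have ev := iffLR (ker_image Fv) kv; exists (P v); last exact: SP Fv.
    exists (xi (P v)); first exact/U_xi/F_U.
    by rewrite -[RHS](U_homotopy (F_U Fv Xv)) -P_eta ev !linear0 addr0.
  have Ueu : U l (eta u) by have := U_eta Uu; rewrite subrK.
  have Fe := U_F Ueu; split; last exact: U_X Ueu.
  apply/(ker_image Fe); rewrite -(SP (eta_F Fe)) P_eta (PS Ueu).
  by rewrite (U_eta_sq Uu) linear0.
suff -> : [set v | ((xi \o eta) @` F l) v /\ X v] = (S \o xi) @` (eta @` U l).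
  apply: (gdim_injective (f := S \o xi)) (r_dim _) => _ [u Uu <-] /=.
  (* [xi] is injective on the image of [eta]: by the homotopy at [eta u], killing [xi (eta u)] kills
     [eta u]. *)
  move=> /(S_inj (U_xi_eta Uu)) xeu.
  have := U_homotopy (U_eta Uu); rewrite xeu (U_eta_sq Uu) !linear0 addr0.
  by move=> <-.
apply/seteqP; split=> [v [kv Xv]|_ [_ [u Uu <-] <-]] /=.
  have Fv : F l v by case: kv => w Fw <-; exact: F_xi_eta.
  have ev := iffLR (coker_image Fv) kv; exists (eta (P v)).
    by exists (P v) => //; exact: F_U.
  by rewrite -P_eta -P_xi ev (SP Fv).
have Uxu := U_xi_eta Uu; have Fx := U_F Uxu; split; last exact: U_X Uxu.
apply/(coker_image Fx); rewrite -(SP (F_xi_eta Fx)) P_xi P_eta (PS Uxu).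
have := U_homotopy (U_eta Uu); rewrite (U_eta_sq Uu) linear0 addr0.
by move=> ->.
Qed.

End JointEigenspaces.

#[global] Opaque levop goodpart sigma.

HB.lock Definition fcoef (C : numClosedFieldType) (k : fockbasis C) (v : fockmod C) : C :=
  v@_k.

Section Coefficients.
Variable C : numClosedFieldType.
Notation V := (fockmod C).
Implicit Types (v w u : V) (lam : 'rV[C]_4) (o : occupation) (k : fockbasis C).

Lemma fcoef_supp v k : (k \in msupp v) = (fcoef k v != 0).
Proof. by rewrite fcoef.unlock; symmetry; exact: mcoeff_neq0. Qed.
Lemma fcoef_ext v w : (forall k, fcoef k v = fcoef k w) -> v = w.
Proof. by rewrite fcoef.unlock; exact: fock_coefP. Qed.
Lemma fcoefD k v w : fcoef k (v + w) = fcoef k v + fcoef k w.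
Proof. by rewrite fcoef.unlock; exact: mcoeffD. Qed.
Lemma fcoefB k v w : fcoef k (v - w) = fcoef k v - fcoef k w.
Proof. by rewrite fcoef.unlock; exact: mcoeffB. Qed.
Lemma fcoefZ k (c : C) v : fcoef k (c *: v) = c * fcoef k v.
Proof. by rewrite fcoef.unlock; exact: mcoeffZ. Qed.
Lemma fcoef0 k : fcoef k 0 = 0.
Proof. by rewrite fcoef.unlock; exact: mcoeff0. Qed.
Lemma fcoef_sum (I : Type) (r : seq I) k (F : I -> V) :
  fcoef k (\sum_(i <- r) F i) = \sum_(i <- r) fcoef k (F i).
Proof.
elim: r => [|i r IH]; first by rewrite !big_nil fcoef0.
by rewrite !big_cons fcoefD IH.
Qed.
Lemma fcoef_diag k f v : fcoef k (diagop f v) = f k * fcoef k v.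
Proof. by rewrite fcoef.unlock; exact: diagop_coef. Qed.
Lemma fcoef_ket k lam o : fcoef k (ket lam o) = ((lam, o) == k)%:R.
Proof. by rewrite fcoef.unlock ket.unlock; exact: mcoeffU1E. Qed.
Lemma fcoef_expand v : v = \sum_(k <- msupp v) fcoef k v *: ket k.1 k.2.
Proof.
rewrite fcoef.unlock ket.unlock {1}[v]monalgEZ; apply: eq_bigr => k _.
by case: k.
Qed.

Lemma diag_eigen f (c : C) v :
  diagop f v = c *: v <-> forall k, fcoef k v <> 0 -> f k = c.
Proof.
split=> [E k vk|fc].
  have := congr1 (fcoef k) E; rewrite fcoef_diag fcoefZ => /eqP.
  rewrite -subr_eq0 -mulrBl mulf_eq0 subr_eq0.
  by case/orP => /eqP.
apply: fcoef_ext => k; rewrite fcoef_diag fcoefZ.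
by have [->|/eqP vk] := eqVneq (fcoef k v) 0; rewrite ?mulr0 // fc.
Qed.

End Coefficients.

Section WeightSpaces.
Variables (C : numClosedFieldType) (q12 : C).
Notation V := (fockmod C).
Notation a := (oscl q12).
Implicit Types (v w u : V) (lam mu : 'rV[C]_4) (o : occupation) (k : fockbasis C).

Definition h1_eigen k : C := k.1 ord0 sa1 - k.1 ord0 sa2.
(** The minus sign is that of $[b_0, Q_b] = -1$. *)
Definition h2_eigen k : C := k.1 ord0 sa2 - k.1 ord0 sb.
Definition d_eigen k : C := h1_eigen k * h2_eigen k + h2_eigen k * h2_eigen k
  - 2%:R^-1 * (k.1 ord0 sc * (k.1 ord0 sc + 1)) - (level k.2)%:R.

Let comb1B (W : lmodType C) (c d : C) (x y : W) :
  c = 1 -> d = 1 -> c *: x - d *: y = x - y.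
Proof. by move=> -> ->; rewrite !scale1r. Qed.

Let comb1D (W : lmodType C) (c d : C) (x y : W) :
  c = 1 -> d = 1 -> c *: x + d *: y = x + y.
Proof. by move=> -> ->; rewrite !scale1r. Qed.

Lemma h1_0 v : h1 q12 0 v = diagop h1_eigen v.
Proof.
have -> : h1 q12 0 v = osc q12 sa1 0 v - osc q12 sa2 0 v.
  exact: (@comb1B V _ _ _ _ (expr0z q12) (expr0z q12)).
rewrite !osc0_diag.
apply: fcoef_ext => k.
rewrite fcoefB.
rewrite !fcoef_diag.
rewrite /signature /h1_eigen /=.
ring.
Qed.

Lemma h2_0 v : h2 q12 0 v = diagop h2_eigen v.
Proof.
have -> : h2 q12 0 v = osc q12 sa2 0 v + osc q12 sb 0 v.
  exact: (@comb1D V _ _ _ _ (expr0z q12) (expr0z q12)).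
rewrite !osc0_diag; apply: fcoef_ext => k.
rewrite fcoefD !fcoef_diag /signature /h2_eigen /=; ring.
Qed.

Lemma zero_part_levop v : zero_part q12 a v - levop v = diagop d_eigen v.
Proof.
have -> : zero_part q12 a v = h1 q12 0 (h2 q12 0 v) + h2 q12 0 (h2 q12 0 v)
    - 2%:R^-1 *: osc q12 sc 0 (osc q12 sc 0 v + v) by [].
rewrite levop_diag !h1_0 !h2_0 !osc0_diag.
apply: fcoef_ext => k.
rewrite fcoefB fcoefB fcoefD.
rewrite fcoefZ.
rewrite !fcoef_diag fcoefD !fcoef_diag.
rewrite /d_eigen /signature /=; ring.
Qed.

Definition joint_eigen (e i j : int) : set V := [set v |
  [/\ (- 2%:R) *: derivation q12 v = e%:~R *: v,
      h1 q12 0 v = i%:~R *: v & h2 q12 0 v = j%:~R *: v]].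

Lemma weight_spaceE (W : set V) e i j :
  weight_space q12 W e i j = [set v | W v /\ joint_eigen e i j v].
Proof.
apply/seteqP; split=> v.
  move=> [Wv E1 E2 E3]; exact: (conj Wv (And3 E1 E2 E3)).
move=> [Wv [E1 E2 E3]]; exact: (And4 Wv E1 E2 E3).
Qed.

Section Charges.
Variables (alpha : int) (beta : C).
Notation charge := (charge alpha beta).
Notation Fl := (Fl q12 alpha beta).
Implicit Types (l i j e : int).

Lemma charge_sc l i j : charge l i j ord0 sc = (- alpha + j + l)%:~R.
Proof. by rewrite mxE /= !intrD intrN. Qed.
Lemma charge_h1 l i j o : h1_eigen (charge l i j, o) = (2 * i - j)%:~R.
Proof. by rewrite /h1_eigen !mxE /= intrB intrM; ring. Qed.
Lemma charge_h2 l i j o : h2_eigen (charge l i j, o) = (alpha - i)%:~R.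
Proof. by rewrite /h2_eigen !mxE /= intrB; ring. Qed.

Lemma charge_eta_shift l i j : charge l i j + charge_shift C true = charge (l + 1) i j.
Proof.
apply/rowP => s; rewrite !mxE eqxx /=.
case: s => [[|[|[|[|n]]]] //= ?]; rewrite ?mulr0 ?mulr1 ?addr0 // intrD; ring.
Qed.
Lemma charge_xi_shift l i j : charge l i j + charge_shift C false = charge (l - 1) i j.
Proof.
apply/rowP => s; rewrite !mxE eqxx /=.
by case: s => [[|[|[|[|n]]]] //= ?]; rewrite ?mulr0 ?mulr1 ?addr0 // intrB; ring.
Qed.

(** The value of $-2d$ on the charged vacuum. [beta] drops out: $h^1_0$ and $h^2_0$ see only
    differences of charges, and the charge of $c$ is free of it. *)
Definition quad l i j : int := - (alpha * (alpha + 1)) + l * (l + 1)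
  - 2 * l * (alpha - j) + (2 * i ^+ 2 - 2 * i * j + j ^+ 2 + j).

Lemma charge_d l i j o :
  (- 2%:R) * d_eigen (charge l i j, o) = (2 * (level o)%:Z + quad l i j)%:~R.
Proof.
have two0 : 2%:R != 0 :> C by rewrite pnatr_eq0.
rewrite /d_eigen charge_h1 charge_h2 charge_sc /= mulrBr mulrBr !mulNr (mulrA 2%:R) mulfV //.
rewrite mul1r (pmulrn 1 (level o)) /quad; ring.
Qed.

End Charges.
End WeightSpaces.

Section LinearEquations.
Variables (R : pzRingType) (W : lmodType R) (f g : {linear W -> W}).
Implicit Types x y : W.

Lemma comp_eq0_0 : f (g 0) = 0. Proof. by rewrite !linear0. Qed.
Lemma comp_eq0_add x y : f (g x) = 0 -> f (g y) = 0 -> f (g (x + y)) = 0.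
Proof. by move=> fx fy; rewrite !linearD fx fy addr0. Qed.
Lemma homotopy_0 : f (g 0) + g (f 0) = 0. Proof. by rewrite !linear0 addr0. Qed.
Lemma homotopy_add x y : f (g x) + g (f x) = x -> f (g y) + g (f y) = y ->
  f (g (x + y)) + g (f (x + y)) = x + y.
Proof. by move=> fx fy; rewrite !linearD addrACA fx fy. Qed.
Lemma comp_fix_add x y : f (g x) = x -> f (g y) = y -> f (g (x + y)) = x + y.
Proof. by move=> fx fy; rewrite !linearD fx fy. Qed.
Lemma agree_0 : f 0 = g 0. Proof. by rewrite !linear0. Qed.
Lemma agree_add x y : f x = g x -> f y = g y -> f (x + y) = g (x + y).
Proof. by move=> fx fy; rewrite !linearD fx fy. Qed.

End LinearEquations.

Section FockSums.
Variables (C : numClosedFieldType) (q12 : C).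
Hypothesis q12_neq0 : q12 != 0.
Hypothesis q_generic : forall n : nat, (0 < n)%N -> (q12 ^+ 2) ^+ n != 1.
Variables (alpha : int) (beta : C).
Notation V := (fockmod C).
Notation a := (oscl q12).
Notation eta := (Defs.eta q12 0).
Notation xi := (Defs.xi q12 0).
Notation charge := (charge alpha beta).
Notation Fl := (Fl q12 alpha beta).
Implicit Types (v w u : V) (lam mu : 'rV[C]_4) (o : occupation) (k : fockbasis C).
Implicit Types (l i j e : int).

Lemma Fl_ind l (P : V -> Prop) : P 0 -> (forall u v, P u -> P v -> P (u + v)) ->
  (forall i j v, fock q12 (charge l i j) v -> P v) -> forall v, Fl l v -> P v.
Proof.
move=> P0 PD Pf v [I [w [fw ->]]]; elim: I => [|x I IH]; first by rewrite big_nil.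
by rewrite big_cons; apply: PD => //; apply: Pf (fw x).
Qed.

Lemma fock_Fl l i j v : fock q12 (charge l i j) v -> Fl l v.
Proof.
move=> fv; exists [:: (i, j)], (fun x => if x == (i, j) then v else 0); split.
  by move=> x; case: eqP => [->|_] //; exact: fock0.
by rewrite big_seq1 eqxx.
Qed.

Lemma Fl_eta l v : Fl l v -> Fl (l + 1) (eta v).
Proof.
move=> [I [w [fw ->]]]; exists I, (fun x => eta (w x)); split=> [x|].
  rewrite -charge_eta_shift.
  exact: (@fock_eta C q12 _ _ (w x) (charge_sc alpha beta l x.1 x.2) (fw x)).
exact: (linear_sum eta).
Qed.

Lemma Fl_xi l v : Fl l v -> Fl (l - 1) (xi v).
Proof.
move=> [I [w [fw ->]]]; exists I, (fun x => xi (w x)); split=> [x|].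
  rewrite -charge_xi_shift.
  exact: (@fock_xi C q12 _ _ (w x) (charge_sc alpha beta l x.1 x.2) (fw x)).
exact: (linear_sum xi).
Qed.

Lemma fock_zpow l i j v : fock q12 (charge l i j) v -> zpow_c0 (- alpha + j + l) v = v.
Proof.
by move=> fv; exact: (zpow_charge (charge_sc alpha beta l i j) (fock_charge fv)).
Qed.

Lemma Fl_eta_sq l v : Fl l v -> eta (eta v) = 0.
Proof.
move: v; refine (@Fl_ind l (fun v => eta (eta v) = 0) _ _ _).
- exact: (@comp_eq0_0 C V eta eta).
- exact: (@comp_eq0_add C V eta eta).
move=> i j v /fock_zpow vm; exact: (eta_eta q12_neq0 q_generic vm).
Qed.

Lemma Fl_homotopy l v : Fl l v -> eta (xi v) + xi (eta v) = v.
Proof.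
move: v; refine (@Fl_ind l (fun v => eta (xi v) + xi (eta v) = v) _ _ _).
- exact: (@homotopy_0 C V eta xi).
- exact: (@homotopy_add C V eta xi).
move=> i j v /fock_zpow vm; exact: (eta_xi_anticomm q12_neq0 q_generic vm).
Qed.

Lemma Fl_sigma_goodpart l v : Fl l v -> sigma q12 (goodpart v) = v.
Proof.
move: v; refine (@Fl_ind l (fun v => sigma q12 (goodpart v) = v) _ _ _).
- exact: (@comp_eq0_0 C V (sigma q12) (@goodpart C)).
- exact: (@comp_fix_add C V (sigma q12) (@goodpart C)).
by move=> i j v fv; exact: (sigma_goodpart q12_neq0 fv).
Qed.

Lemma Fl_derivation l v : Fl l v -> derivation q12 v = diagop (@d_eigen C) v.
Proof.
move: v; refine (@Fl_ind l (fun v => derivation q12 v = diagop (@d_eigen C) v) _ _ _).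
- exact: (@agree_0 C V (derivation q12) (diagop (@d_eigen C))).
- exact: (@agree_add C V (derivation q12) (diagop (@d_eigen C))).
move=> i j v fv; rewrite -(zero_part_levop q12).
exact: (derivation_fock q12_neq0 q_generic fv).
Qed.

Lemma Fl_charges l v : Fl l v ->
  forall k, fcoef k v <> 0 -> exists i j, k.1 = charge l i j.
Proof.
move: v; refine (@Fl_ind l
  (fun v => forall k, fcoef k v <> 0 -> exists i j, k.1 = charge l i j) _ _ _).
- by move=> k; rewrite fcoef0.
- move=> u v uk vk k; rewrite fcoefD.
  have [/uk//|] := pselect (fcoef k u <> 0).
  by move/contrapT => ->; rewrite add0r; exact: vk.
move=> i j v fv k kv; exists i, j; apply: (fock_charge fv).
by rewrite fcoef_supp; apply/eqP.
Qed.

Lemma goodpart_eta v : goodpart (eta v) = eta (goodpart v).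
Proof.
apply: (@comm_vertex C q12 (@goodpart C) true (- 0 - 1)) => [n w _|lam w|n w].
- exact: (@goodpart_osc C q12 sc n w isT).
- exact: goodpart_expQ.
exact: goodpart_zpow.
Qed.

Lemma goodpart_xi v : goodpart (xi v) = xi (goodpart v).
Proof.
apply: (@comm_vertex C q12 (@goodpart C) false (- 0)) => [n w _|lam w|n w].
- exact: (@goodpart_osc C q12 sc n w isT).
- exact: goodpart_expQ.
exact: goodpart_zpow.
Qed.

End FockSums.

Section ModeGrading.
Variables (C : numFieldType) (V : lmodType C).
Variables (u t : bool -> nat -> {linear V -> V}) (L : {linear V -> V}).
Implicit Types (v : V) (b : bool).
Hypothesis Lu : forall b i v, L (u b i v) = u b i (L v) + (1 * i%:R) *: u b i v.
Hypothesis Lt : forall b i v, L (t b i v) = t b i (L v) + (-1 * i%:R) *: t b i v.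

(** Each summand creates $n+r$ and annihilates $r$. *)
Lemma vmode_graded b N (n : int) v :
  L (vmode u t b N n v) = vmode u t b N n (L v) + n%:~R *: vmode u t b N n v.
Proof.
rewrite /vmode linear_sum scaler_sumr -big_split /=; apply: eq_bigr => r _.
rewrite (sexpz_graded (A := L) (Lu b)) (sexpz_graded (A := L) (Lt b)).
rewrite (linearD (sexpz (u b) _)) (linearZE (sexpz (u b) _)) /= -addrA -scalerDl.
congr (_ + _ *: _); rewrite mul1r mulN1r intrD; ring.
Qed.

End ModeGrading.

Section WeightVectors.
Variables (C : numClosedFieldType) (q12 : C).
Hypothesis q12_neq0 : q12 != 0.
Hypothesis q_generic : forall n : nat, (0 < n)%N -> (q12 ^+ 2) ^+ n != 1.
Variables (alpha : int) (beta : C).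
Notation V := (fockmod C).
Notation a := (oscl q12).
Notation eta := (Defs.eta q12 0).
Notation xi := (Defs.xi q12 0).
Notation charge := (charge alpha beta).
Notation Fl := (Fl q12 alpha beta).
Implicit Types (v w u : V) (lam mu : 'rV[C]_4) (o : occupation) (k : fockbasis C).
Implicit Types (l : int) (b : bool).
Notation vm := (vmode (crea q12) (anni q12)).

Definition charge_ind lam k : C := (k.1 == lam)%:R.

Lemma charge_vmode lam b N (n : int) v :
  diagop (charge_ind lam) (vm b N n v) = vm b N n (diagop (charge_ind lam) v).
Proof.
have Ao m w : m != 0 -> diagop (charge_ind lam) (osc q12 sc m w) =
    osc q12 sc m (diagop (charge_ind lam) w).
  by move=> _; exact: diagop_osc.
rewrite /vmode linear_sum; apply: eq_bigr => r _ /=.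
by rewrite (comm_creation_exp Ao) (comm_annihilation_exp Ao).
Qed.

Lemma charge_expQ lam mu v : diagop (charge_ind (lam + mu)) (expQ mu v) =
  expQ mu (diagop (charge_ind lam) v).
Proof.
rewrite diagop_expQ; have -> // : (fun k : fockbasis C => charge_ind (lam + mu)
    (k.1 + mu, k.2)) = charge_ind lam.
by apply/funext => k; rewrite /charge_ind (inj_eq (addIr mu)).
Qed.

Lemma levop_expQ mu v : levop (expQ mu v) = expQ mu (levop v).
Proof. by rewrite !levop_diag diagop_expQ. Qed.

Lemma levop_vmode b N (n : int) v :
  levop (vm b N n v) = vm b N n (levop v) + n%:~R *: vm b N n v.
Proof.
exact: (@vmode_graded C V (crea q12) (anni q12) levop
  (levop_crea q12) (levop_anni q12)).
Qed.

Variables (e p r : int).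
Let i0 : int := alpha - r.
Let j0 : int := 2 * i0 - p.
(* On [charge l i j], [h^1_0] is [2 * i - j] and [h^2_0] is [alpha - i]. *)
Definition weight_charge l : 'rV[C]_4 := charge l i0 j0.
Definition weight_quad l : int := quad alpha l i0 j0.
(** A scalar, since the difference may be odd or negative; then no monomial has this level and
    [Ugood l] is zero. *)
Definition weight_level l : C := (e - weight_quad l)%:~R / 2%:R.

Definition Ugood l : set V := [set u | forall k, fcoef k u <> 0 ->
  [/\ good k.2, k.1 = weight_charge l &
      2 * (level k.2)%:Z + weight_quad l = e]].

(** Two views of one space: the support condition is suited to counting dimensions, the eigenvector
    equations to the action of [eta] and [xi]. *)
Lemma UgoodP l u : Ugood l u <-> [/\ goodpart u = u,
  diagop (charge_ind (weight_charge l)) u = u & levop u = weight_level l *: u].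
Proof.
have two0 : 2%:R != 0 :> C by rewrite pnatr_eq0.
have bool1 (b : bool) : b%:R = 1 :> C -> b by case: b => // /eqP; rewrite eq_sym oner_eq0.
split=> [Uu|[]].
  split.
  - rewrite goodpart_diag -[RHS]scale1r; apply/diag_eigen => k /Uu[gk _ _].
    by rewrite gk.
  - rewrite -[RHS]scale1r; apply/diag_eigen => k /Uu[_ kc _].
    by rewrite /charge_ind kc eqxx.
  rewrite levop_diag; apply/diag_eigen => k /Uu[_ _ E].
  rewrite /weight_level -{1}E addrK intrM mulrAC mulfV // mul1r; exact: pmulrn.
rewrite goodpart_diag levop_diag -{2}[u]scale1r => /diag_eigen gu.
rewrite -{2}[u]scale1r => /diag_eigen cu /diag_eigen lu k ku; split.
- exact/bool1/gu.
- exact/eqP/bool1/cu.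
have /(congr1 (fun x => 2%:R * x)) := lu k ku; rewrite /weight_level mulrC.
rewrite [RHS]mulrC divfK // -natrM pmulrn => /intr_inj; lia.
Qed.

Lemma weight_charge_sc l : weight_charge l ord0 sc = (- alpha + j0 + l)%:~R.
Proof. exact: charge_sc. Qed.

Lemma Ugood_zpow l u : Ugood l u -> zpow_c0 (- alpha + j0 + l) u = u.
Proof.
move=> Uu; apply: (zpow_charge (weight_charge_sc l)) => k.
by rewrite fcoef_supp => /eqP /Uu[].
Qed.

Let comp3Z (W : lmodType C) (f g h : {linear W -> W}) (c : C) x :
  f (g (h (c *: x))) = c *: f (g (h x)).
Proof. by rewrite !linearZ. Qed.

Let grade_step (W : lmodType C) (x y : W) (c d f : C) :
  y = c *: x -> f = c + d -> y + d *: x = f *: x.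
Proof. by move=> -> ->; rewrite scalerDl. Qed.

(** On $c_0 = m$, $\eta_0$ adds $-1-m$ to the level, and [weight_quad] grows by $2(m+1)$ from $l$ to
    $l+1$: the weight is unchanged. This is $[d,\eta_0]=0$ in coordinates. *)
Lemma Ugood_eta l u : Ugood l u -> Ugood (l + 1) (eta u).
Proof.
move=> Uu; have um := Ugood_zpow Uu.
have [gu cu lu] := iffLR (UgoodP l u) Uu; apply/UgoodP; split.
- by rewrite goodpart_eta gu.
- rewrite (etaE q12 um (leqnn _)) charge_vmode /weight_charge -charge_eta_shift.
  by rewrite charge_expQ cu.
have vmZ b N n (c : C) w : vm b N n (expQ (charge_shift C b) (c *: w)) =
    c *: vm b N n (expQ (charge_shift C b) w).
  rewrite /vmode scaler_sumr; apply: eq_bigr => s _.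
  exact: (@comp3Z V (sexpz (crea q12 b) (n + s%:Z)) (sexpz (anni q12 b) s%:Z)
    (expQ (charge_shift C b)) c w).
rewrite (etaE q12 um (leqnn _)) levop_vmode levop_expQ lu.
apply: (@grade_step V _ _ _ _ _ (vmZ _ _ _ _ _)).
rewrite /weight_level /weight_quad /quad; by field.
Qed.

Lemma Ugood_xi l u : Ugood l u -> Ugood (l - 1) (xi u).
Proof.
move=> Uu; have um := Ugood_zpow Uu.
have [gu cu lu] := iffLR (UgoodP l u) Uu; apply/UgoodP; split.
- by rewrite goodpart_xi gu.
- rewrite (xiE q12 um (leqnn _)) charge_vmode /weight_charge -charge_xi_shift.
  by rewrite charge_expQ cu.
have vmZ b N n (c : C) w : vm b N n (expQ (charge_shift C b) (c *: w)) =
    c *: vm b N n (expQ (charge_shift C b) w).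
  rewrite /vmode scaler_sumr; apply: eq_bigr => s _.
  exact: (@comp3Z V (sexpz (crea q12 b) (n + s%:Z)) (sexpz (anni q12 b) s%:Z)
    (expQ (charge_shift C b)) c w).
rewrite (xiE q12 um (leqnn _)) levop_vmode levop_expQ lu.
apply: (@grade_step V _ _ _ _ _ (vmZ _ _ _ _ _)).
rewrite /weight_level /weight_quad /quad; by field.
Qed.

Notation S := (sigma q12).

Lemma Ugood_expand l u : Ugood l u ->
  exists (I : seq occupation) (c : occupation -> C),
    all good I /\ u = \sum_(o <- I) c o *: ket (weight_charge l) o.
Proof.
move=> Uu; exists [seq k.2 | k <- msupp u], (fun o => fcoef (weight_charge l, o) u).
have supp k : k \in msupp u -> good k.2 /\ k.1 = weight_charge l.
  by rewrite fcoef_supp => /eqP /Uu[].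
split; first by apply/allP => _ /mapP[k /supp[gk _] ->].
rewrite big_map; apply: etrans (fcoef_expand u) _.
by apply: eq_big_seq => -[lam o] /supp[_ /= <-].
Qed.

Lemma fock_sigma_Ugood l u : Ugood l u -> fock q12 (weight_charge l) (S u).
Proof.
move=> /Ugood_expand[I [c [/allP Ig ->]]]; rewrite (linear_sum S).
elim: I Ig => [|o I IH] Ig; first by rewrite big_nil; exact: fock0.
rewrite big_cons; have SZ : S (c o *: ket (weight_charge l) o) =
    c o *: S (ket (weight_charge l) o) by exact: linearZ.
rewrite [X in X + _]SZ; apply: fock_lin.
  by apply: fock_sigma; apply: Ig; rewrite mem_head.
by apply: IH => x xI; apply: Ig; rewrite inE xI orbT.
Qed.

Lemma goodpart_sigma_Ugood l u : Ugood l u -> goodpart (S u) = u.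
Proof.
move=> Uu; have [gu _ _] := iffLR (UgoodP l u) Uu.
by rewrite -{1}gu (goodpart_sigma q12_neq0) gu.
Qed.

Lemma sigma_Ugood_Fl l u : Ugood l u -> Fl l (S u).
Proof. by move/fock_sigma_Ugood/fock_Fl. Qed.

Lemma Ugood_joint_eigen l u : Ugood l u -> joint_eigen q12 e p r (S u).
Proof.
move=> Uu; have Fu := sigma_Ugood_Fl Uu.
have supp k : fcoef k (S u) <> 0 -> k.1 = weight_charge l.
  by move=> /eqP ku; apply: (fock_charge (fock_sigma_Ugood Uu)); rewrite fcoef_supp.
have [_ _ lu] := iffLR (UgoodP l u) Uu.
have SZ (c : C) w : S (c *: w) = c *: S w by exact: linearZ.
have := sigma_levop q12 u; rewrite lu SZ => /esym; rewrite levop_diag => /diag_eigen lev.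
split.
- rewrite (Fl_derivation q12_neq0 q_generic Fu).
  apply: fcoef_ext => k; apply: etrans (fcoefZ _ _ _) (etrans _ (esym (fcoefZ _ _ _))).
  rewrite fcoef_diag.
  have [->|/eqP ku] := eqVneq (fcoef k (S u)) 0; first by rewrite !mulr0.
  rewrite mulrA; congr (_ * _); rewrite [k]surjective_pairing (supp k ku) charge_d.
  have two0 : 2%:R != 0 :> C by rewrite pnatr_eq0.
  rewrite intrD intrM -pmulrn (lev k ku) /weight_level /weight_quad; by field.
- rewrite h1_0; apply/diag_eigen => k ku.
  by rewrite [k]surjective_pairing (supp k ku) charge_h1; congr (_%:~R); rewrite /j0; lia.
rewrite h2_0; apply/diag_eigen => k ku.
by rewrite [k]surjective_pairing (supp k ku) charge_h2; congr (_%:~R); rewrite /i0; lia.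
Qed.

Lemma joint_eigen_Ugood l v : Fl l v -> joint_eigen q12 e p r v -> Ugood l (goodpart v).
Proof.
move=> Fv [dv h1v h2v] k; rewrite goodpart_diag fcoef_diag => kv.
have gk : good k.2 by apply: contra_notT kv => /negPf->; exact: mul0r.
have {}kv : fcoef k v <> 0 by move=> E; case: kv; rewrite E; exact: mulr0.
have [i [j kE]] := Fl_charges Fv kv.
have hi : 2 * i - j = p.
  move: h1v; rewrite h1_0 => /diag_eigen /(_ k kv).
  by rewrite [k]surjective_pairing kE charge_h1 => /intr_inj.
have hr : alpha - i = r.
  move: h2v; rewrite h2_0 => /diag_eigen /(_ k kv).
  by rewrite [k]surjective_pairing kE charge_h2 => /intr_inj.
have iE : i = i0 by rewrite /i0; lia.
have jE : j = j0 by rewrite /j0 -iE; lia.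
split; [exact: gk|by rewrite kE iE jE|].
move: dv; rewrite (Fl_derivation q12_neq0 q_generic Fv) => /(congr1 (fcoef k)) dk.
have := etrans (etrans (esym (fcoefZ _ _ _)) dk) (fcoefZ _ _ _).
rewrite fcoef_diag mulrA {dk} => /mulIf dk.
have /dk : fcoef k v != 0 by apply/eqP.
rewrite [k]surjective_pairing kE charge_d => /intr_inj <-.
by rewrite /weight_quad iE jE.
Qed.

End WeightVectors.

(** * Counting occupation numbers *)

Section CountingOccupations.
Variable d : nat.
Notation T := ('I_d * 'I_3)%type.
Implicit Types (f : {ffun T -> 'I_d.+1}) (o : occupation).

(** [lift sa2] skips $a^2$, so that the three colours are $a^1$, $b$, $c$. *)
Definition mode (x : T) : 'I_4 * nat := (lift sa2 x.2, val x.1).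

Lemma mode_inj : injective mode.
Proof.
move=> [n s] [m t] E; have /= st := congr1 fst E; have /= nm := congr1 snd E.
by rewrite (lift_inj st) (val_inj nm).
Qed.

Definition occ_of f : occupation :=
  word_occ (flatten [seq nseq (f x) (mode x) | x <- enum {: T}]).

Lemma occ_ofE f y : occ_of f y = (\sum_(x : T) (mode x == y) * f x)%N.
Proof.
rewrite /occ_of word_occE count_flatten -map_comp sumnE big_map big_enum /=.
by apply: eq_bigr => x _; rewrite /= count_nseq.
Qed.

Lemma occ_of_mode f x : occ_of f (mode x) = f x.
Proof.
rewrite occ_ofE (bigD1 x) //= eqxx mul1n big1 ?addn0 // => y /negPf yx.
by rewrite (inj_eq mode_inj) yx.
Qed.

Lemma occ_of_outside f y : (forall x, mode x != y) -> occ_of f y = 0%N.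
Proof. by move=> xy; rewrite occ_ofE big1 // => x _; rewrite (negPf (xy x)). Qed.

Lemma occ_of_inj : injective occ_of.
Proof.
by move=> f g fg; apply/ffunP => x; apply/val_inj; rewrite /= -!occ_of_mode fg.
Qed.

Lemma good_occ_of f : good (occ_of f).
Proof.
apply/goodP => n; apply: occ_of_outside => x; apply/eqP => /(congr1 fst)/= E.
by have := neq_lift sa2 x.2; rewrite E eqxx.
Qed.

Lemma level_word w : level (word_occ w) = (\sum_(y <- w) y.2.+1)%N.
Proof.
elim: w => [|y w IH] /=; first by rewrite level0 big_nil.
by rewrite level_inc big_cons IH addnC.
Qed.

Lemma level_occ_of f : level (occ_of f) = (\sum_(x : T) x.1.+1 * f x)%N.
Proof.
rewrite /occ_of level_word big_flatten big_map big_enum /=.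
by apply: eq_bigr => x _; rewrite big_nseq iter_addn_0.
Qed.

Lemma occ_le_level o y : (o y * y.2.+1 <= level o)%N.
Proof.
have [yo|yo] := boolP (y \in finsupp o); last by rewrite (fsfun_dflt yo).
by rewrite /level (big_fsetD1 y) //= leq_addr.
Qed.

(** Each $2(n+1)\,o(s,n)$ is at most $d$, so an occupied mode has $n<d$ and every multiplicity is at
    most $d$: the finite type suffices and [inord] is exact. *)
Lemma occ_of_onto o : good o -> (2 * level o = d)%N ->
  exists f, o = occ_of f.
Proof.
move=> /goodP go od; exists [ffun x => inord (o (mode x))].
apply/fsfunP => -[s n]; have le := occ_le_level o (s, n).
have [[x xy]|nx] := pselect (exists x, mode x = (s, n)).
  rewrite -xy occ_of_mode ffunE inordK // xy ltnS.
  by move: (o (s, n)) le => /= c; nia.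
rewrite occ_of_outside; last by move=> x; apply/eqP => xy; apply: nx; exists x.
case: (unliftP sa2 s) nx le => [t ->|->] nx le; last exact: go.
have [nd|dn] := ltnP n d.
  by case: nx; exists (Ordinal nd, t).
by move: (o _) le => /= c; nia.
Qed.

Definition occupations_of_degree : {set {ffun T -> 'I_d.+1}} :=
  finset (fun f : {ffun T -> 'I_d.+1} => (\sum_(x : T) 2 * x.1.+1 * f x == d)%N).

Lemma occupations_of_degreeP o :
  (good o /\ (2 * level o = d)%N) <->
  (exists2 f, f \in occupations_of_degree & o = occ_of f).
Proof.
have lev f : (2 * level (occ_of f) = \sum_(x : T) 2 * x.1.+1 * f x)%N.
  by rewrite level_occ_of big_distrr /=; apply: eq_bigr => x _; rewrite mulnA.
split=> [[go lo]|[f]].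
  by have [f of_] := occ_of_onto go lo; exists f; rewrite // inE -lev -of_ lo.
by rewrite inE => /eqP fd ->; rewrite good_occ_of lev.
Qed.

(** The cube is a product over the three species. Distributing the product over the geometric sums
    chooses one exponent per mode, that is, a function [f] contributing $X$ to the power $\sum
    2(n+1)f$. *)
Lemma inv_euler3_coefE : inv_euler3_coef d = #|occupations_of_degree|%:Z.
Proof.
rewrite /inv_euler3_coef big_add1 /= big_mkord.
under eq_bigr => i _ do rewrite -[3%N]card_ord -prodr_const.
rewrite pair_big /= bigA_distr_bigA /= coef_sum.
rewrite -sum1_card -natz natr_sum [RHS]big_mkcond /=.
apply: eq_bigr => f _; rewrite -(expr_sum 'X) coefXn inE eq_sym.
by case: eqP.
Qed.

End CountingOccupations.

Section KetSpans.
Variable C : numClosedFieldType.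
Notation V := (fockmod C).

Lemma fcoef_kets n (w : 'I_n -> fockbasis C) (c : 'I_n -> C) k :
  fcoef k (\sum_i c i *: ket (w i).1 (w i).2) = \sum_i c i * (w i == k)%:R.
Proof.
rewrite fcoef_sum; apply: eq_bigr => i _; apply: etrans (fcoefZ _ _ _) _.
by rewrite fcoef_ket -surjective_pairing.
Qed.

Lemma gdim_kets n (w : 'I_n -> fockbasis C) : injective w ->
  gdim [set u : V | forall k, fcoef k u <> 0 -> exists i, k = w i] n.
Proof.
move=> winj; exists (fun i => ket (w i).1 (w i).2).
have coefw c j : fcoef (w j) (\sum_i c i *: ket (w i).1 (w i).2) = c j.
  rewrite fcoef_kets (bigD1 j) //= eqxx mulr1 big1 ?addr0 // => i /negPf ij.
  by rewrite (inj_eq winj) ij mulr0.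
split=> [c c0 i|v]; first by rewrite -(coefw c i) c0 fcoef0.
split=> [vw|[c ->] k].
  exists (fun i => fcoef (w i) v); apply: fcoef_ext => k.
  have [[i ->]|nk] := pselect (exists i, k = w i); first by rewrite coefw.
  rewrite fcoef_kets big1 => [|i _].
    by apply: contrapT => kv; apply/nk/vw.
  by case: eqP => [E|_]; [case: nk; exists i|rewrite mulr0].
rewrite fcoef_kets => k0; apply: contrapT => nk; apply: k0; apply: big1 => i _.
by case: eqP => [E|_]; [case: nk; exists i|rewrite mulr0].
Qed.

End KetSpans.

Definition euler_coef (d : int) : nat :=
  if d is Posz n then #|occupations_of_degree n| else 0%N.

Lemma inv_euler3E (d : int) : inv_euler3 d 0 0 = (euler_coef d)%:Z.
Proof. by case: d => n //; rewrite /inv_euler3 /= inv_euler3_coefE. Qed.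

Section UgoodDimension.
Variables (C : numClosedFieldType) (q12 : C) (alpha : int) (beta : C).
Variables (e p r : int).

Lemma Ugood_gdim l : gdim (Ugood (C:=C) alpha beta e p r l)
  (euler_coef (e - weight_quad alpha p r l)).
Proof.
case E : (e - weight_quad alpha p r l) => [n|n] /=; last first.
  exists (fun _ => 0); split=> [c _ []//|v]; split=> [Uv|[c ->]].
    exists (fun _ => 0); rewrite big_ord0; apply: fcoef_ext => k; rewrite fcoef0.
    by apply: contrapT => /Uv[_ _]; lia.
  by rewrite big_ord0 => k; rewrite fcoef0.
pose w (i : 'I_#|occupations_of_degree n|) : fockbasis C :=
  (weight_charge alpha beta p r l, occ_of (enum_val i)).
have winj : injective w by move=> i j [/occ_of_inj /enum_val_inj].
have := gdim_kets winj; congr gdim; apply/seteqP.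
have key k : (exists i, k = w i) <-> [/\ good k.2, k.1 = weight_charge alpha beta p r l
    & 2 * (level k.2)%:Z + weight_quad alpha p r l = e].
  split=> [[i ->]|[gk kc lk]] /=.
    have [|go lo] := iffRL (occupations_of_degreeP n (occ_of (enum_val i))).
      by exists (enum_val i) => //; exact: enum_valP.
    by split=> //; lia.
  have [|f fn kf] := iffLR (occupations_of_degreeP n k.2).
    by split=> //; lia.
  exists (enum_rank_in fn f); rewrite [k]surjective_pairing kc kf /w.
  by rewrite enum_rankK_in.
by split=> u Uu k /Uu /key.
Qed.

End UgoodDimension.

Section WeightDimensions.
Variables (C : numClosedFieldType) (q12 : C).
Hypothesis q12_neq0 : q12 != 0.
Hypothesis q_generic : forall n : nat, (0 < n)%N -> (q12 ^+ 2) ^+ n != 1.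
Variables (alpha : int) (beta : C).
Notation V := (fockmod C).
Notation eta := (Defs.eta q12 0).
Notation xi := (Defs.xi q12 0).
Notation Fl := (Fl q12 alpha beta).
Implicit Types (v w u : V) (l : int).

Lemma has_dim_gdim (W : set V) n : has_dim W n <-> gdim W n.
Proof. by []. Qed.

Let SP l v : Fl l v -> sigma q12 (goodpart v) = v.
Proof. exact: (Fl_sigma_goodpart q12_neq0). Qed.
Let eta_F l v : Fl l v -> Fl (l + 1) (eta v). Proof. exact: Fl_eta. Qed.
Let xi_F l v : Fl l v -> Fl (l - 1) (xi v). Proof. exact: Fl_xi. Qed.
Let eta_sq l v : Fl l v -> eta (eta v) = 0.
Proof. exact: (Fl_eta_sq q12_neq0 q_generic). Qed.
Let homotopy l v : Fl l v -> eta (xi v) + xi (eta v) = v.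
Proof. exact: (Fl_homotopy q12_neq0 q_generic). Qed.

Section FixedWeight.
Variables e p r : int.
Notation X := (joint_eigen q12 e p r).
Notation U := (Ugood alpha beta e p r).
Notation dims := (fun l : int => euler_coef (e - weight_quad alpha p r l)).

Let F_U l v : Fl l v -> X v -> U l (goodpart v).
Proof. exact: (joint_eigen_Ugood q12_neq0 q_generic). Qed.
Let U_F l u : U l u -> Fl l (sigma q12 u).
Proof. exact: sigma_Ugood_Fl. Qed.
Let U_X l u : U l u -> X (sigma q12 u).
Proof. exact: (Ugood_joint_eigen q12_neq0 q_generic). Qed.
Let PS l u : U l u -> goodpart (sigma q12 u) = u.
Proof. exact: (goodpart_sigma_Ugood q12_neq0). Qed.
Let U_eta l u : U l u -> U (l + 1) (eta u).
Proof. exact: Ugood_eta. Qed.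
Let U_xi l u : U l u -> U (l - 1) (xi u).
Proof. exact: Ugood_xi. Qed.

Lemma Fl_weight_dim l : has_dim (weight_space q12 (Fl l) e p r) (dims l).
Proof.
rewrite weight_spaceE; apply/has_dim_gdim.
exact: (@weight_gdim C V (@goodpart C) (sigma q12) Fl X U dims SP F_U U_F U_X PS
  (Ugood_gdim alpha beta e p r) l).
Qed.

Lemma ker_coker_weight_dim : exists s : int -> nat,
  [/\ forall l, (s l + s (l - 1)%R)%N = dims l,
      has_dim (weight_space q12 (Ker q12 (Fl 0)) e p r) (s (- 1)) &
      has_dim (weight_space q12 (Coker q12 (Fl 0)) e p r) (s 0)].
Proof.
have [s [sn sk sc]] := @weight_ker_coker_gdim C V eta xi (@goodpart C) (sigma q12)
  Fl X U dims eta_F xi_F eta_sq homotopy SP (goodpart_eta q12) (goodpart_xi q12)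
  F_U U_F U_X PS U_eta U_xi (Ugood_gdim alpha beta e p r).
exists s; split=> //; rewrite weight_spaceE; apply/has_dim_gdim.
  exact: (sk 0).
exact: (sc 0).
Qed.

Lemma sigma_Ugood_weight l u : U l u -> weight_space q12 (Fl l) e p r (sigma q12 u).
Proof. by move=> Uu; rewrite weight_spaceE; split; [exact: U_F|exact: U_X Uu]. Qed.

Lemma weight_ker v : weight_space q12 (Fl 0) e p r v ->
  weight_space q12 (Ker q12 (Fl 0)) e p r (eta (xi v)).
Proof.
rewrite !weight_spaceE => -[Fv Xv]; split; first by exists v.
exact: (@X_eta_xi C V eta xi (@goodpart C) (sigma q12) Fl X U eta_F xi_F SP
  (goodpart_eta q12) (goodpart_xi q12) F_U U_X U_eta U_xi 0 v Fv Xv).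
Qed.

Lemma weight_coker v : weight_space q12 (Fl 0) e p r v ->
  weight_space q12 (Coker q12 (Fl 0)) e p r (xi (eta v)).
Proof.
rewrite !weight_spaceE => -[Fv Xv]; split; first by exists v.
exact: (@X_xi_eta C V eta xi (@goodpart C) (sigma q12) Fl X U eta_F xi_F SP
  (goodpart_eta q12) (goodpart_xi q12) F_U U_X U_eta U_xi 0 v Fv Xv).
Qed.

End FixedWeight.

Definition weight_sum (W : set V) v := exists (n : nat) (w : 'I_n -> V),
  (forall i, exists e p r, weight_space q12 W e p r (w i)) /\ v = \sum_i w i.

Lemma weight_sum_map (W W' : set V) (f : {linear V -> V}) v :
  (forall e p r u, weight_space q12 W e p r u -> weight_space q12 W' e p r (f u)) ->
  weight_sum W v -> weight_sum W' (f v).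
Proof.
move=> fW [n [w [ww ->]]]; exists n, (fun i => f (w i)); split=> [i|].
  by have [e [p [r wi]]] := ww i; exists e, p, r; exact: fW.
exact: (linear_sum f).
Qed.

(** Monomials of $v$ itself may lie outside [Fl]; those of [goodpart v] are mapped by [sigma] to
    weight vectors in [Fl] with sum $v$. *)
Lemma Fl_weight_sum l v : Fl l v -> weight_sum (Fl l) v.
Proof.
move=> Fv; pose u := goodpart v.
pose x (k : fockbasis C) : V := fcoef k u *: ket k.1 k.2.
exists (size (msupp u)), (fun i => sigma q12 (x (tnth (in_tuple (msupp u)) i))).
split=> [i|]; last first.
  rewrite -(big_tnth _ _ _ xpredT (fun k => sigma q12 (x k))) -(linear_sum (sigma q12)).
  by rewrite -fcoef_expand; exact: (esym (SP Fv)).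
have := mem_tnth i (in_tuple (msupp u)); move: (tnth _ _) => k /=.
rewrite fcoef_supp => /eqP ku.
have gk : good k.2.
  move: ku; rewrite /u goodpart_diag fcoef_diag => ku.
  by apply: contra_notT ku => /negPf->; exact: mul0r.
have kv : fcoef k v <> 0.
  by move=> kv; apply: ku; rewrite /u goodpart_diag fcoef_diag kv; exact: mulr0.
have [i1 [j1 kE]] := Fl_charges Fv kv.
exists (2 * (level k.2)%:Z + quad alpha l i1 j1), (2 * i1 - j1), (alpha - i1).
apply: sigma_Ugood_weight => k'.
have -> : fcoef k' (x k) = fcoef k u * (k == k')%:R.
  apply: etrans (fcoefZ _ _ _) _; by rewrite fcoef_ket -surjective_pairing.
have [<- _|_] := eqVneq k k'; last by rewrite mulr0.
have iE : alpha - (alpha - i1) = i1 by lia.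
have jE : 2 * i1 - (2 * i1 - j1) = j1 by lia.
by split; rewrite // /weight_charge /weight_quad iE jE.
Qed.

Lemma Ker_weight_sum v : Ker q12 (Fl 0) v -> weight_sum (Ker q12 (Fl 0)) v.
Proof.
move=> [u /Fl_weight_sum Fu <-].
exact: (@weight_sum_map (Fl 0) (Ker q12 (Fl 0)) (eta \o xi) u weight_ker Fu).
Qed.

Lemma Coker_weight_sum v : Coker q12 (Fl 0) v -> weight_sum (Coker q12 (Fl 0)) v.
Proof.
move=> [u /Fl_weight_sum Fu <-].
exact: (@weight_sum_map (Fl 0) (Coker q12 (Fl 0)) (xi \o eta) u weight_coker Fu).
Qed.

Lemma Fl_has_character l : has_character q12 (Fl l).
Proof.
split=> [v|e p r]; first exact: Fl_weight_sum.
by exists (euler_coef (e - weight_quad alpha p r l)); exact: Fl_weight_dim.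
Qed.

Lemma Ker_has_character : has_character q12 (Ker q12 (Fl 0)).
Proof.
split=> [v|e p r]; first exact: Ker_weight_sum.
by have [s [_ sk _]] := ker_coker_weight_dim e p r; exists (s (- 1)).
Qed.

Lemma Coker_has_character : has_character q12 (Coker q12 (Fl 0)).
Proof.
split=> [v|e p r]; first exact: Coker_weight_sum.
by have [s [_ _ sc]] := ker_coker_weight_dim e p r; exists (s 0).
Qed.

Lemma character_dim (W : set V) e p r n : has_dim (weight_space q12 W e p r) n ->
  character q12 W e p r = n%:Z.
Proof.
move=> Wn; rewrite /character; congr Posz.
by apply: xget_unique => //= m Wm; exact: gdim_uniq Wm Wn.
Qed.

End WeightDimensions.

(** * Formal series *)

Lemma fsum_single (I : choiceType) (W : zmodType) (D : set I) (F : I -> W) i0 :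
  D i0 -> (forall i, D i -> i != i0 -> F i = 0) -> \sum_(i \in D) F i = F i0.
Proof.
move=> D0 F0; rewrite (fsbigE [:: i0]) // => [|i /=|i Di].
- by rewrite big_mkcond big_seq1 mem_set.
- by rewrite inE => /eqP->.
by rewrite inE => /F0; exact.
Qed.

Section ThetaProduct.
Variables (alpha : int) (ex : int -> int -> nat -> int).
Hypothesis ex_large : forall i j e, exists L, forall l, (L <= l)%N -> e < ex i j l.

Definition theta_term (t : int * int * nat) : fseries :=
  fscale ((-1) ^+ t.2.+1)
    (monomial (ex t.1.1 t.1.2 t.2) (2 * t.1.1 - t.1.2) (alpha - t.1.1)).
Notation theta := (fsum theta_index theta_term).

Lemma monomial_neq0 e p r e' p' r' : monomial e p r e' p' r' <> 0 ->
  [/\ e' = e, p' = p & r' = r].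
Proof. by rewrite /monomial; case: andP => // -[/andP[/eqP-> /eqP->] /eqP->]. Qed.

Lemma theta_term_neq0 i j l e p r : theta_term (i, j, l) e p r <> 0 ->
  [/\ i = alpha - r, j = 2 * (alpha - r) - p & e = ex i j l].
Proof.
move=> /eqP; rewrite /theta_term /fscale mulf_eq0 negb_or => /andP[_ /eqP].
by move/monomial_neq0 => [/= -> -> ->]; split=> //; lia.
Qed.

Lemma theta_term_eq l e p r : let i := alpha - r in let j := 2 * i - p in
  theta_term (i, j, l) e p r = (-1) ^+ l.+1 * (e == ex i j l)%:R.
Proof.
move=> i j; rewrite /theta_term /fscale /monomial /=; congr (_ * _%:R).
have -> : p == 2 * i - j by apply/eqP; rewrite /j; lia.
have -> : r == alpha - i by apply/eqP; rewrite /i; lia.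
by rewrite !andbT.
Qed.

(** The exponents of $x$ and $y$ determine $i$ and $j$, and growth of [ex] in $l$ leaves finitely
    many $l$ for a given power of $q$. *)
Lemma theta_summable : fsummable theta_index theta_term.
Proof.
move=> e p r; pose i := alpha - r; pose j := 2 * i - p.
have [L exL] := ex_large i j e.
apply: (sub_finite_set _ (finite_seq [seq (i, j, l) | l <- iota 0 L])).
move=> [[i' j'] l] [_ /theta_term_neq0[iE jE eE]] /=.
apply/mapP; exists l; last by rewrite iE jE.
rewrite mem_iota /= add0n ltnNge; apply/negP => /exL.
by rewrite eE iE jE ltxx.
Qed.

Lemma theta_coef L e p r : let i := alpha - r in let j := 2 * i - p in
  (forall l, (L <= l)%N -> e < ex i j l) ->
  theta e p r = \sum_(l < L) (-1) ^+ l.+2 * (e == ex i j l.+1)%:R.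
Proof.
move=> i j exL; rewrite /fsum (fsbigE [seq (i, j, l) | l <- iota 1 L]).
- rewrite big_map -[1%N]addn0 iotaDl big_map -{1}[L]subn0 -/(index_iota 0 L) big_mkord.
  apply: eq_big => [l|l _]; first exact: mem_set.
  by rewrite theta_term_eq add1n.
- by rewrite map_inj_uniq ?iota_uniq // => l m [].
- by move=> t /= /mapP[l]; rewrite mem_iota => /andP[l0 _] ->.
move=> [[i' j'] l] l0 out; apply: contrapT => /theta_term_neq0[iE jE eE].
case/negP: out; apply/mapP; exists l; last by rewrite iE jE.
rewrite mem_iota; apply/andP; split; first exact: l0.
rewrite add1n ltnS leqNgt; apply/negP => /ltnW/exL.
by rewrite eE iE jE ltxx.
Qed.

Lemma monomial_mulable e0 (f : fseries) : fmulable (monomial e0 0 0) f.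
Proof.
move=> e p r; apply: (sub_finite_set _ (finite_set1 (e0, 0, 0))).
move=> [[e' p'] r'] [_ /eqP]; rewrite /fmul_term mulf_eq0 negb_or => /andP[/eqP + _].
by move=> /monomial_neq0[/= -> -> ->].
Qed.

Lemma prefactorE e p r :
  prefactor alpha e p r = inv_euler3 (e + alpha * (alpha + 1)) p r.
Proof.
rewrite /prefactor /fmul /fsum (@fsum_single _ _ _ _ (- (alpha * (alpha + 1)), 0, 0)) //.
  by rewrite /fmul_term /monomial !eqxx mul1r opprK !subr0.
move=> [[e' p'] r'] _ ne; apply: contraNeq ne.
rewrite /fmul_term mulf_eq0 negb_or => /andP[/eqP + _].
by move=> /monomial_neq0[/= -> -> ->].
Qed.

Lemma prefactor_neq0 e p r : prefactor alpha e p r <> 0 ->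
  [/\ - (alpha * (alpha + 1)) <= e, p = 0 & r = 0].
Proof.
rewrite prefactorE /inv_euler3.
case: ifP => // /andP[/andP[e0 /eqP-> ] /eqP->] _; split=> //; lia.
Qed.

Section Coefficient.
Variables e p r : int.
Let i : int := alpha - r.
Let j : int := 2 * i - p.
Notation A := (alpha * (alpha + 1)).

(** The prefactor contains neither $x$ nor $y$ and starts at $q^{-\alpha(\alpha+1)}$, so only theta
    terms with exponent at most $e+\alpha(\alpha+1)$ are met. *)
Lemma product_support : exists L : nat,
  (forall l, (L <= l)%N -> e + A < ex i j l) /\
  (forall t, fmul_term (prefactor alpha) theta t e p r <> 0 ->
    t.1.2 = 0 /\ t.2 = 0 /\ t.1.1 \in undup [seq e - ex i j l.+1 | l <- iota 0 L]).
Proof.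
have [L exL] := ex_large i j (e + A); exists L; split=> // -[[t1 t2] t3].
move=> /eqP; rewrite /fmul_term mulf_eq0 negb_or => /andP[/eqP + /eqP] /=.
move=> /prefactor_neq0[/= t1A -> ->]; rewrite !subr0 => th; split=> //; split=> //.
apply: contrapT => out; apply: th; rewrite (@theta_coef L); last first.
  by move=> l /exL; rewrite -/i -/j; lia.
apply: big1 => l _; case: eqP => [E|_]; last by rewrite mulr0.
case: out; rewrite mem_undup; apply/mapP; exists (val l); last by rewrite -E; lia.
by rewrite mem_iota /= ltn_ord.
Qed.

Lemma product_coef : fmul (prefactor alpha) theta e p r =
  \sum_(l \in pos_nat) (-1) ^+ l.+1 * inv_euler3 (e + A - ex i j l) 0 0.
Proof.
have [L [exL supp]] := product_support.
(* Different $l$ may share an exponent, so [R] lists powers of $q$ without repetition; the inner sum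
   over $l$ restores the multiplicity. *)
pose R := undup [seq e - ex i j l.+1 | l <- iota 0 L].
rewrite /fmul {1}/fsum (fsbigE [seq (t, 0, 0) | t <- R]); first last.
- move=> [[t1 t2] t3] _ out; apply: contrapT => /supp[/= t20 [t30 tR]].
  by case/negP: out; apply/mapP; exists t1; rewrite // t20 t30.
- by [].
- by rewrite map_inj_uniq ?undup_uniq // => x y [].
rewrite big_map (@fsum_positive _ _ L); last first.
  move=> l /exL lt; rewrite /inv_euler3; case: ifP => [|_]; last by rewrite mulr0.
  by move=> /andP[/andP[]]; lia.
transitivity (\sum_(t <- R) \sum_(l < L)
    (-1) ^+ l.+2 * (inv_euler3 (t + A) 0 0 * (t == e - ex i j l.+1)%:R)).
  apply: eq_big => [t|t _]; first exact: mem_set.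
  rewrite /fmul_term /= prefactorE !subr0.
  (* For $t < -A$ the prefactor vanishes; for $t \ge -A$ the bound at $e+A$ also bounds the theta
     exponents at $e-t$. *)
  have [tA|tA] := leP (- A) t; last first.
    have -> : inv_euler3 (t + A) 0 0 = 0.
      by rewrite /inv_euler3; case: ifP => // /andP[/andP[]]; lia.
    by rewrite mul0r big1 // => l _; rewrite mul0r mulr0.
  rewrite (@theta_coef L); last by move=> l /exL; rewrite -/i -/j; lia.
  rewrite mulr_sumr; apply: eq_bigr => l _; rewrite mulrCA -/i -/j.
  by congr (_ * (_ * _%:R)); apply/eqP/eqP; lia.
rewrite exchange_big; apply: eq_bigr => l _; rewrite -mulr_sumr; congr (_ * _).
have lR : e - ex i j l.+1 \in R.
  by rewrite mem_undup; apply/mapP; exists (val l); rewrite // mem_iota /= ltn_ord.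
rewrite (bigD1_seq _ lR) ?undup_uniq //= eqxx mulr1 big1 => [|t /negPf->].
  by rewrite addr0 addrAC.
by rewrite mulr0.
Qed.

End Coefficient.

Lemma product_mulable : fmulable (prefactor alpha) theta.
Proof.
move=> e p r; have [L [_ supp]] := product_support e p r.
set R := undup _ in supp.
apply: (sub_finite_set _ (finite_seq [seq (t, 0 : int, 0 : int) | t <- R])).
move=> [[t1 t2] t3] [_ /supp[/= -> [-> tR]]].
by apply/mapP; exists t1.
Qed.

End ThetaProduct.

(** With this [L], the second factor of $l(l-1+2c)$ is at least $|e-k|+1$ and the first is
    positive. *)
Lemma quadratic_large (c k e : int) : exists L : nat, forall l : nat, (L <= l)%N ->
  e < l%:Z * (l%:Z - 1) + 2 * l%:Z * c + k.
Proof. by exists (`|e - k| + 2 * `|c| + 2)%N => l lL; nia. Qed.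

(** * Characters of kernel and cokernel *)

Section Characters.
Variable alpha : int.

Definition ker_exponent (i j : int) (l : nat) : int :=
  l%:Z * (l%:Z - 1) + 2 * l%:Z * (alpha - j)
  + (2 * i ^+ 2 - 2 * i * j + j ^+ 2 + j).
Definition coker_exponent (i j : int) (l : nat) : int :=
  l%:Z * (l%:Z + 1) - 2 * l%:Z * (alpha - j)
  + (2 * i ^+ 2 - 2 * i * j + j ^+ 2 + j).

Lemma ker_termE : ker_term alpha = theta_term alpha ker_exponent.
Proof. by apply/funext => -[[i j] l]. Qed.
Lemma coker_termE : coker_term alpha = theta_term alpha coker_exponent.
Proof. by apply/funext => -[[i j] l]. Qed.

Lemma ker_exponent_large i j e :
  exists L, forall l, (L <= l)%N -> e < ker_exponent i j l.
Proof. exact: quadratic_large. Qed.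
Lemma coker_exponent_large i j e :
  exists L, forall l, (L <= l)%N -> e < coker_exponent i j l.
Proof.
(* Uses $l(l+1)-2l(\alpha-j) = l(l-1)+2l(1-(\alpha-j))$. *)
have [L HL] := quadratic_large (1 - (alpha - j))
  (2 * i ^+ 2 - 2 * i * j + j ^+ 2 + j) e.
exists L => l /HL; congr (_ < _); rewrite /coker_exponent; ring.
Qed.

Lemma weight_quad_ker p r (l : nat) : let i := alpha - r in
  weight_quad alpha p r (- l%:Z) =
  ker_exponent i (2 * i - p) l - alpha * (alpha + 1).
Proof. by rewrite /weight_quad /quad /ker_exponent /=; ring. Qed.
Lemma weight_quad_coker p r (l : nat) : let i := alpha - r in
  weight_quad alpha p r l =
  coker_exponent i (2 * i - p) l - alpha * (alpha + 1).
Proof. by rewrite /weight_quad /quad /coker_exponent /=; ring. Qed.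

Lemma euler_coef_lt0 d : d < 0 -> euler_coef d = 0%N.
Proof. by case: d. Qed.

Section SignedSequence.
Variables (e p r : int) (ex : int -> int -> nat -> int) (w : nat -> int).
Hypothesis ex_large : forall i j e', exists L, forall l, (L <= l)%N -> e' < ex i j l.
Hypothesis wE : forall l, w l =
  ex (alpha - r) (2 * (alpha - r) - p) l - alpha * (alpha + 1).

Lemma weight_vanish : exists L, forall l, (L <= l)%N -> euler_coef (e - w l) = 0%N.
Proof.
have [L HL] := ex_large (alpha - r) (2 * (alpha - r) - p) (e + alpha * (alpha + 1)).
by exists L => l /HL lt; apply: euler_coef_lt0; rewrite wE; lia.
Qed.

Lemma weight_alternating (s : nat -> nat) :
  (forall l, (s l + s l.+1)%N = euler_coef (e - w l.+1)) ->
  \sum_(l \in pos_nat) (-1) ^+ l.+1 * (euler_coef (e - w l))%:Z = (s 0%N)%:Z.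
Proof.
move=> sw; have [L wL] := weight_vanish.
apply: (@alternating_fsum (fun l => (s l)%:Z) (fun l => (euler_coef (e - w l))%:Z) L).
  by move=> l; rewrite -sw.
move=> l lL; have := sw l; rewrite wL; last exact: leqW.
by case: (s l).
Qed.

Lemma weight_product :
  fmul (prefactor alpha) (fsum theta_index (theta_term alpha ex)) e p r =
  \sum_(l \in pos_nat) (-1) ^+ l.+1 * (euler_coef (e - w l))%:Z.
Proof.
rewrite (product_coef alpha ex_large); apply: eq_fsbigr => l _.
by rewrite wE -inv_euler3E opprB addrA.
Qed.

End SignedSequence.

Variables (C : numClosedFieldType) (q12 : C) (beta : C).
Hypothesis q12_neq0 : q12 != 0.
Hypothesis q_generic : forall n : nat, (0 < n)%N -> (q12 ^+ 2) ^+ n != 1.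
Notation Fl := (Fl q12 alpha beta).
Notation chF l := (character q12 (Fl l)).

Lemma chF_coef e p r l : chF l e p r = (euler_coef (e - weight_quad alpha p r l))%:Z.
Proof. exact/character_dim/Fl_weight_dim. Qed.

Lemma summable_alternating (ex : int -> int -> nat -> int) (z : nat -> int) :
  (forall i j e, exists L, forall l, (L <= l)%N -> e < ex i j l) ->
  (forall p r l, weight_quad alpha p r (z l) =
    ex (alpha - r) (2 * (alpha - r) - p) l - alpha * (alpha + 1)) ->
  fsummable pos_nat (fun l : nat => fscale ((-1) ^+ l.+1) (chF (z l))).
Proof.
move=> ex_large zE e p r.
have [L vL] := @weight_vanish e p r ex _ ex_large (zE p r).
apply: (sub_finite_set _ (finite_seq (iota 0 L))) => l [_].
rewrite /fscale chF_coef /= mem_iota add0n ltnNge => ne.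
by apply/negP => /vL v0; apply: ne; rewrite v0 mulr0.
Qed.

(** The kernel has dimension $s_{-1}$ and the complex is followed downwards: $s_{-1-l}+s_{-2-l}$ is
    the dimension in degree $-(l+1)$. The cokernel starts at $s_0$ and is followed upwards. *)
Lemma character_ker e p r : character q12 (Ker q12 (Fl 0)) e p r =
  \sum_(l \in pos_nat) (-1) ^+ l.+1 *
    (euler_coef (e - weight_quad alpha p r (- l%:Z)))%:Z.
Proof.
have [s [sD sker _]] := ker_coker_weight_dim q12_neq0 q_generic alpha beta e p r.
rewrite (character_dim sker); apply/esym.
apply: (@weight_alternating e p r ker_exponent _ ker_exponent_large
  (weight_quad_ker p r) (fun l : nat => s (- 1 - l%:Z))) => l.
rewrite -sD; congr (s _ + s _)%N; lia.
Qed.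

Lemma character_coker e p r : character q12 (Coker q12 (Fl 0)) e p r =
  \sum_(l \in pos_nat) (-1) ^+ l.+1 *
    (euler_coef (e - weight_quad alpha p r l))%:Z.
Proof.
have [s [sD _ scoker]] := ker_coker_weight_dim q12_neq0 q_generic alpha beta e p r.
rewrite (character_dim scoker); apply/esym.
apply: (@weight_alternating e p r coker_exponent _ coker_exponent_large
  (weight_quad_coker p r) (fun l : nat => s l%:Z)) => l.
rewrite -sD addnC; congr (s _ + s _)%N; lia.
Qed.

End Characters.

Unset Implicit Arguments.
Theorem proposition3 (C : numClosedFieldType) (q12 : C)
    (q12_neq0 : q12 != 0)
    (q_generic : forall n : nat, (0 < n)%N -> (q12 ^+ 2) ^+ n != 1)
    (alpha : int) (beta : C) :
  let KerF := Ker q12 (F0 q12 alpha beta) in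
  let CokerF := Coker q12 (F0 q12 alpha beta) in
  let chF l := character q12 (Fl q12 alpha beta l) in
  let altF_ker (l : nat) := fscale ((-1) ^+ l.+1) (chF (- l%:Z)) in
  let altF_coker (l : nat) := fscale ((-1) ^+ l.+1) (chF l%:Z) in
  let theta_ker := fsum theta_index (ker_term alpha) in
  let theta_coker := fsum theta_index (coker_term alpha) in
  (* all the characters, sums and products below are well defined *)
  [/\ forall l, has_character q12 (Fl q12 alpha beta l),
      has_character q12 KerF
    & has_character q12 CokerF] /\
  [/\ fsummable pos_nat altF_ker, fsummable theta_index (ker_term alpha),
      fmulable (monomial (- (alpha * (alpha + 1))) 0 0) inv_euler3
    & fmulable (prefactor alpha) theta_ker] /\
  [/\ fsummable pos_nat altF_coker, fsummable theta_index (coker_term alpha)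
    & fmulable (prefactor alpha) theta_coker] /\
  [/\ character q12 KerF = character q12 (Ker q12 (Fl q12 alpha beta 0)),
      character q12 KerF = fsum pos_nat altF_ker
    & character q12 KerF = fmul (prefactor alpha) theta_ker] /\
  [/\ character q12 CokerF = character q12 (Coker q12 (Fl q12 alpha beta 0)),
      character q12 CokerF = fsum pos_nat altF_coker
    & character q12 CokerF = fmul (prefactor alpha) theta_coker].
Proof.
move=> KerF CokerF chF altF_ker altF_coker theta_ker theta_coker.
have ker_large := @ker_exponent_large alpha.
have coker_large := @coker_exponent_large alpha.
have kerE : theta_ker = fsum theta_index (theta_term alpha (ker_exponent alpha)).
  by rewrite /theta_ker ker_termE.
have cokerE : theta_coker = fsum theta_index (theta_term alpha (coker_exponent alpha)).
  by rewrite /theta_coker coker_termE.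
split; last split; last split; last split.
- split=> [l||].
  + exact: Fl_has_character.
  + exact: Ker_has_character.
  exact: Coker_has_character.
- split.
  + exact: (@summable_alternating alpha C q12 beta q12_neq0 q_generic
      (ker_exponent alpha) (fun l : nat => - l%:Z) ker_large (weight_quad_ker alpha)).
  + by rewrite ker_termE; exact: theta_summable.
  + exact: monomial_mulable.
  by rewrite kerE; exact: product_mulable.
- split.
  + exact: (@summable_alternating alpha C q12 beta q12_neq0 q_generic
      (coker_exponent alpha) Posz coker_large (weight_quad_coker alpha)).
  + by rewrite coker_termE; exact: theta_summable.
  by rewrite cokerE; exact: product_mulable.
- split=> //; apply/funext => e; apply/funext => p; apply/funext => r.
  + rewrite /KerF (character_ker alpha beta q12_neq0 q_generic).
    apply: eq_fsbigr => l _; rewrite /altF_ker /fscale.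
    by rewrite /chF (chF_coef alpha beta q12_neq0 q_generic).
  rewrite /KerF (character_ker alpha beta q12_neq0 q_generic) kerE.
  by rewrite (@weight_product alpha e p r (ker_exponent alpha) _ ker_large
    (weight_quad_ker alpha p r)).
split=> //; apply/funext => e; apply/funext => p; apply/funext => r.
+ rewrite /CokerF (character_coker alpha beta q12_neq0 q_generic).
  apply: eq_fsbigr => l _; rewrite /altF_coker /fscale.
  by rewrite /chF (chF_coef alpha beta q12_neq0 q_generic).
rewrite /CokerF (character_coker alpha beta q12_neq0 q_generic) cokerE.
by rewrite (@weight_product alpha e p r (coker_exponent alpha) _ coker_large
    (weight_quad_coker alpha p r)).
Qed.
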